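(* Let $\gamma\in(0,1)$. Then the following two statements hold. (i) $\mathrm{PBMO}^-(\gamma)=\mathrm{BMO}^+(\gamma)=-\mathrm{BMO}^-(\gamma)$. Moreover, for any $f\in L^1_{\mathrm{loc}}$, $$\|f\|_{\mathrm{PBMO}^-(\gamma)}\sim\|f\|_{\mathrm{BMO}^+(\gamma)}\sim\|-f\|_{\mathrm{BMO}^-(\gamma)},$$ where the positive equivalence constants are independent of $f$. (ii) $A_\infty^+(\gamma)=\bigcup_{r\in[1,\infty)}A_r^+(\gamma)$.
   Context: Work in $\mathbb{R}^{n+1}$, with points $(x,t)$, $x\in\mathbb{R}^n$, $t\in\mathbb{R}$; $p\in(1,\infty)$ is fixed throughout. $Q(x,L)=\{y\in\mathbb{R}^n: x_i-\frac L2\le y_i<x_i+\frac L2 \text{ for all } i\in\{1,\dots,n\}\}$. A parabolic rectangle centered at $(x,t)$ with edge length $l(R):=L\in(0,\infty)$ is $R=R(x,t,L)=Q(x,L)\times[t-L^p,t+L^p)$; $\mathcal{R}$ is the set of all parabolic rectangles. For $\gamma\in[0,1)$ (the time lag), $R^-(\gamma)=Q(x,L)\times[t-L^p,t-\gamma L^p)$ and $R^+(\gamma)=Q(x,L)\times[t+\gamma L^p,t+L^p)$. $f_A=\fint_A f=\frac1{|A|}\int_A f$ (Lebesgue measure $dx\,dt$), $f_+=\max\{f,0\}$, $f_-=-\min\{f,0\}$. $L^1_{\mathrm{loc}}$ is the set of all locally integrable (real-valued) functions on $\mathbb{R}^{n+1}$. A weight is a nonnegative locally integrable function on $\mathbb{R}^{n+1}$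 that is positive almost everywhere. $F\sim G$ means that each is bounded by a positive constant times the other. $\mathrm{PBMO}^-(\gamma)$, $\mathrm{BMO}^+(\gamma)$, $\mathrm{BMO}^-(\gamma)$ are the sets of all $f\in L^1_{\mathrm{loc}}$ for which, respectively, the following quantities are finite: $$\|f\|_{\mathrm{PBMO}^-(\gamma)}=\sup_{R\in\mathcal{R}}\inf_{c\in\mathbb{R}}\Big[\fint_{R^-(\gamma)}(f-c)_++\fint_{R^+(\gamma)}(f-c)_-\Big],$$ $$\|f\|_{\mathrm{BMO}^+(\gamma)}=\sup_{R\in\mathcal{R}}\fint_{R^-(\gamma)}[f-f_{R^+(\gamma)}]_+,\qquad \|f\|_{\mathrm{BMO}^-(\gamma)}=\sup_{R\in\mathcal{R}}\fint_{R^+(\gamma)}[f-f_{R^-(\gamma)}]_+.$$ $-\mathrm{BMO}^-(\gamma)=\{f:\,-f\in\mathrm{BMO}^-(\gamma)\}$. For $r\in[1,\infty]$, $A_r^+(\gamma)$ is the set of all weights $w$ with $[w]_{A_r^+(\gamma)}<\infty$, where $[w]_{A_1^+(\gamma)}=\sup_{R\in\mathcal{R}}\fint_{R^-(\gamma)}w\,[\operatorname{ess\,inf}_{R^+(\gamma)}w]^{-1}$; for $r\in(1,\infty)$, $[w]_{A_r^+(\gamma)}=\sup_{R\in\mathcal{R}}\fint_{R^-(\gamma)}w\,\big[\fint_{R^+(\gamma)}w^{\frac1{1-r}}\big]^{r-1}$; and $[w]_{A_\infty^+(\gamma)}=\sup_{R\in\mathcal{R}}\fint_{R^-(\gamma)}w\,\exp\big\{\fint_{R^+(\gamma)}\ln\frac1w\big\}$.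 *)

(* Defs.v *)
From HB Require Import structures.
From mathcomp Require Import all_boot all_order all_algebra.
From mathcomp Require Import all_classical all_reals all_analysis.
From mathcomp Require Import ess_sup_inf.

Set Implicit Arguments.
Unset Strict Implicit.
Unset Printing Implicit Defensive.

Import Order.TTheory GRing.Theory Num.Theory.
Import numFieldNormedType.Exports.

Local Open Scope classical_set_scope.
Local Open Scope ring_scope.

(* Lebesgue measure on R^n, on the Borel sigma-algebra of n.-tuple R, as an
   iterated product of the one-dimensional Lebesgue measure. *)
Section lebesgue_tuple.
Context {R : realType}.

Local Notation T n := (n.-tuple (measurableTypeR R)).

Definition tuple_cons n (z : T n * measurableTypeR R) : T n.+1 :=
  [the n.+1.-tuple _ of z.2 :: z.1].

Lemma measurable_tuple_cons n : measurable_fun setT (@tuple_cons n).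
Proof. exact: measurable_cons. Qed.

Section step.
Context n (mu : {measure set (T n) -> \bar R}).

Definition lebesgue_tupleS : set (T n.+1) -> \bar R :=
  pushforward (mu \x @lebesgue_measure R)%E (@tuple_cons n).

Let tuple_cons_preimage (A : set (T n.+1)) :
  measurable A -> measurable (@tuple_cons n @^-1` A).
Proof.
by move=> mA; rewrite -[X in measurable X]setTI; exact: measurable_tuple_cons.
Qed.

Let lebesgue_tupleS0 : lebesgue_tupleS set0 = 0%E.
Proof. by rewrite /lebesgue_tupleS /pushforward preimage_set0 measure0. Qed.

Let lebesgue_tupleS_ge0 A : (0 <= lebesgue_tupleS A)%E.
Proof. by rewrite /lebesgue_tupleS /pushforward; exact: measure_ge0. Qed.

Let lebesgue_tupleS_sigma_additive : semi_sigma_additive lebesgue_tupleS.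
Proof.
move=> F mF tF mUF; rewrite /lebesgue_tupleS /pushforward preimage_bigcup.
apply: measure_semi_sigma_additive.
- by move=> i; exact: tuple_cons_preimage.
- apply/trivIsetP => i j _ _ ij; rewrite -preimage_setI.
  by move/trivIsetP : tF => -> //; rewrite preimage_set0.
- by rewrite -preimage_bigcup; exact: tuple_cons_preimage.
Qed.

HB.instance Definition _ := isMeasure.Build _ _ _ lebesgue_tupleS
  lebesgue_tupleS0 lebesgue_tupleS_ge0 lebesgue_tupleS_sigma_additive.
End step.

Fixpoint lebesgue_tuple n : {measure set (T n) -> \bar R} :=
  if n is n'.+1 then lebesgue_tupleS (lebesgue_tuple n')
  else \d_([tuple] : T 0).

End lebesgue_tuple.
Arguments lebesgue_tuple R n : clear implicits.

Section spacetime.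
Variables (R : realType) (n : nat).

Definition borel_spacetime_measure :
    {measure set (n.-tuple (measurableTypeR R) * measurableTypeR R)
     -> \bar R} :=
  (lebesgue_tuple R n \x @lebesgue_measure R)%E.

(* The points (x, t) of R^(n+1), with x in R^n and t in R.  The sigma-algebra
   is that of all Lebesgue measurable sets, i.e. the completion of the Borel
   one, and not just the Borel sets. *)
Definition spacetime : measurableType _ :=
  caratheodory_type (borel_spacetime_measure^*)%mu.

Definition lebesgue_spacetime : {measure set spacetime -> \bar R} :=
  @completed_measure_extension _ _ _ borel_spacetime_measure.

End spacetime.
Arguments lebesgue_spacetime {R n}.

Section function_spaces.
Context {R : realType} {n : nat}.

Local Notation E := (spacetime R n).
Local Notation mu := (@lebesgue_spacetime R n).

(* Tuples carry no topology in the library: compactness in R^(n+1) is that of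
   the corresponding subset of 'rV[R]_n * R. *)
Definition spacetime_rV (z : E) : 'rV[R]_n * R :=
  let: (x, t) := z : n.-tuple R * R in (\row_i tnth x i, t).

Definition L1loc : set (E -> R) :=
  [set f : E -> R | measurable_fun setT f /\
    forall K : set E, compact (spacetime_rV @` K) ->
      (\int[mu]_(z in K) `|f z|%:E < +oo)%E].

Definition weight : set (E -> R) :=
  [set w | [/\ L1loc w, forall z, 0 <= w z & {ae mu, forall z, 0 < w z}]].

Definition avg (A : set E) (f : E -> R) : \bar R :=
  ((mu A)^-1 * \int[mu]_(z in A) (f z)%:E)%E.

(* Only meaningful when [avg A f] is finite, e.g. for locally integrable f and
   bounded A. *)
Definition mean (A : set E) (f : E -> R) : R := fine (avg A f).

(* Extending f by +oo outside of A makes the essential infimum on the whole space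
   that on A. *)
Definition ess_inf_on (A : set E) (f : E -> R) : \bar R :=
  ess_inf mu (patch (cst +oo%E) A (EFin \o f)).

Definition cube (x : n.-tuple R) (L : R) : set (n.-tuple R) :=
  [set y | forall i, tnth x i - L / 2 <= tnth y i < tnth x i + L / 2].

(* A parabolic rectangle R(x, t, L) is given by its parameters, which determine
   R^-(gamma) and R^+(gamma). *)
Record parabolic_rectangle := ParabolicRectangle {
  rect_center : n.-tuple R;
  rect_time : R;
  rect_edge : R;
  rect_edge_gt0 : 0 < rect_edge }.

Variables p gamma : R.

Definition rect_minus (Q : parabolic_rectangle) : set E :=
  cube (rect_center Q) (rect_edge Q) `*`
  `[rect_time Q - rect_edge Q `^ p, rect_time Q - gamma * rect_edge Q `^ p[.

Definition rect_plus (Q : parabolic_rectangle) : set E :=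
  cube (rect_center Q) (rect_edge Q) `*`
  `[rect_time Q + gamma * rect_edge Q `^ p, rect_time Q + rect_edge Q `^ p[.

Definition sup_rect (F : parabolic_rectangle -> \bar R) : \bar R :=
  ereal_sup [set F Q | Q in [set: parabolic_rectangle]].

Definition PBMO_minus_norm (f : E -> R) : \bar R :=
  sup_rect (fun Q => ereal_inf [set
    (avg (rect_minus Q) ((f \- cst c)^\+)%R +
     avg (rect_plus Q) ((f \- cst c)^\-)%R)%E | c in [set: R]]).

Definition BMO_plus_norm (f : E -> R) : \bar R :=
  sup_rect (fun Q =>
    avg (rect_minus Q) (f \- cst (mean (rect_plus Q) f))^\+).

Definition BMO_minus_norm (f : E -> R) : \bar R :=
  sup_rect (fun Q =>
    avg (rect_plus Q) (f \- cst (mean (rect_minus Q) f))^\+).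

Definition PBMO_minus : set (E -> R) :=
  [set f | L1loc f /\ (PBMO_minus_norm f < +oo)%E].

Definition BMO_plus : set (E -> R) :=
  [set f | L1loc f /\ (BMO_plus_norm f < +oo)%E].

Definition BMO_minus : set (E -> R) :=
  [set f | L1loc f /\ (BMO_minus_norm f < +oo)%E].

Definition opp_BMO_minus : set (E -> R) := [set f | BMO_minus (\- f)].

(* The factors below are computed in \bar R, with 0^-1 = +oo, +oo `^ s = +oo for
   s > 0 and expeR +oo = +oo.  The real conventions for [`^] and [ln] at 0 only
   matter on the null set where the weight w vanishes. *)
Definition A1_plus_const (w : E -> R) : \bar R :=
  sup_rect (fun Q =>
    avg (rect_minus Q) w * (ess_inf_on (rect_plus Q) w)^-1)%E.

Definition Ar_plus_const (r : R) (w : E -> R) : \bar R :=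
  sup_rect (fun Q =>
    avg (rect_minus Q) w *
    avg (rect_plus Q) (fun z => w z `^ (1 / (1 - r)))%R `^ (r - 1))%E.

Definition Ainfty_plus_const (w : E -> R) : \bar R :=
  sup_rect (fun Q =>
    avg (rect_minus Q) w *
    expeR (avg (rect_plus Q) (fun z => ln (1 / w z))%R))%E.

(* The exponent r ranges over [1, +oo]; other values of r are irrelevant. *)
Definition A_plus_const (r : \bar R) : (E -> R) -> \bar R :=
  match r with
  | r'%:E => if r' == 1 then A1_plus_const else Ar_plus_const r'
  | _ => Ainfty_plus_const
  end.

Definition A_plus (r : \bar R) : set (E -> R) :=
  [set w | weight w /\ (A_plus_const r w < +oo)%E].

End function_spaces.

Definition equivalent_on {R : realType} {T : Type} (D : set T)
    (F G : T -> \bar R) : Prop :=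
  (exists2 C : R, 0 < C & forall f, D f -> (F f <= C%:E * G f)%E) /\
  (exists2 C : R, 0 < C & forall f, D f -> (G f <= C%:E * F f)%E).

(* Main.v *)
(* Let f belong to BMO^+.  The mean of f over an early half is controlled by the mean over the
   late half, and subdivision propagates this to all earlier positions inside the same cube.  If
   the mean over a cube exceeded by too much the later mean over an adjacent cube, the excess
   would reappear, multiplied by a large factor, at a smaller scale, and the iteration would
   contradict local integrability; because p > 1, the subdivided chains are short in time.  This
   gives a Harnack inequality for means along chains of cubes.

   On a parabolic grid, each cell is compared with a mean taken a fixed number of time steps
   earlier.  Stopping at the first cells whose reference mean is below that of the root, the
   stopped cells that are not already covered by delayed stopped cells fill at most a fixed
   proportion theta < 1 of the root, so that the supremum Y of the lower oscillation satisfies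
   Y <= 1 + 2 C + theta (Y + C).  The same argument for exp (delta (c - f)_+) gives exponential
   integrability from below, and hence that f belongs to PBMO^-.  Time reversal applied to - f
   settles - BMO^-.

   For w in A_infinity^+, Jensen's inequality shows that ln w belongs to BMO^+, and exponential
   integrability of (c - ln w)_+ on late halves bounds a negative power of w, which is an
   A_r^+ condition.  The converse inclusion is again Jensen's inequality. *)

From HB Require Import structures.
Require Import Defs.
From mathcomp Require Import all_boot all_order all_algebra.
From mathcomp Require Import all_classical all_reals all_analysis.
From mathcomp Require Import measurable_realfun ess_sup_inf.
From mathcomp Require Import zify lra ring.

Set Implicit Arguments.
Unset Strict Implicit.
Unset Printing Implicit Defensive.

Import Order.TTheory GRing.Theory Num.Theory.
Import numFieldNormedType.Exports.

Local Open Scope classical_set_scope.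
Local Open Scope ring_scope.

(** Control in BMO^+ runs one way: a later mean bounds an earlier excess, and not conversely. A
    stopped cell is therefore no place to estimate [f]. Its copy moved back in time is: the low
    reference mean, taken after the copy, bounds the excess of [f] there, while the high mean of the
    parent bounds the mean of [f] there from below. These copies may overlap, leave the root and
    cover other stopped cells, so a disjoint decomposition is replaced by a count of volume. Stopped
    cells inside the copy of one that is no finer are paid for by that copy. The others nearly avoid
    all copies, whose union has at least a fixed fraction of their volume, and both must fit into a
    slightly enlarged root. Since [N^p] need not be an integer, durations of cells are only
    comparable to those of halves. Suprema are taken over truncated functions, so as to be finite
    from the start. The functions live on an abstract space with coordinates, so that reversing time
    is a change of instance, and one estimate with a free function [W] yields both the oscillation
    bounds and the weights. *)

(* The two instances used are space-time and its time reversal.  The field [bs_approx] recovers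
   Lebesgue measurable sets, up to small measure, from the Borel ones. *)
Record box_space (R : realType) (n : nat) := BoxSpace {
  bs_disp : measure_display;
  bs_type :> measurableType bs_disp;
  bs_mu : {measure set bs_type -> \bar R};
  bs_X : 'I_n -> bs_type -> R;
  bs_T : bs_type -> R;
  bs_mX : forall i, measurable_fun setT (bs_X i);
  bs_mT : measurable_fun setT bs_T;
  bs_mu_box : forall (a b : 'I_n -> R) s s', (forall i, a i <= b i) ->
    s <= s' ->
    bs_mu [set z | (forall i, a i <= bs_X i z < b i) /\ s <= bs_T z < s'] =
    (\prod_i (b i - a i) * (s' - s))%:E;
  bs_approx : forall (A K : set bs_type) (e : R), measurable A ->
    measurable K -> (bs_mu K < +oo)%E -> 0 < e ->
    exists2 B, <<s [set H | (exists i r, H = [set z | bs_X i z < r]) \/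
                            (exists r, H = [set z | bs_T z < r])] >> B &
      (bs_mu (K `&` ((A `\` B) `|` (B `\` A))) <= e%:E)%E }.

(** * Integrals over boxes, and tilings of boxes *)

Section coordinate_boxes.
Context {R : realType} {n : nat} {S : box_space R n}.
Local Notation E := (bs_type S).
Local Notation mu := (@bs_mu R n S).
Local Notation X := (@bs_X R n S).
Local Notation T := (@bs_T R n S).
Implicit Types (g h : E -> R) (A B : set E).

Definition gbox (a b : 'I_n -> R) (s s' : R) : set E :=
  [set z | (forall i, a i <= X i z < b i) /\ s <= T z < s'].

Definition bx (a : 'I_n -> R) (l s t : R) : set E :=
  gbox a (fun i => a i + l) s (s + t).

Definition loc_integrable (g : E -> R) : Prop := measurable_fun setT g /\
  forall a l s t, mu.-integrable (bx a l s t) (EFin \o g).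

Definition bounded_measurable (A : set E) : Prop := measurable A /\
  exists a l s t, A `<=` bx a l s t.

Definition integ (A : set E) (g : E -> R) : R := \int[mu]_(z in A) g z.

Lemma measurable_halfspace_X i (r : R) : measurable [set z | X i z < r].
Proof.
rewrite (_ : [set z | X i z < r] = [set: E] `&` X i @^-1` `]-oo, r[).
  exact: bs_mX.
by rewrite setTI; apply/seteqP; split => z /=; rewrite in_itv.
Qed.

Lemma measurable_halfspace_T (r : R) : measurable [set z | T z < r].
Proof.
rewrite (_ : [set z | T z < r] = [set: E] `&` T @^-1` `]-oo, r[).
  exact: bs_mT.
by rewrite setTI; apply/seteqP; split => z /=; rewrite in_itv.
Qed.

Lemma measurable_gbox a b s s' : measurable (gbox a b s s').
Proof.
rewrite (_ : gbox a b s s' = (\bigcap_(i in [set: 'I_n])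
    ([set z | X i z < b i] `\` [set z | X i z < a i])) `&`
    ([set z | T z < s'] `\` [set z | T z < s])).
  apply: measurableI; last first.
    by apply: measurableD; exact: measurable_halfspace_T.
  apply: fin_bigcap_measurable => // i _.
  by apply: measurableD; exact: measurable_halfspace_X.
apply/seteqP; split=> z /=.
  move=> [h1 h2]; split.
    by move=> i _ /=; have /andP[h3 h4] := h1 i; split=> //; apply/negP;
      rewrite -leNgt.
  by case/andP: h2 => h3 h4; split=> //; apply/negP; rewrite -leNgt.
move=> [h1 [h2 h3]]; split; last by rewrite h2 leNgt andbT; apply/negP.
move=> i; have [h4 h5] := h1 i Logic.I.
by rewrite h4 leNgt andbT; apply/negP.
Qed.

Lemma measurable_bx a l s t : measurable (bx a l s t).
Proof. exact: measurable_gbox. Qed.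
Hint Resolve measurable_bx : core.

Lemma mu_bx a l s t : 0 <= l -> 0 <= t -> mu (bx a l s t) = (l ^+ n * t)%:E.
Proof.
move=> l0 t0; rewrite /bx /gbox bs_mu_box ?lerDl//; last by move=> i; rewrite lerDl.
congr (_ * _)%:E; last by rewrite addrC addKr.
rewrite (eq_bigr (fun=> l)); last by move=> i _; rewrite addrC addKr.
by rewrite prodr_const card_ord.
Qed.

Lemma bx_empty a l s t : t <= 0 -> bx a l s t = set0.
Proof.
move=> t0; apply/seteqP; split=> // z [_ /andP[h1 h2]].
by have := le_lt_trans h1 h2; rewrite -subr_gt0 addrAC subrr add0r ltNge t0.
Qed.

Lemma mu_bx_lty a l s t : (mu (bx a l s t) < +oo)%E.
Proof.
have [t0|t0] := leP t 0; first by rewrite bx_empty// measure0 ltry.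
have h : bx a l s t `<=` bx a (Num.max l 0) s t.
  move=> z [h1 h2]; split=> // i; have /andP[-> /= h3] := h1 i.
  by rewrite (lt_le_trans h3)// lerD2l le_max lexx.
apply: (@le_lt_trans _ _ (mu (bx a (Num.max l 0) s t))).
  by apply: le_measure => //; rewrite inE.
by rewrite mu_bx ?ltry ?(ltW t0)// le_max lexx orbT.
Qed.

Lemma bounded_bx a l s t : bounded_measurable (bx a l s t).
Proof. by split=> //; exists a, l, s, t. Qed.
Hint Resolve bounded_bx : core.

Lemma bounded_sub A B : measurable A -> A `<=` B -> bounded_measurable B ->
  bounded_measurable A.
Proof.
move=> mA AB [mB [a [l [s [t Bb]]]]]; split=> //; exists a, l, s, t.
exact: subset_trans Bb.
Qed.

Lemma bounded_set0 : bounded_measurable set0.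
Proof. by apply: (bounded_sub _ _ (bounded_bx (fun=> 0) 0 0 0)). Qed.

Lemma boundedI A B : bounded_measurable A -> measurable B ->
  bounded_measurable (A `&` B).
Proof.
move=> bA mB; apply: bounded_sub (bA); last exact: subIsetl.
by apply: measurableI => //; case: bA.
Qed.

Lemma boundedD A B : bounded_measurable A -> measurable B ->
  bounded_measurable (A `\` B).
Proof.
move=> bA mB; apply: bounded_sub (bA); last exact: subDsetl.
by apply: measurableD => //; case: bA.
Qed.

Lemma bxU_sub a l s t a' l' s' t' : exists a0 l0 s0 t0,
  bx a l s t `|` bx a' l' s' t' `<=` bx a0 l0 s0 t0.
Proof.
pose m := \sum_i (`|a i| + `|a' i|).
have hm i : `|a i| + `|a' i| <= m.
  by rewrite /m (bigD1 i)//= lerDl sumr_ge0// => j _; rewrite addr_ge0.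
exists (fun=> - m), (m + m + `|l| + `|l'|), (- `|s| - `|s'|),
  (`|s| + `|s'| + `|s| + `|s'| + `|t| + `|t'|).
have h (r : R) : - `|r| <= r <= `|r| by rewrite -ler_norml.
move=> z [] [h1 h2]; split.
- move=> i; have := h1 i; have := hm i.
  have := h (a i); have := h l; have := normr_ge0 (a' i); have := normr_ge0 l'.
  lra.
- have := h s; have := h t; have := normr_ge0 s'; have := normr_ge0 t'; lra.
- move=> i; have := h1 i; have := hm i.
  have := h (a' i); have := h l'; have := normr_ge0 (a i); have := normr_ge0 l.
  lra.
- have := h s'; have := h t'; have := normr_ge0 s; have := normr_ge0 t; lra.
Qed.

Lemma boundedU A B : bounded_measurable A -> bounded_measurable B ->
  bounded_measurable (A `|` B).
Proof.
move=> [mA [a [l [s [t hA]]]]] [mB [a' [l' [s' [t' hB]]]]]; split.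
  exact: measurableU.
have [a0 [l0 [s0 [t0 h]]]] := bxU_sub a l s t a' l' s' t'.
exists a0, l0, s0, t0; apply: subset_trans h; exact: setUSS.
Qed.

Lemma mu_bounded_lty A : bounded_measurable A -> (mu A < +oo)%E.
Proof.
move=> [mA [a [l [s [t sub]]]]]; apply: le_lt_trans (mu_bx_lty a l s t).
by apply: le_measure => //; rewrite inE.
Qed.

Lemma loc_integrable_on A g : bounded_measurable A -> loc_integrable g ->
  mu.-integrable A (EFin \o g).
Proof.
move=> [mA [a [l [s [t h]]]]] [_ ig].
by apply: integrableS (ig a l s t).
Qed.

Lemma loc_integrable_cst c : loc_integrable (fun=> c).
Proof.
split=> // a l s t; apply/integrableP; split=> /=.
  by apply/measurable_EFinP.
rewrite (@integral_cst _ _ _ mu (bx a l s t) _ `|c|%:E)//.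
by rewrite lte_mul_pinfty// mu_bx_lty.
Qed.

Lemma loc_integrable_le g h : measurable_fun setT g -> loc_integrable h ->
  (forall z, `|g z| <= h z) -> loc_integrable g.
Proof.
move=> mg [mh ih] gh; split=> // a l s t.
apply: le_integrable (ih a l s t) => //.
  by apply/measurable_EFinP; apply: measurable_funTS.
by move=> z _ /=; rewrite lee_fin (le_trans (gh z))// ler_norm.
Qed.

Lemma loc_integrableD g h : loc_integrable g -> loc_integrable h ->
  loc_integrable (fun z => g z + h z).
Proof.
move=> [mg ig] [mh ih]; split; first exact: measurable_funD.
by move=> a l s t; apply: (integrableD _ (ig a l s t) (ih a l s t)).
Qed.

Lemma loc_integrableZ c g : loc_integrable g ->
  loc_integrable (fun z => c * g z).
Proof.
move=> [mg ig]; split; first exact: measurable_funM.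
by move=> a l s t; apply: (integrableZl _ _ (ig a l s t)).
Qed.

Lemma loc_integrableN g : loc_integrable g -> loc_integrable (fun z => - g z).
Proof.
move=> lg; rewrite (_ : (fun z => - g z) = (fun z => -1 * g z)).
  exact: loc_integrableZ.
by apply/funext => z; rewrite mulN1r.
Qed.

Lemma loc_integrableB g h : loc_integrable g -> loc_integrable h ->
  loc_integrable (fun z => g z - h z).
Proof. by move=> lg lh; apply: loc_integrableD => //; exact: loc_integrableN. Qed.

Lemma loc_integrable_norm g : loc_integrable g ->
  loc_integrable (fun z => `|g z|).
Proof.
move=> [mg ig]; split; first exact: measurableT_comp.
by move=> a l s t; apply: (integrable_abse (ig a l s t)).
Qed.

Lemma loc_integrable_max g h : loc_integrable g -> loc_integrable h ->
  loc_integrable (fun z => Num.max (g z) (h z)).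
Proof.
move=> lg lh; apply: (@loc_integrable_le _ (fun z => `|g z| + `|h z|)).
- by apply: measurable_maxr; [case: lg|case: lh].
- by apply: loc_integrableD; exact: loc_integrable_norm.
- by move=> z; case: (leP (g z) (h z)) => _; rewrite ?lerDl ?lerDr.
Qed.

Lemma loc_integrable_min g h : loc_integrable g -> loc_integrable h ->
  loc_integrable (fun z => Num.min (g z) (h z)).
Proof.
move=> lg lh; apply: (@loc_integrable_le _ (fun z => `|g z| + `|h z|)).
- by apply: measurable_minr; [case: lg|case: lh].
- by apply: loc_integrableD; exact: loc_integrable_norm.
- by move=> z; case: (leP (g z) (h z)) => _; rewrite ?lerDl ?lerDr.
Qed.

Lemma integD A g h : bounded_measurable A -> loc_integrable g ->
  loc_integrable h ->
  integ A (fun z => g z + h z) = integ A g + integ A h.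
Proof.
by move=> bA lg lh; rewrite /integ RintegralD//; [case: bA|
  exact: loc_integrable_on..].
Qed.

Lemma integB A g h : bounded_measurable A -> loc_integrable g ->
  loc_integrable h ->
  integ A (fun z => g z - h z) = integ A g - integ A h.
Proof.
by move=> bA lg lh; rewrite /integ RintegralB//; [case: bA|
  exact: loc_integrable_on..].
Qed.

Lemma integZ A c g : bounded_measurable A -> loc_integrable g ->
  integ A (fun z => c * g z) = c * integ A g.
Proof.
by move=> bA lg; rewrite /integ RintegralZl//; [case: bA|
  exact: loc_integrable_on..].
Qed.

Lemma integ_ge0 A g : (forall z, A z -> 0 <= g z) -> 0 <= integ A g.
Proof. exact: Rintegral_ge0. Qed.

Lemma integ_le A g h : bounded_measurable A -> loc_integrable g ->
  loc_integrable h -> (forall z, A z -> g z <= h z) -> integ A g <= integ A h.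
Proof.
by move=> bA lg lh gh; rewrite /integ le_Rintegral//; [case: bA|
  exact: loc_integrable_on..].
Qed.

Lemma integU A B g : bounded_measurable A -> bounded_measurable B ->
  loc_integrable g -> A `&` B = set0 ->
  integ (A `|` B) g = integ A g + integ B g.
Proof.
move=> bA bB lg AB; rewrite /integ Rintegral_setU//; [by case: bA|by case: bB| |].
- by apply: loc_integrable_on => //; exact: boundedU.
- by rewrite /disj_set AB.
Qed.

Lemma integ_split A B g : bounded_measurable A -> measurable B ->
  loc_integrable g -> integ A g = integ (A `&` B) g + integ (A `\` B) g.
Proof.
move=> bA mB lg; rewrite -{1}(setUIDK A B) integU//.
- exact: boundedI.
- exact: boundedD.
- by apply/seteqP; split=> // z [[_ h] [_ /(_ h)]].
Qed.

Lemma integ_subset A B g : measurable A -> bounded_measurable B -> loc_integrable g ->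
  (forall z, B z -> 0 <= g z) -> A `<=` B -> integ A g <= integ B g.
Proof.
move=> mA bB lg g0 AB; rewrite (integ_split bB mA)//.
by rewrite (setIidr AB) lerDl integ_ge0// => z [/g0].
Qed.

Lemma integU_le A B g : bounded_measurable A -> bounded_measurable B ->
  loc_integrable g -> (forall z, 0 <= g z) ->
  integ (A `|` B) g <= integ A g + integ B g.
Proof.
move=> bA bB lg g0.
rewrite (@integ_split (A `|` B) A)//; [|exact: boundedU|by case: bA].
apply: lerD.
  by rewrite (_ : _ `&` _ = A)//; apply/seteqP; split=> z /=; tauto.
apply: integ_subset => //; first by apply: measurableD; [case: (boundedU bA bB)|case: bA].
by move=> z /= ; tauto.
Qed.

Definition vol (A : set E) : R := integ A (fun=> 1).

Lemma vol_ge0 A : 0 <= vol A.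
Proof. exact: integ_ge0. Qed.

Lemma vol_fine A : measurable A -> vol A = fine (mu A).
Proof. by move=> mA; rewrite /vol /integ Rintegral_cst// mul1r. Qed.

Lemma mu_vol A : bounded_measurable A -> mu A = (vol A)%:E.
Proof.
move=> bA; rewrite vol_fine; last by case: bA.
by rewrite fineK// ge0_fin_numE// mu_bounded_lty.
Qed.

Lemma vol_bx a l s t : 0 <= l -> 0 <= t -> vol (bx a l s t) = l ^+ n * t.
Proof. by move=> l0 t0; rewrite vol_fine// mu_bx. Qed.

Lemma integ_cst A c : bounded_measurable A -> integ A (fun=> c) = c * vol A.
Proof.
by move=> bA; rewrite /vol -integZ// ?mulr1//; exact: loc_integrable_cst.
Qed.

End coordinate_boxes.

Section tilings.
Context {R : realType} {n : nat} {S : box_space R n}.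
Local Notation E := (bs_type S).
Implicit Types (g h : E -> R) (a : 'I_n -> R) (l s t : R).

Definition corner a (k : 'I_n -> int) l : 'I_n -> R := fun i => a i + (k i)%:~R * l.

Lemma integ_bigU (I : choiceType) (s : seq I) (F : I -> set E) g : loc_integrable g ->
  (forall i, bounded_measurable (F i)) ->
  (forall i j, i != j -> F i `&` F j = set0) -> uniq s ->
  bounded_measurable (\big[setU/set0]_(i <- s) F i) /\
  integ (\big[setU/set0]_(i <- s) F i) g = \sum_(i <- s) integ (F i) g.
Proof.
move=> lg bF dF; elim: s => [_|i s ih /= /andP[is_ us]].
  by rewrite !big_nil /integ Rintegral_set0; split=> //; exact: bounded_set0.
have [ih1 ih2] := ih us; rewrite !big_cons; split; first exact: boundedU.
rewrite integU// ?ih2//.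
rewrite -bigcup_seq; apply/seteqP; split=> // z [zi [j /= js zj]].
have /dF h : i != j by apply: contraNneq is_ => ->.
by have : (F i `&` F j) z by []; rewrite h.
Qed.

Lemma cell_ex (a l x : R) (N : nat) : 0 < l -> a <= x < a + N%:R * l ->
  exists k : 'I_N, a + k%:R * l <= x < a + k%:R * l + l.
Proof.
move=> l0 /andP[h1 h2].
have y0 : 0 <= (x - a) / l by rewrite divr_ge0 ?subr_ge0// ltW.
have /andP[h3 h4] := truncn_itv y0.
have h5 : (Num.truncn ((x - a) / l) < N)%N.
  rewrite -(ltr_nat R) (le_lt_trans h3)// ltr_pdivrMr//; lra.
exists (Ordinal h5) => /=; move: (Num.truncn _) h3 h4 {h5} => m.
by rewrite ler_pdivlMr// ltr_pdivrMr// -natr1 mulrDl mul1r => h3 h4; lra.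
Qed.

Lemma cell_uniq (a l x : R) (k k' : int) : 0 < l ->
  a + k%:~R * l <= x < a + k%:~R * l + l ->
  a + k'%:~R * l <= x < a + k'%:~R * l + l -> k = k'.
Proof.
move=> l0.
wlog: k k' / k < k'.
  move=> h h1 h2; case: (ltgtP k k') => // kk; first exact: h.
  by apply/esym; exact: h.
move=> kk /andP[h1 h2] /andP[h3 h4].
have : (k + 1)%:~R <= k'%:~R :> R by rewrite ler_int lezD1.
by rewrite intrD -(ler_pM2r l0) mulrDl mul1r => h; exfalso; lra.
Qed.

Lemma integ_tile a (N : nat) l s t g : 0 < l -> loc_integrable g ->
  integ (bx a (N%:R * l) s t : set E) g =
  \sum_(k : {ffun 'I_n -> 'I_N}) integ (bx (corner a (fun i => k i) l) l s t) g.
Proof.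
move=> l0 lg.
have [||_] := @integ_bigU _ (index_enum {ffun 'I_n -> 'I_N})
    (fun k => bx (corner a (fun i => k i) l) l s t) g lg _ _ (index_enum_uniq _).
- by move=> k; exact: bounded_bx.
- move=> k k' kk; apply/seteqP; split=> // z /= [[h1 _] [h2 _]].
  move/eqP: kk; apply; apply/ffunP => i.
  by have [] := cell_uniq l0 (h1 i) (h2 i) => /val_inj.
move=> <-; congr integ; rewrite -bigcup_seq; apply/seteqP; split=> z.
  move=> [h1 h2].
  have /choice[k hk] : forall i, exists k : 'I_N,
      a i + k%:R * l <= bs_X i z < a i + k%:R * l + l.
    by move=> i; exact: cell_ex.
  exists [ffun i => k i]; first by rewrite /= mem_index_enum.
  by split=> // i; rewrite /corner ffunE; exact: hk.
move=> [k _ [h1 h2]]; split=> // i; have /andP[h3 h4] := h1 i.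
move: h3 h4; rewrite /corner -[(k i)%:~R]/((k i)%:R).
have h5 : (k i)%:R * l + l <= N%:R * l.
  by rewrite -[X in _ + X <= _]mul1r -mulrDl ler_pM2r// natr1 ler_nat.
have h6 : 0 <= (k i)%:R * l by rewrite mulr_ge0// ltW.
by move=> *; apply/andP; split; lra.
Qed.

Lemma integ_tile_le a (N : nat) l s t g (b : R) : 0 < l -> loc_integrable g ->
  (forall k : {ffun 'I_n -> 'I_N},
    integ (bx (corner a (fun i => k i) l) l s t : set E) g <= b) ->
  integ (bx a (N%:R * l) s t : set E) g <= N%:R ^+ n * b.
Proof.
move=> l0 lg h; rewrite integ_tile//.
apply: le_trans (ler_sum _ (fun k _ => h k)) _.
by rewrite sumr_const card_ffun !card_ord -natrX mulr_natl.
Qed.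

Lemma integ_time_split a l s t t' g : loc_integrable g -> 0 <= t -> 0 <= t' ->
  integ (bx a l s (t + t') : set E) g =
  integ (bx a l s t : set E) g + integ (bx a l (s + t) t') g.
Proof.
move=> lg t0 t1; rewrite -integU//.
- congr integ; apply/seteqP; split=> z /=.
    move=> [h1 /andP[h2 h3]]; case: (ltP (bs_T z) (s + t)) => h4.
      by left; split=> //; rewrite h2.
    by right; split=> //; rewrite h4/= -addrA.
  move=> [[h1 /andP[h2 h3]]|[h1 /andP[h2 h3]]]; split=> //; apply/andP; split; lra.
- exact: bounded_bx.
- exact: bounded_bx.
- apply/seteqP; split=> // z [[_ /andP[_ h1]] [_ /andP[h2 _]]].
  by have := lt_le_trans h1 h2; rewrite ltxx.
Qed.

End tilings.

(* Locked to keep [lra] from unfolding the real power. *)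
HB.lock Definition om {R : realType} (p l : R) : R := l `^ p.

Section exact_boxes.
Context {R : realType} {n : nat} {S : box_space R n}.
Variables (p gamma : R).

(* [lag l] is the time between the starts of the early and the late half of a parabolic
   rectangle of edge [l], and [rho l] is the duration of each half. *)
Definition lag (l : R) : R := (1 + gamma) * om p l.
Definition rho (l : R) : R := (1 - gamma) * om p l.
Definition ebox (a : 'I_n -> R) (l s : R) : set (bs_type S) := bx a l s (rho l).
Definition mean_on (f : bs_type S -> R) A : R := integ A f / vol A.
Definition ep (f : bs_type S -> R) A c : R :=
  integ A (fun z => Num.max (f z - c) 0).
End exact_boxes.

HB.lock Definition emean {R : realType} {n : nat} {S : box_space R n}
  (p gamma : R) (f : bs_type S -> R) (a : 'I_n -> R) (l s : R) : R :=
  mean_on f (ebox p gamma a l s).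

(** * Means over the halves of a parabolic rectangle *)

Section forward_means.
Context {R : realType} {n : nat} {S : box_space R n}.
Variables (p gamma : R).
Hypotheses (p_gt1 : 1 < p) (gamma_gt0 : 0 < gamma) (gamma_lt1 : gamma < 1).
Local Notation E := (bs_type S).
Local Notation om := (om p).
Local Notation lag := (lag p gamma).
Local Notation rho := (rho p gamma).
Local Notation ebox := (@ebox R n S p gamma).
Local Notation emean := (@emean R n S p gamma).
Implicit Types (f g : E -> R) (a b : 'I_n -> R) (l r s t u v c : R) (A : set E).

(** The unit ball of BMO^+. All estimates are proved in it, with constants that do not depend on
    [f], and reach the whole space by scaling. *)
Definition bmo1 f : Prop := loc_integrable f /\ forall a l s, 0 < l ->
  ep f (ebox a l s) (emean f a l (s + lag l)) <= vol (ebox a l s).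

Lemma emeanE f a l s : emean f a l s = mean_on f (ebox a l s).
Proof. by rewrite unlock. Qed.

Lemma om_gt0 l : 0 < l -> 0 < om l.
Proof. by move=> l0; rewrite unlock powR_gt0. Qed.

Lemma omM c l : 0 <= c -> 0 <= l -> om (c * l) = om c * om l.
Proof. by move=> c0 l0; rewrite unlock powRM. Qed.

Lemma om_le l r : 0 <= l -> l <= r -> om l <= om r.
Proof.
move=> l0 lr; rewrite unlock; apply: ge0_ler_powR; rewrite ?nnegrE//.
  by rewrite ltW// (lt_trans ltr01).
exact: le_trans lr.
Qed.

Lemma om1 : om 1 = 1. Proof. by rewrite unlock powR1. Qed.

Lemma om_ge1 l : 1 <= l -> 1 <= om l.
Proof. by move=> l1; rewrite -om1 om_le. Qed.

Lemma rho_gt0 l : 0 < l -> 0 < rho l.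
Proof. by move=> l0; rewrite mulr_gt0 ?om_gt0// subr_gt0. Qed.

Lemma vol_ebox a l s : 0 < l -> vol (ebox a l s) = l ^+ n * rho l.
Proof. by move=> l0; rewrite vol_bx// ltW// rho_gt0. Qed.

Lemma vol_ebox_gt0 a l s : 0 < l -> 0 < vol (ebox a l s).
Proof. by move=> l0; rewrite vol_ebox// mulr_gt0 ?exprn_gt0 ?rho_gt0. Qed.

Lemma bounded_ebox a l s : bounded_measurable (ebox a l s).
Proof. exact: bounded_bx. Qed.

Lemma mean_onK f A : 0 < vol A -> integ A f = mean_on f A * vol A.
Proof. by move=> A0; rewrite /mean_on divfK// gt_eqF. Qed.

Lemma loc_ep f c : loc_integrable f ->
  loc_integrable (fun z => Num.max (f z - c) 0).
Proof.
by move=> lf; apply: loc_integrable_max; [apply: loc_integrableB => //|];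
  exact: loc_integrable_cst.
Qed.

Lemma ep_ge0 f A c : 0 <= ep f A c.
Proof. by apply: integ_ge0 => z _; rewrite le_max lexx orbT. Qed.

Lemma ep_anti f A c c' : bounded_measurable A -> loc_integrable f -> c <= c' ->
  ep f A c' <= ep f A c.
Proof.
move=> bA lf cc; apply: integ_le => //; [exact: loc_ep..|move=> z _].
by case: (leP (f z - c') 0) => h; case: (leP (f z - c) 0) => h'; lra.
Qed.

Lemma ep_subset f A B c : measurable A -> bounded_measurable B ->
  loc_integrable f -> A `<=` B -> ep f A c <= ep f B c.
Proof.
move=> mA bB lf AB; apply: integ_subset => //; first exact: loc_ep.
by move=> z _; rewrite le_max lexx orbT.
Qed.

Lemma integ_le_ep f A c : bounded_measurable A -> loc_integrable f ->
  integ A f <= c * vol A + ep f A c.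
Proof.
move=> bA lf; have h := loc_integrable_cst; rewrite -integ_cst// -integD//; last exact: loc_ep.
apply: integ_le => //; first by apply: loc_integrableD => //; exact: loc_ep.
by move=> z _; case: (leP (f z - c) 0) => h'; lra.
Qed.

Lemma mean_le_ep f A c (b : R) : bounded_measurable A -> loc_integrable f ->
  0 < vol A -> ep f A c <= b * vol A -> mean_on f A <= c + b.
Proof.
move=> bA lf A0 h; rewrite /mean_on ler_pdivrMr// mulrDl.
by apply: le_trans (integ_le_ep c bA lf) _; rewrite lerD2l.
Qed.

Lemma ep_ebox f A a l s c : bmo1 f -> 0 < l -> measurable A ->
  A `<=` ebox a l s -> emean f a l (s + lag l) <= c ->
  ep f A c <= vol (ebox a l s).
Proof.
move=> [lf bf] l0 mA Ab mc; apply: le_trans (bf a l s l0).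
apply: le_trans (ep_subset _ mA (bounded_ebox a l s) lf Ab) _.
by apply: ep_anti => //; exact: bounded_ebox.
Qed.

(** A mean exceeds [c] by at most the average of [(f - c)_+]; enlarging [A] to a full early half
    costs the ratio of the volumes. *)
Lemma mean_le_emean f A a l s D : bmo1 f -> 0 < l -> bounded_measurable A ->
  A `<=` ebox a l s -> 0 < vol A -> vol (ebox a l s) <= D * vol A ->
  mean_on f A <= emean f a l (s + lag l) + D.
Proof.
move=> bf l0 bA Ab A0 hD; apply: mean_le_ep => //; first by case: bf.
by apply: le_trans hD; apply: ep_ebox => //; case: bA.
Qed.

Lemma emean_le_emean f b r v a l s (D : R) : bmo1 f -> 0 < l -> 0 < r ->
  ebox b r v `<=` ebox a l s -> vol (ebox a l s) <= D * vol (ebox b r v) ->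
  emean f b r v <= emean f a l (s + lag l) + D.
Proof.
move=> bf l0 r0 hb hD; rewrite [leLHS]emeanE; apply: mean_le_emean => //.
  exact: bounded_ebox.
exact: vol_ebox_gt0.
Qed.

Lemma emean_le_ep f a l s c (b : R) : loc_integrable f -> 0 < l ->
  ep f (ebox a l s) c <= b * vol (ebox a l s) -> emean f a l s <= c + b.
Proof.
move=> lf l0 h; rewrite emeanE; apply: mean_le_ep => //.
  exact: bounded_ebox.
exact: vol_ebox_gt0.
Qed.

Lemma integ_ebox f a l s : 0 < l ->
  integ (ebox a l s) f = emean f a l s * vol (ebox a l s).
Proof. by move=> l0; rewrite emeanE -mean_onK// vol_ebox_gt0. Qed.

Lemma emean_lag f a l s : bmo1 f -> 0 < l ->
  emean f a l s <= emean f a l (s + lag l) + 1.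
Proof. by move=> bf l0; apply: emean_le_emean => //; rewrite mul1r. Qed.

(** The time interval is covered by stacked early halves of duration [rho l]. Their number is at
    most [t / rho l + 1], whence the extra [rho l]. *)
Lemma ep_column f c a l s1 s2 : bmo1 f -> 0 < l ->
  (forall v, s1 <= v <= s2 -> emean f a l v <= c) ->
  forall v t, 0 <= t -> s1 <= v + lag l -> v + t + lag l <= s2 ->
  ep f (bx a l v t) c <= l ^+ n * (t + rho l).
Proof.
move=> bf l0 hm.
have lf : loc_integrable f by case: bf.
have r0 := rho_gt0 l0.
have ln0 : 0 < l ^+ n by rewrite exprn_gt0.
have key : forall (k : nat) v t, 0 <= t <= k%:R * rho l -> s1 <= v + lag l ->
    v + t + lag l <= s2 -> ep f (bx a l v t) c <= l ^+ n * (k%:R * rho l).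
  elim=> [|k ih] v t /andP[t0 tk] h1 h2.
    rewrite mul0r in tk *; rewrite bx_empty// mulr0.
    by rewrite /ep /integ Rintegral_set0.
  have hv : ep f (ebox a l v) c <= l ^+ n * rho l.
    rewrite -(vol_ebox a v)//; apply: ep_ebox => //; first exact: measurable_bx.
    by apply: hm; rewrite h1/=; lra.
  rewrite -natr1 mulrDl mul1r.
  have [tr|rt] := leP t (rho l).
    apply: le_trans (_ : _ <= ep f (ebox a l v) c) _.
      apply: ep_subset => //; [exact: measurable_bx|exact: bounded_ebox|].
      by move=> z [hz /andP[h3 h4]]; split=> //; rewrite h3/=; lra.
    apply: le_trans hv _; rewrite ler_pM2l// lerDr mulr_ge0//; lra.
  rewrite (_ : t = rho l + (t - rho l)); last by ring.
  rewrite /ep integ_time_split; [|exact: loc_ep|exact: ltW|lra].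
  rewrite mulrDr addrC lerD//; apply: ih; last 2 first.
  - lra.
  - lra.
  - move: tk; rewrite -natr1 mulrDl mul1r => tk; apply/andP; split; lra.
move=> v t t0 h1 h2.
have y0 : 0 <= t / rho l by rewrite divr_ge0// ltW.
have /andP[h3 h4] := truncn_itv y0.
move: (Num.truncn _) h3 h4 => k; rewrite ler_pdivlMr// ltr_pdivrMr// => h3 h4.
apply: le_trans (key k.+1 v t _ h1 h2) _; first by rewrite t0 ltW.
rewrite ler_pM2l// -natr1 mulrDl mul1r; lra.
Qed.

Lemma ex_nat_ge (x : R) : exists k : nat, x <= k%:R.
Proof.
exists (Num.truncn (Num.max x 0)).+1; apply/ltW.
have h : 0 <= Num.max x 0 by rewrite le_max lexx orbT.
by have /andP[_] := truncn_itv h; apply: le_lt_trans; rewrite le_max lexx.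
Qed.

(* This is where [p > 1] enters: a walk through N cubes of side l / N takes a time
   comparable to N (l / N)^p, which is small compared with l^p. *)
Lemma ex_om_large (b : R) : exists N : nat,
  [/\ (1 < N)%N, b <= om N%:R & b * N%:R <= om N%:R].
Proof.
have p10 : 0 < p - 1 by rewrite subr_gt0.
have [k hk] := ex_nat_ge (Num.max b 1 `^ (p - 1)^-1).
have b1 : 1 <= Num.max b 1 by rewrite le_max lexx orbT.
exists k.+2; set N : R := _%:R.
have kN : k%:R <= N by rewrite ler_nat !leqW.
have N0 : 0 < N by rewrite ltr0n.
have h : b <= N `^ (p - 1).
  apply: le_trans (_ : Num.max b 1 <= _); first by rewrite le_max lexx.
  have b0 : 0 <= Num.max b 1 by exact: le_trans b1.
  have -> : Num.max b 1 = (Num.max b 1 `^ (p - 1)^-1) `^ (p - 1).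
    by rewrite -powRrM mulVf ?powRr1// gt_eqF.
  apply: (ge0_ler_powR (ltW p10)); rewrite ?nnegrE ?powR_ge0//.
  exact: le_trans hk kN.
have e : om N = N `^ (p - 1) * N.
  rewrite unlock -[X in _ * X](powRr1 (ltW N0)) -powRD.
    by rewrite subrK.
  by rewrite (gt_eqF N0) implybT.
have h2 : b * N <= om N by rewrite e ler_pM2r.
split=> //; have [b0|b0] := leP b 0.
  by rewrite (le_trans b0)// ltW// om_gt0.
by apply: le_trans h2; rewrite ler_peMr ?(ltW b0)// ler1n.
Qed.

(* Inside one spatial cube, cutting it into N^n subcubes makes the lags short enough to
   reach every earlier time. *)
Lemma ep_past (t0 : R) : exists2 C, 0 <= C & forall f b l u v t,
  bmo1 f -> 0 < l -> 0 <= t -> u - t0 * om l <= v -> v + t <= u - 2 * om l ->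
  ep f (bx b l v t) (emean f b l u + C) <= l ^+ n * (t + rho l).
Proof.
have gg0 := gamma_gt0; have gg1 := gamma_lt1.
have g10 : 0 < 1 - gamma by rewrite subr_gt0.
(* This makes [2 * om r <= rho l] for [r = l / N]: a jump of [lag r] that starts before the early
   half of side [l] cannot pass over it. *)
have [N [N1 hN _]] := ex_om_large (2 / (1 - gamma)).
rewrite ler_pdivrMr// in hN.
have N0 : 0 < N%:R :> R by rewrite ltr0n ltnW.
have oN := om_gt0 N0.
have [i0 hi0] := ex_nat_ge (t0 * om N%:R).
exists (N%:R ^+ n * om N%:R + i0%:R).
  by rewrite addr_ge0// mulr_ge0 ?exprn_ge0// ltW.
move=> f b l u v t bf l0 t0' hv hvt.
pose r := l / N%:R.
have r0 : 0 < r by rewrite divr_gt0.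
have lr : l = N%:R * r by rewrite /r mulrC divfK// gt_eqF.
have oml : om l = om N%:R * om r by rewrite lr omM ?ltW.
have or0 := om_gt0 r0.
have ol0 := om_gt0 l0.
have lagr : lag r + rho r = 2 * om r by rewrite /lag /rho; ring.
have lagl : lag l + rho l = 2 * om l by rewrite /lag /rho; ring.
have h2r : 2 * om r <= rho l.
  by rewrite /rho oml mulrA ler_pM2r// mulrC; lra.
have lr0 : 0 < lag r by rewrite mulr_gt0//; lra.
(* [i] counts jumps by [lag r], each of which costs 1. Without a jump, the small box lies in the
   early half that starts at [u - lag l], and the cost is the volume ratio [N ^ n * om N]. *)
have P (i : nat) (b' : 'I_n -> R) v' :
    (forall j, b j <= b' j /\ b' j + r <= b j + l) ->
    u - lag l - i%:R * lag r <= v' <= u - lag l + rho l - rho r ->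
    emean f b' r v' <= emean f b l u + (N%:R ^+ n * om N%:R + i%:R).
  move=> hb; elim: i v' => [|i ih] v' /andP[h1 h2].
    rewrite -[X in emean f b l X](subrK (lag l)) addr0.
    apply: emean_le_emean => //.
    - move=> z [hz /andP[h3 h4]]; split.
        move=> j; have [h5 h6] := hb j; have /andP[h7 h8] := hz j.
        by apply/andP; split; lra.
      by apply/andP; split; lra.
    - rewrite !vol_ebox// {1}lr exprMn /rho oml.
      by rewrite le_eqVlt; apply/orP; left; apply/eqP; ring.
  have [h3|h3] := leP (u - lag l - i%:R * lag r) v'.
    by apply: le_trans (ih _ _) _; [rewrite h3|rewrite -natr1; lra].
  apply: le_trans (emean_lag _ _ bf r0) _.
  have /ih : u - lag l - i%:R * lag r <= v' + lag r <= u - lag l + rho l - rho r.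
    move: h1; rewrite -natr1 mulrDl mul1r => h1.
    have : 0 <= i%:R * lag r by rewrite mulr_ge0// ltW.
    by move=> ?; apply/andP; split; lra.
  have -> : i.+1%:R = i%:R + 1 :> R by rewrite natr1.
  move: (emean f b' r _) (emean f b l u) (_ * om N%:R) (i%:R) => x y z w.
  lra.
rewrite {1}lr; apply: le_trans (_ : N%:R ^+ n * (r ^+ n * (t + rho r)) <= _); last first.
  rewrite mulrA -exprMn -lr ler_pM2l ?exprn_gt0// lerD2l /rho ler_pM2l//.
  by rewrite om_le ?(ltW r0)// lr ler_peMl ?(ltW r0)// ler1n ltnW.
apply: integ_tile_le => //; first by apply: loc_ep; case: bf.
move=> k; apply: (@ep_column f _ _ r (u - lag l - i0%:R * lag r)
    (u - lag l + rho l - rho r)) => //.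
- move=> v' hv'; apply: P => // j; rewrite /corner -[(k j)%:~R]/((k j)%:R).
  have h3 : 0 <= (k j)%:R * r by rewrite mulr_ge0// ltW.
  have h4 : (k j)%:R * r + r <= l.
    by rewrite -[X in _ + X <= _]mul1r -mulrDl lr ler_pM2r// natr1 ler_nat.
  by split; lra.
- have : t0 * om l <= i0%:R * lag r.
    rewrite oml mulrA; apply: le_trans (_ : i0%:R * om r <= _).
      by rewrite ler_pM2r.
    by rewrite ler_wpM2l// /lag ler_peMl ?ltW//; lra.
  have : 0 < lag l by rewrite mulr_gt0//; lra.
  by clear -lr0 hv; lra.
- have : 2 * om r <= (2 - 2 * gamma) * om l.
    by apply: le_trans h2r _; rewrite /rho ler_pM2r//; lra.
  rewrite /rho /lag in lagr lagl *; clear -lagr lagl hvt gg0 or0; lra.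
Qed.

End forward_means.

(** Subtracting [X ^+ 2], which exceeds the fixed point [X * (X - 1)] of the recursion, absorbs the
    additive error and leaves pure growth. *)
Lemma growth_arith (R : realFieldType) (X y y' m : R) : 1 < X ->
  0 <= y - m - X ^+ 2 ->
  X * (y - m) - X * (X - 1) <= (X - 1) * (y' - m) ->
  (1 + X^-1) * (y - m - X ^+ 2) <= y' - m - X ^+ 2.
Proof.
move=> X1 z0 h.
have X0 : 0 < X by exact: lt_trans X1.
have X10 : 0 < X - 1 by rewrite subr_gt0.
set z := y - m - X ^+ 2 in z0 *.
have h1 : X * z <= (X - 1) * (y' - m - X ^+ 2).
  have -> : X * z = X * (y - m) - X * (X - 1) - (X - 1) * X ^+ 2 - X.
    by rewrite /z; ring.
  rewrite [leRHS]mulrBr; lra.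
rewrite -(ler_pM2l X10); apply: le_trans h1.
have -> : (X - 1) * ((1 + X^-1) * z) = (X - X^-1) * z.
  by rewrite mulrA; congr (_ * _); field; rewrite gt_eqF.
by rewrite ler_wpM2r// gerBl invr_ge0 ltW.
Qed.

Lemma bernoulli (R : realFieldType) (x : R) (k : nat) : 0 <= x ->
  1 + k%:R * x <= (1 + x) ^+ k.
Proof.
move=> x0; elim: k => [|k ih]; first by rewrite mul0r addr0 expr0.
rewrite exprS -natr1; apply: le_trans (_ : (1 + x) * (1 + k%:R * x) <= _).
  have -> : (1 + x) * (1 + k%:R * x) = 1 + (k%:R + 1) * x + k%:R * x ^+ 2 by ring.
  by rewrite lerDl mulr_ge0 ?exprn_ge0 ?ler0n.
by rewrite ler_wpM2l// addr_ge0.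
Qed.

Lemma ex_expr_ge (R : realType) (x b : R) : 0 < x -> exists k, b <= (1 + x) ^+ k.
Proof.
move=> x0; have [k hk] := ex_nat_ge (b / x); exists k.
apply: le_trans (bernoulli k (ltW x0)).
by move: hk; rewrite ler_pdivrMr// => hk; rewrite (le_trans hk)// lerDr.
Qed.

(** Every coordinate moves by one unit towards its target and waits there once it has arrived, so
    that all of them take the same [m] steps and none leaves the range. *)
Lemma walk_le (R : realType) (n : nat) (lo hi : int) (X : R) (m : nat) :
  forall F : ('I_n -> int) -> nat -> R,
  (forall k k' i, (forall j, lo <= k j <= hi) -> (forall j, lo <= k' j <= hi) ->
    (forall j, `|k' j - k j| <= 1) -> (i < m)%N -> F k i <= F k' i.+1 + X) ->
  forall k0 k1, (forall j, lo <= k0 j <= hi) -> (forall j, lo <= k1 j <= hi) ->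
    (forall j, `|k1 j - k0 j| <= m) -> F k0 0%N <= F k1 m + m%:R * X.
Proof.
elim: m => [|m ih] F hF k0 k1 h0 h1 h01.
  rewrite mul0r addr0 (_ : k0 = k1)//; apply/funext => j.
  by have := h01 j; lia.
pose k j : int := if k0 j < k1 j then k0 j + 1 else
  if k1 j < k0 j then k0 j - 1 else k0 j.
have hk j : [/\ lo <= k j <= hi, `|k j - k0 j| <= 1 & `|k1 j - k j| <= m].
  have := h0 j; have := h1 j; have := h01 j; rewrite /k.
  case: (ltP (k0 j) (k1 j)) => c1; [|case: (ltP (k1 j) (k0 j)) => c2];
    by move=> *; split; lia.
apply: le_trans (hF k0 k 0%N h0 _ _ _) _ => //; try by move=> j; have [] := hk j.
rewrite -natr1 mulrDl mul1r addrA lerD2r.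
apply: (ih (fun k i => F k i.+1)) => //; try by move=> j; have [] := hk j.
by move=> k2 k3 i *; apply: hF.
Qed.

Section walk_arithmetic.

(** The first term gives the corner of a double cube that contains both of two touching cubes, the
    second the position of one of them inside it. *)
Lemma int_split (k : int) : `|k| <= 1 -> k = (if k == -1 then -1 else 0) +
  ((if k == 1 then ord_max else ord0 : 'I_2) : nat)%:Z.
Proof.
by move=> k1; case: eqP => [->|] //; case: eqP => [->|]//= h1 h2; lia.
Qed.

Lemma ord2P (e : 'I_2) : (e : nat) = 0%N \/ (e : nat) = 1%N.
Proof. by case: e => -[|[|//]] /= _; [left|right]. Qed.

Lemma ord_range (N : nat) (i : 'I_N) : 0 <= (i : nat)%:Z <= N%:Z - 1.
Proof. by have := ltn_ord i; lia. Qed.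

Lemma mul_ord2_range (N : nat) (e : 'I_2) : (0 < N)%N ->
  0 <= N%:Z * (e : nat)%:Z <= (2 * N)%:Z - 1.
Proof. by case: (ord2P e) => ->; lia. Qed.

Lemma int_dist_range (N : nat) (x y : int) : 0 <= x <= N%:Z - 1 ->
  0 <= y <= N%:Z - 1 -> `|x - y| <= N.
Proof. by lia. Qed.

Lemma le_range (N : nat) (x : int) : 0 <= x <= N%:Z - 1 -> x <= N%:Z.
Proof. by lia. Qed.

End walk_arithmetic.

(** * A Harnack inequality for the means *)

Section adjacent_cubes.
Context {R : realType} {n : nat} {S : box_space R n}.
Variables (p gamma : R).
Hypotheses (p_gt1 : 1 < p) (gamma_gt0 : 0 < gamma) (gamma_lt1 : gamma < 1).
Hypothesis n_gt0 : (0 < n)%N.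
Local Notation E := (bs_type S).
Local Notation om := (om p).
Local Notation lag := (lag p gamma).
Local Notation rho := (rho p gamma).
Local Notation ebox := (@ebox R n S p gamma).
Local Notation emean := (@emean R n S p gamma).
Local Notation bmo1 := (@bmo1 R n S p gamma).
Implicit Types (f g : E -> R) (a b c : 'I_n -> R) (l r s t u v : R) (A : set E).

Lemma corner_corner a k k' l :
  corner (corner a k l) k' l = corner a (fun i => k i + k' i) l.
Proof. by apply/funext => i; rewrite /corner intrD mulrDl addrA. Qed.

(** Of the [X] subcubes of the double cube, one has a mean at most [m] and each of the others a mean
    at most the later mean plus [X]. If the average over all is high nevertheless, the later mean
    must be higher still. *)
Lemma growth_step f c (kb : {ffun 'I_n -> 'I_2}) l s (m : R) (X := 2 ^+ n : R) :
  bmo1 f -> 0 < l ->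
  integ (bx (corner c (fun i => kb i) l) l s (rho (2 * l))) f <=
    m * (l ^+ n * rho (2 * l)) ->
  X * (emean f c (2 * l) s - m) - X * (X - 1) <=
    (X - 1) * (emean f c (2 * l) (s + lag (2 * l)) - m).
Proof.
move=> bf l0 hb; set y' := emean _ _ _ (_ + _).
have lf : loc_integrable f by case: bf.
have l20 : 0 < 2 * l by rewrite mulr_gt0.
have r0 := rho_gt0 p gamma_lt1 l20.
have v0 : 0 < l ^+ n * rho (2 * l) by rewrite mulr_gt0 ?exprn_gt0.
have hcell (k : {ffun 'I_n -> 'I_2}) :
    integ (bx (corner c (fun i => k i) l) l s (rho (2 * l)) : set E) f <=
    (y' + X) * (l ^+ n * rho (2 * l)).
  have vk : vol (bx (corner c (fun i => k i) l) l s (rho (2 * l)) : set E) =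
      l ^+ n * rho (2 * l) by rewrite vol_bx// ltW.
  rewrite mean_onK ?vk// ler_pM2r//.
  apply: (@mean_le_emean _ _ _ p gamma) => //.
  - exact: bounded_bx.
  - move=> z [hz ht]; split=> // j; have := hz j; rewrite /corner.
    by case: (k j) => -[|[|//]] /= _; rewrite ?mulr0z ?mulr1z ?mul0r ?mul1r; lra.
  - by rewrite vk.
  - by rewrite vol_ebox// vk exprMn mulrA.
have : X * emean f c (2 * l) s * (l ^+ n * rho (2 * l)) <=
    ((X - 1) * (y' + X) + m) * (l ^+ n * rho (2 * l)).
  have -> : X * emean f c (2 * l) s * (l ^+ n * rho (2 * l)) =
      integ (ebox c (2 * l) s) f.
    rewrite integ_ebox// vol_ebox// exprMn -/X.
    by rewrite /X; move: (rho _) (emean _ _ _ _) => *; ring.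
  rewrite integ_tile// (bigD1 kb)//= [leRHS]mulrDl addrC lerD//.
  apply: le_trans (ler_sum _ (fun k _ => hcell k)) _.
  rewrite sumr_const; set q := #|_|; rewrite -[_ *+ q]mulr_natl.
  have -> : q%:R = X - 1 :> R.
    by rewrite /q cardC1 card_ffun !card_ord -subn1 natrB ?expn_gt0// natrX.
  by rewrite -[leRHS]mulrA.
rewrite ler_pM2r// /y'.
move: (emean f c (2 * l) s) (emean f c (2 * l) (s + lag (2 * l))) (X).
by move=> y1 y2 Y h; lra.
Qed.

Definition touching a b l := exists2 k : 'I_n -> int,
  (forall i, `|k i| <= 1) & b = corner a k l.

Lemma growth f c (kb : {ffun 'I_n -> 'I_2}) l s (m : R) (J : nat)
    (X := 2 ^+ n : R) :
  bmo1 f -> 0 < l ->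
  (forall j, (j < J)%N ->
    integ (bx (corner c (fun i => kb i) l) l (s + j%:R * lag (2 * l))
      (rho (2 * l))) f <= m * (l ^+ n * rho (2 * l))) ->
  0 <= emean f c (2 * l) s - m - X ^+ 2 ->
  (1 + X^-1) ^+ J * (emean f c (2 * l) s - m - X ^+ 2) <=
    emean f c (2 * l) (s + J%:R * lag (2 * l)) - m - X ^+ 2.
Proof.
move=> bf l0 hb z0.
have X1 : 1 < X by rewrite exprn_egt1 ?ltr1n// -lt0n.
have Xi : 0 <= 1 + X^-1 by rewrite addr_ge0// invr_ge0 ltW// (lt_trans ltr01).
elim: J hb => [|J ih] hb; first by rewrite expr0 mul1r mul0r addr0.
have {}ih := ih (fun j h => hb j (ltnW h)).
rewrite exprS -mulrA.
have -> : s + J.+1%:R * lag (2 * l) = s + J%:R * lag (2 * l) + lag (2 * l).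
  by rewrite -[_.+1%:R]natr1; ring.
apply: le_trans (ler_wpM2l Xi ih) _; apply: growth_arith => //.
  by apply: le_trans ih; rewrite mulr_ge0// exprn_ge0.
by apply: growth_step => //; exact: hb.
Qed.

(** If all small means in the time window were at most [m], [ep_column] in every subcube would bound
    the mean over the large box by [m + 2]. *)
Lemma ex_small_ebox f c l s (N : nat) (m : R) : bmo1 f -> 0 < l -> (0 < N)%N ->
  m + 2 < emean f c (N%:R * l) s -> exists (k : {ffun 'I_n -> 'I_N}) v,
    s + lag l <= v <= s + rho (N%:R * l) + lag l /\
    m < emean f (corner c (fun i => k i) l) l v.
Proof.
move=> bf l0 N0; apply: contraPP => /forallNP h; apply/negP; rewrite -leNgt.
have N1 : 1 <= N%:R :> R by rewrite ler1n.
have Nl0 : 0 < N%:R * l by rewrite mulr_gt0// ltr0n.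
have r0 := rho_gt0 p gamma_lt1 Nl0.
have bE : bounded_measurable (ebox c (N%:R * l) s) by exact: bounded_ebox.
have lf : loc_integrable f by case: bf.
apply: emean_le_ep => //.
rewrite vol_ebox// exprMn.
have hr : rho l <= rho (N%:R * l).
  rewrite /rho ler_pM2l ?subr_gt0//; apply: om_le => //; first exact: ltW.
  by rewrite ler_peMl// ltW.
apply: le_trans (_ : N%:R ^+ n * (l ^+ n * (rho (N%:R * l) + rho l)) <= _).
  apply: integ_tile_le => //; first exact: loc_ep.
  move=> k; apply: (ep_column gamma_lt1 (s1 := s + lag l)
      (s2 := s + rho (N%:R * l) + lag l)) => //; last exact: ltW.
  move=> v hv; rewrite leNgt; apply/negP => hm.
  by have /forallNP/(_ v) := h k; apply.
rewrite mulrA mulrCA ler_pM2l; first by lra.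
by rewrite mulr_gt0 ?exprn_gt0// (lt_le_trans ltr01).
Qed.

(** One half of the time [T0 * om l] pays for the [J] growth steps in the double cube. The other
    half pays for the [2 * N] steps of the walk at scale [l / N], because [4 * N <= om N]. *)
Lemma blowup_times (N J : nat) (l s t : R) (Q := om 2)
    (T0 := 2 * ((2 * J%:R + 3) * Q + 6)) :
  (0 < N)%N -> 0 < l -> 4 <= om N%:R -> 4 * N%:R <= om N%:R ->
  T0 * om l <= t ->
  (forall j, (j <= J)%N ->
    s + lag (2 * l) + j%:R * lag (2 * l) + rho (2 * l) <= s + t - 2 * om l) /\
  (forall v i, v <= s + lag (2 * l) + J%:R * lag (2 * l) + rho (2 * l) +
                    lag (l / N%:R) -> (i <= 2 * N)%N ->
     v + i%:R * (T0 * om (l / N%:R)) + rho (l / N%:R) <= s + t - 2 * om l).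
Proof.
move=> N0 l0 h4 h4N ht; have gg0 := gamma_gt0; have gg1 := gamma_lt1.
have NR0 : 0 < N%:R :> R by rewrite ltr0n.
have Q0 : 0 < Q by exact: om_gt0.
have r0 : 0 < l / N%:R by rewrite divr_gt0.
have o0 := om_gt0 p l0; have o'0 := om_gt0 p r0.
have o2 : om (2 * l) = Q * om l by rewrite omM ?ltW.
have oN : om l = om N%:R * om (l / N%:R).
  by rewrite -omM ?ltW// mulrC divfK// gt_eqF.
have w0 : 0 < Q * om l by rewrite mulr_gt0.
set w := Q * om l in w0.
have JR0 : 0 <= J%:R :> R by rewrite ler0n.
have hlag : lag (2 * l) <= 2 * w by rewrite /lag o2 -/w ler_pM2r//; lra.
have hrho : rho (2 * l) <= w by rewrite /rho o2 -/w ler_piMl ?ltW//; lra.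
have lag0 : 0 <= lag (2 * l) by rewrite /lag o2 -/w mulr_ge0 ?ltW//; lra.
have T0w : T0 * om l = 2 * (2 * (J%:R * w) + 3 * w + 6 * om l).
  by rewrite /T0 /w; ring.
have Jw0 : 0 <= J%:R * w by rewrite mulr_ge0// ltW.
have hj j : (j <= J)%N -> j%:R * lag (2 * l) <= 2 * (J%:R * w).
  move=> jJ; apply: le_trans (_ : J%:R * lag (2 * l) <= _).
    by rewrite ler_wpM2r// ler_nat.
  by rewrite [leRHS]mulrCA ler_wpM2l.
split=> [j /hj hjJ|v i hv hi].
  lra.
have h1 : i%:R * (T0 * om (l / N%:R)) <= T0 * om l / 2.
  rewrite oN mulrCA -mulrA ler_wpM2l//.
    by rewrite /T0 mulr_ge0// addr_ge0// mulr_ge0 ?ltW// ltr_wpDl// mulr_ge0.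
  rewrite mulrAC ler_pM2r//.
  apply: le_trans (_ : 2 * N%:R <= _); first by rewrite -natrM ler_nat.
  by lra.
have h2 : lag (l / N%:R) <= om l.
  by rewrite /lag oN ler_pM2r//; lra.
have h3 : rho (l / N%:R) <= om l.
  by rewrite /rho oN ler_pM2r//; lra.
have := hj _ (leqnn J); lra.
Qed.

(* A drop between adjacent cubes forces a drop larger by a factor above N^(n + p) at scale
   l / N: the mean grows geometrically along the common double cube, so that some small cube
   has a large mean, and a walk of 2 N adjacent steps leads from it to a cube with a small one. *)
Lemma blowup : exists (N : nat) (T0 C0 : R),
  [/\ (1 < N)%N, 0 < T0, 0 < C0 & forall f a b l s t D,
    bmo1 f -> 0 < l -> touching a b l -> T0 * om l <= t <= 2 * T0 * om l ->
    C0 <= D -> D <= emean f a l s - emean f b l (s + t) ->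
    exists a' b' s', [/\ touching a' b' (l / N%:R),
      forall i, `|a' i - a i| <= 2 * l, s <= s',
      s' + T0 * om (l / N%:R) + rho (l / N%:R) <= s + t + rho l &
      2 * N%:R ^+ n * om N%:R * D <= emean f a' (l / N%:R) s' -
        emean f b' (l / N%:R) (s' + T0 * om (l / N%:R))]].
Proof.
have gg0 := gamma_gt0; have gg1 := gamma_lt1.
have [N [N1 h4 h4N]] := ex_om_large p_gt1 4.
have N0 : (0 < N)%N by exact: ltnW.
have NR0 : 0 < N%:R :> R by rewrite ltr0n.
set G := om N%:R in h4 h4N *; have G0 : 0 < G by exact: om_gt0.
pose X : R := 2 ^+ n; have X0 : 0 < X by rewrite exprn_gt0.
(* [N ^ n * om N] is the ratio of the volumes at the two scales; the factor 2 makes the product of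
   drop and volume double at every stage. *)
pose Lam := 2 * N%:R ^+ n * G.
have Nn0 : 0 < N%:R ^+ n :> R by rewrite exprn_gt0.
have Lam0 : 0 < Lam by rewrite !mulr_gt0.
have Xi0 : 0 < X^-1 by rewrite invr_gt0.
(* [J] growth steps turn a height of [D / 2] into [(2 * N * Lam + 1) * D], which [2 * N] steps down
   by [Lam * D] cannot undo. *)
have [J hJ] := ex_expr_ge (4 * N%:R * Lam + 2) Xi0.
pose T0 := 2 * ((2 * J%:R + 3) * om 2 + 6).
have Q0 : 0 < om 2 by exact: om_gt0.
have T00 : 0 < T0.
  by rewrite /T0 mulr_gt0// ltr_wpDl// mulr_ge0 ?ltW// ltr_wpDl// mulr_ge0.
have [C1 C10 hC1] := @ep_past R n S p gamma p_gt1 gamma_gt0 gamma_lt1 (2 * T0).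
(* [C2] collects the losses before the growth starts and is absorbed by one half of [D]. The other
   summand of [C0] pays for comparing the end of the walk with the cube [b]. *)
pose C2 := X * om 2 + C1 + 2 + X ^+ 2.
have XQ0 : 0 < X * om 2 by rewrite mulr_gt0.
have X20 : 0 < X ^+ 2 by rewrite exprn_gt0.
have C20 : 2 < C2 by rewrite /C2; lra.
pose C0 := 2 * C2 + 2 * N%:R ^+ n * G.
have NG0 : 0 < 2 * N%:R ^+ n * G by [].
have C00 : 0 < C0 by rewrite /C0; lra.
exists N, T0, C0; split=> // f a b l s t D bf l0 [k k1 bk] /andP[tl tu] hD hDe.
have lf : loc_integrable f by case: bf.
have D0 : 0 < D by exact: lt_le_trans hD.
have o0 := om_gt0 p l0.
pose c := corner a (fun i => if k i == -1 then -1 else 0) l.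
pose kb := [ffun i => if k i == 1 then ord_max else ord0 : 'I_2].
have bc : b = corner c (fun i => kb i) l.
  rewrite bk corner_corner; congr corner; apply/funext => i; rewrite ffunE.
  exact: int_split.
have l20 : 0 < 2 * l by rewrite mulr_gt0.
have ll0 : 0 < l / N%:R by rewrite divr_gt0.
set l' := l / N%:R in ll0 *.
have lN : N%:R * l' = l by rewrite mulrC divfK// gt_eqF.
have [ht1 ht2] := @blowup_times N J l s t N0 l0 h4 h4N tl.
pose mu' := emean f b l (s + t) + C1 + 2.
pose y := emean f c (2 * l) (s + lag (2 * l)).
have rl0 := rho_gt0 p gamma_lt1 l0.
have r2 : rho (2 * l) = om 2 * rho l.
  by rewrite /rho omM ?ltW// mulrCA.
have r2l0 : 0 < rho (2 * l) by exact: rho_gt0.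
have rr2 : rho l <= rho (2 * l).
  by rewrite r2 ler_peMl// ?(ltW rl0)//; apply: om_ge1 => //; rewrite ler1n.
have ml'0 : 0 <= lag l' by rewrite mulr_ge0 ?ltW ?om_gt0//; lra.
have ml0 : 0 <= lag (2 * l) by rewrite mulr_ge0 ?ltW ?om_gt0//; lra.
have hA : emean f a l s <= y + X * om 2.
  apply: emean_le_emean => //.
  - move=> z [hz /andP[hs1 hs2]]; split; last by rewrite hs1/=; lra.
    move=> i; have := hz i; rewrite /c /corner; case: ifP => _ /=.
      by rewrite mulrNz mulr1z mulN1r; lra.
    by rewrite mulr0z mul0r addr0; lra.
  - rewrite !vol_ebox// exprMn r2 -/X le_eqVlt; apply/orP; left; apply/eqP.
    by move: (rho l) (om 2) (X) => *; ring.
have z0 : D / 2 <= y - mu' - X ^+ 2.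
  move: hA hDe hD; rewrite /C0 /C2 /mu'.
  move: (emean f a _ _) (emean f b _ _) y (X * om 2) (X ^+ 2) XQ0 X20 => *; lra.
have ho2 := om_gt0 p l20.
have hb j : (j < J)%N -> integ (bx (corner c (fun i => kb i) l) l
    (s + lag (2 * l) + j%:R * lag (2 * l)) (rho (2 * l)) : set E) f <=
    mu' * (l ^+ n * rho (2 * l)).
  move=> jJ; rewrite -bc; set v := s + _ + _.
  have hv : ep f (bx b l v (rho (2 * l))) (emean f b l (s + t) + C1) <=
      l ^+ n * (rho (2 * l) + rho l).
    apply: hC1 => //; first exact: ltW.
    - have : 0 <= j%:R * lag (2 * l) by rewrite mulr_ge0.
      rewrite /v; lra.
    - by have := ht1 j (ltnW jJ); rewrite /v.
  apply: le_trans (integ_le_ep (emean f b l (s + t) + C1) _ lf) _.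
    exact: bounded_bx.
  have -> : vol (bx b l v (rho (2 * l)) : set E) = l ^+ n * rho (2 * l).
    by rewrite vol_bx// ltW.
  rewrite /mu' [leRHS]mulrDl lerD2l.
  apply: le_trans hv _; rewrite mulrCA ler_pM2l ?exprn_gt0//; lra.
have z0' : 0 <= y - mu' - X ^+ 2 by apply: le_trans z0; rewrite divr_ge0 ?ltW.
pose yJ := emean f c (2 * l) (s + lag (2 * l) + J%:R * lag (2 * l)).
have hgrow : (1 + X^-1) ^+ J * (y - mu' - X ^+ 2) <= yJ - mu' - X ^+ 2.
  exact: growth bf l0 hb z0'.
have zJ : (2 * N%:R * Lam + 1) * D <= yJ - mu' - X ^+ 2.
  apply: le_trans hgrow.
  have -> : (2 * N%:R * Lam + 1) * D = (4 * N%:R * Lam + 2) * (D / 2) by field.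
  apply: ler_pM => //; last by rewrite divr_ge0 ?ltW.
  by rewrite addr_ge0// mulr_ge0 ?ltW// mulr_gt0.
have N2l : (2 * N)%:R * l' = 2 * l by rewrite natrM -mulrA lN.
have [k0 [v0 [/andP[hv1 hv2] hk0]]] : exists (k0 : {ffun 'I_n -> 'I_(2 * N)}) v0,
    s + lag (2 * l) + J%:R * lag (2 * l) + lag l' <= v0 <=
    s + lag (2 * l) + J%:R * lag (2 * l) + rho (2 * l) + lag l' /\
    yJ - 2 - X ^+ 2 < emean f (corner c (fun i => k0 i) l') l' v0.
  rewrite -[X in rho X]N2l; apply: ex_small_ebox => //; first by rewrite muln_gt0.
  by rewrite N2l -/yJ; lra.
(* Without a large drop between adjacent small cubes, the walk from the high cube to the corner of
   [b] loses at most [2 * N * (Lam * D)], and its end, early enough for [ep_past], would still be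
   too high. *)
apply: contrapT => hno.
pose F (k : 'I_n -> int) (i : nat) :=
  emean f (corner c k l') l' (v0 + i%:R * (T0 * om l')).
pose kN (i : 'I_n) : int := N%:Z * kb i.
have d0 : 0 < T0 * om l' by rewrite mulr_gt0// om_gt0.
have hw : F (fun i => k0 i) 0%N <= F kN (2 * N)%N + (2 * N)%:R * (Lam * D).
  apply: (@walk_le R n 0 ((2 * N)%:Z - 1) (Lam * D)).
  - move=> k2 k3 i h2 h3 h23 iN; rewrite leNgt; apply/negP => hlt; apply: hno.
    exists (corner c k2 l'), (corner c k3 l'), (v0 + i%:R * (T0 * om l')).
    have iS : v0 + i%:R * (T0 * om l') + T0 * om l' = v0 + i.+1%:R * (T0 * om l').
      by rewrite -[i.+1%:R]natr1; ring.
    split.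
    + exists (fun j => k3 j - k2 j) => //.
      by rewrite corner_corner; congr corner; apply/funext => j; rewrite addrC subrK.
    + move=> j; rewrite /c /corner.
      have h4' : 0 <= (k2 j)%:~R * l' <= 2 * l.
        rewrite mulr_ge0 ?ler0z ?(ltW ll0)//=; last by case/andP: (h2 j).
        rewrite -N2l ler_pM2r// -[(2 * N)%:R]/((2 * N)%:Z%:~R) ler_int.
        exact: le_range.
      rewrite ler_norml; clear -h4' l0; case: ifP => _ /=;
        rewrite ?mulrNz ?mulr1z ?mulN1r ?mulr0z ?mul0r; lra.
    + have : 0 <= i%:R * (T0 * om l') by rewrite mulr_ge0 ?(ltW d0).
      have : 0 <= J%:R * lag (2 * l) by rewrite mulr_ge0.
      clear -hv1 ml0 ml'0; lra.
    + rewrite iS; apply: le_trans (ht2 v0 i.+1 hv2 iN) _.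
      by lra.
    + rewrite iS -/G -/Lam; apply/ltW; rewrite ltrBrDl.
      by move: hlt; rewrite /F.
  - by move=> j; exact: ord_range.
  - by move=> j; exact: mul_ord2_range.
  - by move=> j; apply: int_dist_range; [exact: mul_ord2_range|exact: ord_range].
have hF : F kN (2 * N)%N <= emean f b l (s + t) + C1 + 2 * N%:R ^+ n * G.
  rewrite /F (_ : corner c kN l' = b); last first.
    rewrite bc; apply/funext => j; rewrite /corner /kN intrM mulrAC.
    by rewrite -[(N%:Z)%:~R]/(N%:R) lN mulrC.
  set u' := v0 + _.
  have hu' := ht2 v0 (2 * N)%N hv2 (leqnn _).
  have r'0 := rho_gt0 p gamma_lt1 ll0.
  have hl' : l' <= l by rewrite -lN ler_peMl ?(ltW ll0)// ler1n.
  have hr' : rho l' <= rho l.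
    by rewrite /rho ler_pM2l ?subr_gt0// om_le// ltW.
  apply: emean_le_ep => //.
  apply: le_trans (_ : l ^+ n * (rho l' + rho l) <= _).
    apply: le_trans (_ : _ <= ep f (bx b l u' (rho l')) (emean f b l (s + t) + C1)) _.
      apply: ep_subset => //; [exact: measurable_bx|exact: bounded_bx|].
      by move=> z [hz ?]; split=> // i; have := hz i; clear -hl'; lra.
    apply: hC1 => //; first exact: ltW.
    have : 0 <= (2 * N)%:R * (T0 * om l') by rewrite mulr_ge0 ?(ltW d0).
    have : 0 <= J%:R * lag (2 * l) by rewrite mulr_ge0.
    rewrite /u'; clear -hv1 ml0 ml'0 tu; lra.
  rewrite vol_ebox//.
  have -> : 2 * N%:R ^+ n * G * (l' ^+ n * rho l') = l ^+ n * (rho l + rho l).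
    have -> : rho l = G * rho l' by rewrite /rho -lN omM ?ltW// mulrCA.
    have -> : l ^+ n = N%:R ^+ n * l' ^+ n by rewrite -exprMn lN.
    move: (rho l') (l' ^+ n) (N%:R ^+ n) (G) => *; ring.
  by rewrite ler_pM2l ?exprn_gt0// lerD2r.
have hk0' : yJ - 2 - X ^+ 2 < F (fun i => k0 i) 0%N by rewrite /F mul0r addr0.
have {}hw := lt_le_trans hk0' hw.
have {hF} := lt_le_trans hw (lerD hF (lexx _)).
move: zJ hD; rewrite natrM /C0 /mu'.
have -> : (2 * N%:R * Lam + 1) * D = 2 * N%:R * (Lam * D) + D by ring.
lra.
Qed.

End adjacent_cubes.

Lemma nat_dist_zero (N m : nat) (x : int) : (N <= m)%N -> `|x| <= N%:Z ->
  `|x - 0| <= m%:Z.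
Proof. by lia. Qed.

Lemma int_norm_range (N : nat) (x : int) : `|x| <= N%:Z -> - N%:Z <= x <= N%:Z.
Proof. by lia. Qed.

Lemma zero_range (N : nat) : - N%:Z <= (0 : int) <= N%:Z.
Proof. by lia. Qed.

Section harnack.
Context {R : realType} {n : nat} {S : box_space R n}.
Variables (p gamma : R).
Hypotheses (p_gt1 : 1 < p) (gamma_gt0 : 0 < gamma) (gamma_lt1 : gamma < 1).
Hypothesis n_gt0 : (0 < n)%N.
Local Notation E := (bs_type S).
Local Notation om := (om p).
Local Notation lag := (lag p gamma).
Local Notation rho := (rho p gamma).
Local Notation ebox := (@ebox R n S p gamma).
Local Notation emean := (@emean R n S p gamma).
Local Notation bmo1 := (@bmo1 R n S p gamma).
Implicit Types (f g : E -> R) (a b c : 'I_n -> R) (l r s t u v : R) (A : set E).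

Lemma emean_norm_le f a l s B : loc_integrable f -> 0 < l ->
  bounded_measurable B -> ebox a l s `<=` B ->
  `|emean f a l s| * vol (ebox a l s) <= integ B (fun z => `|f z|).
Proof.
move=> lf l0 bB sB.
have v0 : 0 < vol (ebox a l s) by exact: vol_ebox_gt0.
rewrite -[X in _ * X](gtr0_norm v0) -normrM -integ_ebox//.
apply: le_trans (_ : integ (ebox a l s) (fun z => `|f z|) <= _).
  apply: le_normr_Rintegral; first exact: measurable_bx.
  by apply: loc_integrable_on => //; exact: bounded_ebox.
by apply: integ_subset => //; [exact: measurable_bx|exact: loc_integrable_norm].
Qed.

(* Iterated, [blowup] would make the integral of |f| over a fixed box infinite. *)
Lemma adjacent_le : exists T0 C0 : R, [/\ 0 < T0, 0 < C0 &
  forall f a b l s t, bmo1 f -> 0 < l -> touching a b l ->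
    T0 * om l <= t <= 2 * T0 * om l ->
    emean f a l s <= emean f b l (s + t) + C0].
Proof.
have [N [T0 [C0 [N1 T00 C00 hblow]]]] :=
  blowup (S := S) p_gt1 gamma_gt0 gamma_lt1 n_gt0.
exists T0, C0; split=> // f a b l s t bf l0 hab ht.
rewrite leNgt; apply/negP => hlt.
have lf : loc_integrable f by case: bf.
pose D := emean f a l s - emean f b l (s + t).
have D0 : C0 < D by rewrite /D ltrBrDl.
have NR : 2 <= N%:R :> R by rewrite ler_nat.
have NR0 : 0 < N%:R :> R by exact: lt_le_trans NR.
pose L (i : nat) := l / N%:R ^+ i.
have L0 i : 0 < L i by rewrite divr_gt0// exprn_gt0.
have LS i : L i.+1 = L i / N%:R by rewrite /L exprSr invfM mulrA.
pose G := om N%:R.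
have G0 : 0 < G by exact: om_gt0.
have omL i : om (L i) = om (L i.+1) * G.
  have e : L i = N%:R * L i.+1 by rewrite LS mulrC divfK// gt_eqF.
  by rewrite {1}e omM ?(ltW NR0) ?(ltW (L0 _))// mulrC.
have Nn1 : 1 <= N%:R ^+ n :> R by rewrite exprn_ege1// (le_trans _ NR)// ler1n.
have G1 : 1 <= G by apply: om_ge1 => //; rewrite (le_trans _ NR)// ler1n.
pose Lam := 2 * N%:R ^+ n * G.
have Lam1 : 1 <= Lam.
  by rewrite /Lam -[leLHS]mulr1 ler_pM// -[leLHS]mulr1 ler_pM// ler1n.
(* The term [4 * L i] reserves room for the displacements still to come: at most [2 * L j] at each
   stage [j >= i], with [L] at least halved every time. *)
have step (i : nat) : exists a' b' s' t',
    [/\ touching a' b' (L i), T0 * om (L i) <= t' <= 2 * T0 * om (L i),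
      (forall j, `|a' j - a j| + 4 * L i <= 4 * l) /\
      Lam ^+ i * D <= emean f a' (L i) s' - emean f b' (L i) (s' + t'),
      s <= s' & s' + t' + rho (L i) <= s + t + rho l].
  elim: i => [|i [a' [b' [s' [t' [hab' ht' [haa hD] ss' st']]]]]].
    exists a, b, s, t; rewrite /L expr0 divr1; split=> //.
    by split; [move=> j; rewrite subrr normr0 add0r|rewrite mul1r].
  have CD : C0 <= Lam ^+ i * D.
    apply: le_trans (ltW D0) _; rewrite ler_peMl ?exprn_ege1//.
    exact: ltW (lt_trans C00 D0).
  have [a2 [b2 [s2 [h1 h2 h3 h4 h5]]]] := hblow f a' b' (L i) s' t' _ bf (L0 i) hab' ht' CD hD.
  exists a2, b2, s2, (T0 * om (L i.+1)); rewrite LS; split=> //.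
  - have q0 : 0 < T0 * om (L i / N%:R) by rewrite mulr_gt0// om_gt0// divr_gt0.
    by rewrite lexx/= -mulrA; lra.
  - split; last by rewrite exprS -mulrA.
    move=> j; have := haa j; have := h2 j.
    have : `|a2 j - a j| <= `|a2 j - a' j| + `|a' j - a j|.
      by rewrite (le_trans _ (ler_normD _ _))// addrA subrK.
    have : 4 * (L i / N%:R) <= 2 * L i.
      have q0 : 0 < L i / N%:R by rewrite divr_gt0.
      have : 2 * (L i / N%:R) <= N%:R * (L i / N%:R) by rewrite ler_pM2r.
      rewrite [N%:R * _]mulrC divfK ?gt_eqF//; lra.
    lra.
  - exact: le_trans h3.
  - exact: le_trans h4 st'.
have rl0 := rho_gt0 p gamma_lt1 l0.
pose Reg : set E := bx (fun j => a j - 4 * l) (8 * l) s (t + rho l).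
pose Z := integ Reg (fun z => `|f z|).
have bReg : bounded_measurable Reg by exact: bounded_bx.
pose V := l ^+ n * rho l.
have V0 : 0 < V by rewrite mulr_gt0 ?exprn_gt0.
have volL (i : nat) : L i ^+ n * rho (L i) * (N%:R ^+ n * G) ^+ i = V.
  elim: i => [|i ih]; first by rewrite expr0 mulr1 /L expr0 divr1.
  rewrite -ih LS exprS.
  have -> : rho (L i) = G * rho (L i / N%:R) by rewrite /rho omL LS; ring.
  have -> : L i ^+ n = (L i / N%:R) ^+ n * N%:R ^+ n.
    by rewrite -exprMn divfK// gt_eqF.
  move: (rho _) ((L i / _) ^+ n) ((N%:R ^+ n * G) ^+ i) (N%:R ^+ n) => *; ring.
have key (i : nat) : 2 ^+ i * D * V <= 2 * Z.
  have [a' [b' [s' [t' [[k hk bk] /andP[ht1 ht2] [haa hD] ss' st']]]]] := step i.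
  have ri0 := rho_gt0 p gamma_lt1 (L0 i).
  have Li := L0 i.
  have T0i : 0 < T0 * om (L i) by rewrite mulr_gt0 ?om_gt0.
  have lim : `|emean f a' (L i) s'| * vol (ebox a' (L i) s') <= Z.
    apply: emean_norm_le => // z [hz hzt]; split; last by lra.
    by move=> j; have := hz j; have := haa j; have := ler_norm (a' j - a j);
      have := ler_norm (- (a' j - a j)); rewrite normrN; lra.
  have lim' : `|emean f b' (L i) (s' + t')| * vol (ebox b' (L i) (s' + t')) <= Z.
    apply: emean_norm_le => // z [hz hzt]; split; last by lra.
    move=> j; have := hz j; have := haa j; have := ler_norm (a' j - a j).
    have := ler_norm (- (a' j - a j)); rewrite normrN bk /corner.
    have : - L i <= (k j)%:~R * L i <= L i.
      rewrite -ler_norml normrM (gtr0_norm Li) ler_piMl ?(ltW Li)//.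
      by rewrite -intr_norm -[1]/(1%:~R) ler_int.
    lra.
  move: lim lim'; rewrite !vol_ebox//.
  have := ler_norm (emean f a' (L i) s').
  have := ler_norm (- emean f b' (L i) (s' + t')); rewrite normrN.
  move: hD; move: (emean _ _ _ _) (emean _ _ _ _) => x y hD h1 h2.
  have W0 : 0 < L i ^+ n * rho (L i) by rewrite mulr_gt0 ?exprn_gt0.
  have := volL i; set W := L i ^+ n * _ in W0 *; move=> hV h3 h4.
  have h5 : Lam ^+ i * D * W <= 2 * Z.
    apply: le_trans (_ : (`|y| + `|x|) * W <= _); last by rewrite mulrDl; lra.
    by rewrite ler_pM2r//; lra.
  apply: le_trans h5; rewrite -hV.
  have -> : Lam ^+ i = 2 ^+ i * (N%:R ^+ n * G) ^+ i by rewrite -exprMn mulrA.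
  rewrite le_eqVlt; apply/orP; left; apply/eqP.
  move: (2 ^+ i) ((N%:R ^+ n * G) ^+ i) (W) => *; ring.
have [i hi] := @ex_expr_ge R 1 (2 * Z / (D * V) + 1) ltr01.
have DV : 0 < D * V by rewrite mulr_gt0// (lt_trans C00).
have := key i; rewrite -mulrA -ler_pdivlMr//.
by move: hi; rewrite -[1 + 1]/2; lra.
Qed.

(** The time [u - v] is cut into [m] equal steps whose length lies between [T0 * om l] and twice
    that. The lower bound on [u - v] gives [m >= N], enough steps to reach any offset of at most [N]
    cubes. *)
Lemma harnack : exists2 T0 : R, 0 < T0 & forall (N : nat) (T : R), (0 < N)%N ->
  exists2 C : R, 0 <= C & forall f a k l v u, bmo1 f -> 0 < l ->
    (forall i, `|k i| <= N%:Z) ->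
    N%:R * T0 * om l <= u - v <= T * om l ->
    emean f a l v <= emean f (corner a k l) l u + C.
Proof.
have [T0 [C0 [T00 C00 hadj]]] := adjacent_le.
exists T0 => // N T N0; exists (Num.max T 0 / T0 * C0).
  by rewrite mulr_ge0 ?divr_ge0 ?(ltW T00) ?(ltW C00)// le_max lexx orbT.
move=> f a k l v u bf l0 hk /andP[h1 h2].
have o0 := om_gt0 p l0.
have To0 : 0 < T0 * om l by rewrite mulr_gt0.
pose x := (u - v) / (T0 * om l).
have hx : N%:R <= x by rewrite ler_pdivlMr// mulrA.
have x0 : 0 <= x by rewrite (le_trans _ hx).
have /andP[hm1 hm2] := truncn_itv x0.
set m := Num.truncn x in hm1 hm2.
have Nm : (N <= m)%N by rewrite -ltnS -(ltr_nat R) (le_lt_trans hx).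
have m0 : (0 < m)%N by exact: leq_trans Nm.
have mR0 : 0 < m%:R :> R by rewrite ltr0n.
pose t := (u - v) / m%:R.
have uv : u - v = x * (T0 * om l) by rewrite /x divfK// gt_eqF.
clearbody x.
have ht : T0 * om l <= t <= 2 * T0 * om l.
  rewrite /t ler_pdivlMr// ler_pdivrMr// uv; apply/andP; split.
    by rewrite mulrC ler_pM2r.
  have h3 : x <= 2 * m%:R.
    have : 1 <= m%:R :> R by rewrite ler1n.
    by move: hm2; rewrite -natr1; lra.
  apply: le_trans (_ : 2 * m%:R * (T0 * om l) <= _).
    by rewrite ler_pM2r.
  by rewrite le_eqVlt; apply/orP; left; apply/eqP; ring.
pose F (k : 'I_n -> int) (i : nat) := emean f (corner a k l) l (v + i%:R * t).
have H : F (fun=> 0) 0%N <= F k m + m%:R * C0.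
  apply: (@walk_le R n (- N%:Z) N%:Z).
  - move=> k2 k3 i _ _ hk23 _; rewrite /F.
    have -> : v + i.+1%:R * t = v + i%:R * t + t by rewrite -[i.+1%:R]natr1; ring.
    apply: hadj => //; exists (fun j => k3 j - k2 j) => //.
    by rewrite corner_corner; congr corner; apply/funext => j; rewrite addrC subrK.
  - by move=> j; exact: zero_range.
  - by move=> j; exact: int_norm_range.
  - by move=> j; exact: (nat_dist_zero Nm (hk j)).
have e0 : F (fun=> 0) 0%N = emean f a l v.
  rewrite /F mul0r addr0; congr (emean f _ _ _).
  by apply/funext => i; rewrite /corner mulr0z mul0r addr0.
have em : F k m = emean f (corner a k l) l u.
  by rewrite /F /t [m%:R * _]mulrC divfK ?gt_eqF// addrC subrK.
rewrite -e0 -em; apply: le_trans H _; rewrite lerD2l ler_pM2r//.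
apply: le_trans hm1 _; rewrite ler_pdivlMr//.
apply: le_trans (_ : T <= _); last by rewrite le_max lexx.
by rewrite -(ler_pM2r o0) -mulrA -uv.
Qed.

End harnack.

(** * Approximation by locally constant functions *)

Section tame_approximation.
Import HBSimple.
Context {R : realType} {n : nat} {S : box_space R n}.
Local Notation E := (bs_type S).
Local Notation mu := (@bs_mu R n S).
Local Notation X := (@bs_X R n S).
Local Notation T := (@bs_T R n S).
Variables (a0 : 'I_n -> R) (l0 s0 t0 : R).
Hypotheses (l0_ge0 : 0 <= l0) (t0_ge0 : 0 <= t0).
Let K : set E := bx a0 l0 s0 t0.
Implicit Types (A B N : set E) (f g : E -> R) (e : R).

Definition close (r : R) (z z' : E) : Prop :=
  (forall i, `|X i z - X i z'| <= r) /\ `|T z - T z'| <= r.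

(** A quantitative form of a null boundary: off a small set, membership does not change at scale
    [r], even if [z'] leaves the frame. *)
Definition tame A : Prop := forall e, 0 < e -> exists r N,
  [/\ 0 < r, measurable N, vol (K `&` N) <= e &
    forall z z', K z -> ~ N z -> close r z z' -> (A z <-> A z')].

Lemma bounded_frame B : measurable B -> bounded_measurable (K `&` B).
Proof. by move=> mB; apply: boundedI => //; exact: bounded_bx. Qed.

Lemma vol_subset A B : measurable A -> bounded_measurable B -> A `<=` B ->
  vol A <= vol B.
Proof.
by move=> mA bB AB; apply: integ_subset => //; exact: loc_integrable_cst.
Qed.

Lemma vol_U A B : bounded_measurable A -> bounded_measurable B ->
  vol (A `|` B) <= vol A + vol B.
Proof.
by move=> bA bB; apply: integU_le => //; exact: loc_integrable_cst.
Qed.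

Lemma vol_frameU A B C : measurable A -> measurable B -> measurable C ->
  C `<=` A `|` B -> vol (K `&` C) <= vol (K `&` A) + vol (K `&` B).
Proof.
move=> mA mB mC CAB.
apply: le_trans (vol_U (bounded_frame mA) (bounded_frame mB)).
apply: vol_subset; first by case: (bounded_frame mC).
  by apply: boundedU; exact: bounded_frame.
by move=> z [Kz /CAB[Az|Bz]]; [left|right].
Qed.

Lemma tameC A : tame A -> tame (~` A).
Proof.
move=> hA e e0; have [r [N [r0 mN hN h]]] := hA e e0; exists r, N; split=> //.
by move=> z z' Kz Nz zz'; have := h z z' Kz Nz zz'; rewrite /setC /=; tauto.
Qed.

Lemma closeW r r' z z' : r <= r' -> close r z z' -> close r' z z'.
Proof.
by move=> rr [h1 h2]; split; [move=> i|]; apply: le_trans rr.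
Qed.

Lemma tameU A B : tame A -> tame B -> tame (A `|` B).
Proof.
move=> hA hB e e0; have e20 : 0 < e / 2 by rewrite divr_gt0.
have [r [N [r0 mN hN h]]] := hA _ e20.
have [r' [N' [r'0 mN' hN' h']]] := hB _ e20.
exists (Num.min r r'), (N `|` N'); split.
- by rewrite lt_min r0.
- exact: measurableU.
- by apply: le_trans (vol_frameU mN mN' (measurableU _ _ mN mN') (@subset_refl _ _)) _; lra.
- move=> z z' Kz Nz zz'.
  have h1 : close r z z' by apply: closeW zz'; rewrite ge_min lexx.
  have h2 : close r' z z' by apply: closeW zz'; rewrite ge_min lexx orbT.
  have := h z z' Kz (fun x => Nz (or_introl x)) h1.
  by have := h' z z' Kz (fun x => Nz (or_intror x)) h2; rewrite /setU /=; tauto.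
Qed.

Lemma tame0 : tame set0.
Proof.
move=> e e0; exists 1, set0; split=> //; rewrite setI0 /vol /integ.
by rewrite Rintegral_set0 ltW.
Qed.

Lemma tame_halfspace_X i r : tame [set z | X i z < r].
Proof.
move=> e e0.
pose M := \prod_(j | j != i) l0 * t0.
have M0 : 0 <= M by rewrite mulr_ge0// prodr_ge0.
(* The slab of half-width [2 * q] about the hyperplane has volume [4 * q * M] in the frame. Using
   [M + 1] avoids a division by zero for a degenerate frame. *)
pose q := e / (4 * (M + 1)).
have q0 : 0 < q by rewrite divr_gt0// mulr_gt0// ltr_wpDl.
pose a j := if j == i then r - 2 * q else a0 j.
pose b j := if j == i then r + 2 * q else a0 j + l0.
pose N : set E := [set z | X i z < r + 2 * q] `\` [set z | X i z < r - 2 * q].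
have mN : measurable N by apply: measurableD; exact: measurable_halfspace_X.
exists q, N; split=> //.
  have sub : K `&` N `<=` gbox a b s0 (s0 + t0).
    move=> z [[h1 h2] [h3 h4]]; split=> // j; rewrite /a /b; case: eqP => [->|_].
      by rewrite h3 andbT leNgt; apply/negP.
    exact: h1.
  have mug : mu (gbox a b s0 (s0 + t0)) = (4 * q * M)%:E.
    rewrite /gbox bs_mu_box ?lerDl//; last first.
      by move=> j; rewrite /a /b; case: eqP => _; [lra|rewrite lerDl].
    rewrite (bigD1 i)//= /a /b eqxx.
    rewrite (eq_bigr (fun=> l0)); last first.
      by move=> j /negPf ->; rewrite addrC addKr.
    by congr EFin; rewrite /M; ring.
  apply: (@le_trans _ _ (4 * q * M)).
    rewrite -lee_fin -mug -mu_vol; last exact: bounded_frame.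
    by apply: le_measure => //; rewrite inE; [case: (bounded_frame mN)|exact: measurable_gbox].
  rewrite /q; rewrite (_ : 4 * _ * M = e * (M / (M + 1))); last first.
    by field; rewrite gt_eqF// ltr_wpDl.
  by rewrite ler_piMr ?(ltW e0)// ler_pdivrMr ?ltr_wpDl// mul1r lerDl.
move=> z z' Kz Nz [/(_ i) h _] /=.
have hN : X i z < r - 2 * q \/ r + 2 * q <= X i z.
  case: (ltP (X i z) (r - 2 * q)) => h1; [by left|right].
  rewrite leNgt; apply/negP => h2; apply: Nz; split=> //.
  by apply/negP; rewrite -leNgt.
move: h; rewrite ler_norml => /andP[h1 h2].
by case: hN => h3; split => h4; lra.
Qed.

Lemma tame_halfspace_T r : tame [set z | T z < r].
Proof.
move=> e e0.
pose M := l0 ^+ n.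
have M0 : 0 <= M by rewrite exprn_ge0.
pose q := e / (4 * (M + 1)).
have q0 : 0 < q by rewrite divr_gt0// mulr_gt0// ltr_wpDl.
pose N : set E := [set z | T z < r + 2 * q] `\` [set z | T z < r - 2 * q].
have mN : measurable N by apply: measurableD; exact: measurable_halfspace_T.
exists q, N; split=> //.
  have sub : K `&` N `<=` bx a0 l0 (r - 2 * q) (4 * q).
    move=> z [[h1 h2] [h3 h4]]; split=> //; apply/andP; split.
      by rewrite leNgt; apply/negP.
    by move: h3; rewrite /=; lra.
  apply: le_trans (vol_subset _ (bounded_bx _ _ _ _) sub) _.
    by case: (bounded_frame mN).
  rewrite vol_bx//; last by rewrite mulr_ge0// ltW.
  rewrite -/M.
  rewrite /q; rewrite (_ : M * _ = e * (M / (M + 1))); last first.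
    by field; rewrite gt_eqF// ltr_wpDl.
  by rewrite ler_piMr ?(ltW e0)// ler_pdivrMr ?ltr_wpDl// mul1r lerDl.
move=> z z' Kz Nz [_ h] /=.
have hN : T z < r - 2 * q \/ r + 2 * q <= T z.
  case: (ltP (T z) (r - 2 * q)) => h1; [by left|right].
  rewrite leNgt; apply/negP => h2; apply: Nz; split=> //.
  by apply/negP; rewrite -leNgt.
move: h; rewrite ler_norml => /andP[h1 h2].
by case: hN => h3; split => h4; lra.
Qed.

Definition symd A B := (A `\` B) `|` (B `\` A).

(** Approximation in measure by tame sets. This weaker property passes to countable unions, hence to
    the generated sigma-algebra. *)
Definition tamable A : Prop := measurable A /\ forall e, 0 < e ->
  exists2 B, measurable B /\ tame B & vol (K `&` symd A B) <= e.

Lemma measurable_symd A B : measurable A -> measurable B -> measurable (symd A B).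
Proof. by move=> mA mB; apply: measurableU; exact: measurableD. Qed.

Lemma tame_tamable A : measurable A -> tame A -> tamable A.
Proof.
move=> mA tA; split=> // e e0; exists A => //.
by rewrite /symd setDv setU0 setI0 /vol /integ Rintegral_set0 ltW.
Qed.

Lemma tamableC A : tamable A -> tamable (~` A).
Proof.
move=> [mA hA]; split; first exact: measurableC.
move=> e e0; have [B [mB tB] hB] := hA e e0; exists (~` B).
  by split; [exact: measurableC|exact: tameC].
rewrite (_ : symd _ _ = symd A B)//; apply/seteqP; split=> z;
  have := EM (A z); have := EM (B z); rewrite /symd /setC /setD /setU /=; tauto.
Qed.

Lemma tamableU A B : tamable A -> tamable B -> tamable (A `|` B).
Proof.
move=> [mA hA] [mB hB]; split; first exact: measurableU.
move=> e e0; have e20 : 0 < e / 2 by rewrite divr_gt0.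
have [A' [mA' tA] hA'] := hA _ e20; have [B' [mB' tB] hB'] := hB _ e20.
exists (A' `|` B'); first by split; [exact: measurableU|exact: tameU].
apply: le_trans (@vol_frameU (symd A A') (symd B B') _ _ _ _ _) _.
- exact: measurable_symd.
- exact: measurable_symd.
- by apply: measurable_symd; exact: measurableU.
- by move=> z; rewrite /symd /=; tauto.
- lra.
Qed.

Lemma tamable_limit A : measurable A ->
  (forall e, 0 < e -> exists2 B, tamable B & vol (K `&` symd A B) <= e) ->
  tamable A.
Proof.
move=> mA h; split=> // e e0; have e20 : 0 < e / 2 by rewrite divr_gt0.
have [B [mB hB] hAB] := h _ e20; have [B' [mB' tB] hB'] := hB _ e20.
exists B' => //; apply: le_trans (@vol_frameU (symd A B) (symd B B') _ _ _ _ _) _.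
- exact: measurable_symd.
- exact: measurable_symd.
- exact: measurable_symd.
- by move=> z; rewrite /symd /=; have := EM (B z); tauto.
- lra.
Qed.

Lemma tamable_bigcup (F : nat -> set E) : (forall i, tamable (F i)) ->
  tamable (\bigcup_i F i).
Proof.
move=> hF.
have mF i : measurable (F i) by case: (hF i).
have mU : measurable (\bigcup_i F i) by exact: bigcup_measurable.
have hU m : tamable (\big[setU/set0]_(i < m) F i).
  elim: m => [|m ih]; first by rewrite big_ord0; apply: tame_tamable => //; exact: tame0.
  by rewrite big_ord_recr; exact: tamableU.
apply: tamable_limit => // e e0.
pose G m := K `&` (\bigcup_i F i `\` \big[setU/set0]_(i < m) F i).
have mG m : measurable (G m).
  by case: (bounded_frame (measurableD mU (proj1 (hU m)))).
have cG : mu (G m) @[m --> \oo] --> mu (\bigcap_m G m).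
  apply: nonincreasing_cvg_mu => //.
  - apply: (le_lt_trans (_ : _ <= mu K)%E); last exact: mu_bx_lty.
    by apply: le_measure => //; rewrite ?inE//; [exact: measurable_bx|move=> z []].
  - exact: bigcap_measurable.
  - move=> i j ij; apply/subsetPset => z [Kz [Uz hz]]; split=> //; split=> // hz'.
    have : (\bigcup_(k < i) F k) z by rewrite bigcup_mkord.
    move=> [k ki Fk]; apply: hz; rewrite -bigcup_mkord; exists k => //=.
    exact: leq_trans ij.
have G0 : \bigcap_m G m = set0.
  apply/seteqP; split=> // z hz; have [_ [[i _ Fi] _]] := hz 0%N Logic.I.
  have [_ [_ h]] := hz i.+1 Logic.I; apply: h.
  by rewrite -bigcup_mkord; exists i => /=.
rewrite G0 measure0 in cG.
move/fine_cvg : cG => /cvgrPdist_lt /(_ _ e0) [m _ /(_ m (leqnn _))] /=.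
have bG : bounded_measurable (G m).
  by apply: bounded_frame; apply: measurableD => //; case: (hU m).
rewrite sub0r normrN -vol_fine; last by case: bG.
rewrite ger0_norm ?vol_ge0// => hm.
exists (\big[setU/set0]_(i < m) F i) => //; rewrite (_ : _ `&` _ = G m) ?ltW//.
rewrite /G /symd; congr (_ `&` _); apply/seteqP; split=> z; last by left.
move=> [//|[]]; rewrite -bigcup_mkord => -[i _ Fi] /= h; exfalso; apply: h.
by exists i.
Qed.

Lemma tamable_gen A :
  <<s [set H | (exists i r, H = [set z : E | X i z < r]) \/
               (exists r, H = [set z : E | T z < r])] >> A -> tamable A.
Proof.
move: A; apply: smallest_sub.
  split.
  - by apply: tame_tamable => //; exact: tame0.
  - by move=> A hA; rewrite setTD; exact: tamableC.
  - exact: tamable_bigcup.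
move=> _ [[i [r ->]]|[r ->]]; apply: tame_tamable.
- exact: measurable_halfspace_X.
- exact: tame_halfspace_X.
- exact: measurable_halfspace_T.
- exact: tame_halfspace_T.
Qed.

Lemma measurable_tamable A : measurable A -> tamable A.
Proof.
move=> mA; apply: tamable_limit => // e e0.
have mK : measurable K by exact: measurable_bx.
have [B /tamable_gen hB hAB] := bs_approx mA mK (mu_bx_lty a0 l0 s0 t0) e0.
exists B => //; rewrite -lee_fin -mu_vol//.
by apply: bounded_frame; apply: measurable_symd => //; case: hB.
Qed.

Definition locally_const_approx f : Prop := forall e, 0 < e -> exists r g N,
  [/\ 0 < r, loc_integrable g, measurable N &
    [/\ integ K (fun z => `|f z - g z|) <= e, vol (K `&` N) <= e &
    forall z z', K z -> ~ N z -> close r z z' -> g z = g z']].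

Let bK : bounded_measurable K. Proof. exact: bounded_bx. Qed.

Lemma locally_const_limit f : loc_integrable f ->
  (forall e, 0 < e -> exists2 g, loc_integrable g /\ locally_const_approx g &
     integ K (fun z => `|f z - g z|) <= e) -> locally_const_approx f.
Proof.
move=> lf h e e0; have e20 : 0 < e / 2 by rewrite divr_gt0.
have [g [lg hg] fg] := h _ e20.
have [r [g' [N [r0 lg' mN [gg hN hc]]]]] := hg _ e20.
exists r, g', N; split=> //; split=> //; last by lra.
have l1 := loc_integrable_norm (loc_integrableB lf lg).
have l2 := loc_integrable_norm (loc_integrableB lg lg').
apply: le_trans (_ : integ K (fun z => `|f z - g z| + `|g z - g' z|) <= _).
  apply: integ_le => //.
  - by apply: loc_integrable_norm; exact: loc_integrableB.
  - exact: loc_integrableD.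
  - by move=> z _; rewrite (le_trans _ (ler_normD _ _))// addrA subrK.
rewrite integD//; lra.
Qed.

Lemma integ0 A : integ A (fun=> 0) = 0.
Proof. by rewrite /integ /Rintegral integral0. Qed.

Lemma locally_const0 : locally_const_approx (fun=> 0).
Proof.
move=> e e0; exists 1, (fun=> 0), set0; split=> //.
  exact: loc_integrable_cst.
split=> //.
- under [X in integ K X]eq_fun do rewrite subrr normr0.
  by rewrite integ0 ltW.
- by rewrite setI0 /vol /integ Rintegral_set0 ltW.
Qed.

Lemma locally_constD f g : loc_integrable f -> loc_integrable g ->
  locally_const_approx f -> locally_const_approx g ->
  locally_const_approx (fun z => f z + g z).
Proof.
move=> lf lg hf hg e e0; have e20 : 0 < e / 2 by rewrite divr_gt0.
have [r [f' [N [r0 lf' mN [ff hN hc]]]]] := hf _ e20.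
have [r' [g' [N' [r'0 lg' mN' [gg hN' hc']]]]] := hg _ e20.
exists (Num.min r r'), (fun z => f' z + g' z), (N `|` N'); split.
- by rewrite lt_min r0.
- exact: loc_integrableD.
- exact: measurableU.
split.
- have l1 := loc_integrable_norm (loc_integrableB lf lf').
  have l2 := loc_integrable_norm (loc_integrableB lg lg').
  apply: le_trans (_ : integ K (fun z => `|f z - f' z| + `|g z - g' z|) <= _).
    apply: integ_le => //.
    + apply: loc_integrable_norm; apply: loc_integrableB; exact: loc_integrableD.
    + exact: loc_integrableD.
    + by move=> z _; rewrite (le_trans _ (ler_normD _ _))// opprD addrACA.
  rewrite integD//; lra.
- by apply: le_trans (vol_frameU mN mN' (measurableU _ _ mN mN') (@subset_refl _ _)) _; lra.
- move=> z z' Kz Nz zz'; congr (_ + _).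
    apply: hc => //; first by move=> Nz'; apply: Nz; left.
    by apply: closeW zz'; rewrite ge_min lexx.
  apply: hc' => //; first by move=> Nz'; apply: Nz; right.
  by apply: closeW zz'; rewrite ge_min lexx orbT.
Qed.

Lemma loc_integrable_indic A : measurable A ->
  loc_integrable (\1_A : E -> R).
Proof.
move=> mA; apply: (@loc_integrable_le _ _ _ _ (fun=> 1)).
- exact: measurable_indic.
- exact: loc_integrable_cst.
- by move=> z; rewrite indicE; case: (_ \in _); rewrite ?normr1 ?normr0.
Qed.

Lemma locally_const_indic (c : R) A : measurable A ->
  locally_const_approx (fun z => c * \1_A z).
Proof.
move=> mA e e0.
pose e' := e / (`|c| + 1).
have c1 : 0 < `|c| + 1 by rewrite ltr_wpDl.
have e'0 : 0 < e' by rewrite divr_gt0.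
have e'e : e' <= e by rewrite /e' ler_pdivrMr// ler_peMr ?(ltW e0)// lerDr.
have [_ /(_ _ e'0)[B [mB tB] hB]] := measurable_tamable mA.
have [r [N [r0 mN hN hc]]] := tB _ e0.
have lB := loc_integrable_indic mB; have lA := loc_integrable_indic mA.
exists r, (fun z => c * \1_B z), N; split=> //; first exact: loc_integrableZ.
split=> //; last first.
  move=> z z' Kz Nz zz'; congr (_ * _); rewrite !indicE.
  by have h := hc z z' Kz Nz zz'; congr (nat_of_bool _)%:R; apply/idP/idP; rewrite !inE; apply h.
have mS := measurable_symd mA mB.
have lS := loc_integrable_indic mS.
apply: le_trans (_ : integ K (fun z => `|c| * \1_(symd A B) z) <= _).
  apply: integ_le => //.
  - by apply: loc_integrable_norm; apply: loc_integrableB; exact: loc_integrableZ.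
  - exact: loc_integrableZ.
  - move=> z _; rewrite -mulrBr normrM ler_wpM2l// !indicE.
    have [Az|Az] := boolP (z \in A); have [Bz|Bz] := boolP (z \in B);
      rewrite ?subrr ?normr0 ?ler0n// ?subr0 ?sub0r ?normrN ?normr1.
    + by rewrite mem_set//; left; split; [rewrite inE in Az|move/mem_set; exact/negP].
    + by rewrite mem_set//; right; split; [rewrite inE in Bz|move/mem_set; exact/negP].
rewrite integZ//.
have -> : integ K (\1_(symd A B) : E -> R) = vol (K `&` symd A B).
  rewrite /integ /Rintegral integral_indic//; last exact: measurable_bx.
  rewrite setIC vol_fine//; by case: (bounded_frame mS).
apply: le_trans (_ : `|c| * e' <= _); first by rewrite ler_wpM2l.
by rewrite /e' mulrCA ler_piMr ?(ltW e0)// ler_pdivrMr// mul1r lerDl.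
Qed.

(* A substitute for Lebesgue's differentiation theorem. *)
Lemma loc_integrable_locally_const f : loc_integrable f -> locally_const_approx f.
Proof.
move=> lf; apply: locally_const_limit => // e e0.
have mK : measurable K by exact: measurable_bx.
have [g_ [ig _ cg]] := approximation_sfun_integrable mK (loc_integrable_on bK lf).
have sumK (s : seq R) (g : {sfun E >-> R}) :
    let h := fun z => \sum_(y <- s) (y * \1_(g @^-1` [set y]) z) in
    loc_integrable h /\ locally_const_approx h.
  move=> /=; elim: s => [|y s [ih1 ih2]].
    under eq_fun do rewrite big_nil.
    by split; [exact: loc_integrable_cst|exact: locally_const0].
  under eq_fun do rewrite big_cons.
  have my : measurable (g @^-1` [set y]) by exact: measurable_sfunP.
  have ly : loc_integrable (fun z : E => y * \1_(g @^-1` [set y]) z).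
    by apply: loc_integrableZ; exact: loc_integrable_indic.
  split; first exact: loc_integrableD.
  by apply: locally_constD => //; exact: locally_const_indic.
have hg m : loc_integrable (g_ m) /\ locally_const_approx (g_ m).
  have [] := sumK (finmap.enum_fset (fset_set (range (g_ m)))) (g_ m).
  rewrite (_ : (fun z => _) = g_ m)//; apply/funext => z.
  by rewrite fimfunE fsbig_finite.
move/fine_cvg : cg => /cvgrPdist_lt /(_ _ e0) [m _ /(_ m (leqnn _))] /=.
rewrite sub0r normrN => hm; exists (g_ m) => //; apply: ltW; apply: le_lt_trans hm.
by rewrite ler_normr; apply/orP; left.
Qed.

End tame_approximation.

(** * Stopped cells of a parabolic grid *)

Section nested_families.
Context {R : realType} {n : nat} {S : box_space R n}.
Local Notation E := (bs_type S).
Variables (I : eqType) (F G : I -> set E).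
Hypothesis bF : forall i, bounded_measurable (F i).
Hypothesis bG : forall i, bounded_measurable (G i).

Definition big_union (H : I -> set E) (s : seq I) : set E :=
  \big[setU/set0]_(i <- s) H i.

Lemma in_union H s z : big_union H s z <-> exists2 i, i \in s & H i z.
Proof.
rewrite /big_union; elim: s => [|i s ih]; first by rewrite big_nil; split=> // -[].
rewrite big_cons; split=> [[Hz|/ih[j js Hz]]|[j]].
- by exists i => //; rewrite mem_head.
- by exists j => //; rewrite inE js orbT.
- by rewrite inE => /orP[/eqP->|js] Hz; [left|right; apply/ih; exists j].
Qed.

Lemma bounded_union (H : I -> set E) s : (forall i, bounded_measurable (H i)) ->
  bounded_measurable (big_union H s).
Proof.
move=> bH; rewrite /big_union; elim: s => [|i s ih]; rewrite ?big_nil ?big_cons.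
  exact: bounded_set0.
exact: boundedU.
Qed.

Variable le : I -> I -> Prop.
Hypothesis leF : forall i j, le i j -> F i `<=` F j.
Hypothesis leG : forall i j, le i j -> G i `<=` G j.

(** For cells listed from fine to coarse. Dropping every member that lies in a later one leaves a
    disjoint subfamily with the same union, so that local inequalities can be summed. *)
Fixpoint nested (s : seq I) : Prop := if s is i :: s' then
  (forall j, j \in s' -> le i j \/ F i `&` F j = set0) /\ nested s' else True.

Lemma nested_cons i s : nested (i :: s) ->
  (exists2 j, j \in s & le i j) \/ F i `&` big_union F s = set0.
Proof.
move=> [h _]; have [|hn] := pselect (exists2 j, j \in s & le i j); first by left.
right; apply/seteqP; split=> // z [Fi /in_union[j js Fj]].
have [lij|] := h j js; first by apply: hn; exists j.
by move/seteqP => [/(_ z) + _]; apply.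
Qed.

Lemma nested_integ_le s (g h : E -> R) : nested s ->
  loc_integrable g -> loc_integrable h ->
  (forall i, i \in s -> integ (F i) g <= integ (F i) h) ->
  integ (big_union F s) g <= integ (big_union F s) h.
Proof.
move=> + lg lh; elim: s => [|i s ih] ns H.
  by rewrite /big_union big_nil /integ !Rintegral_set0.
have {}ih : integ (big_union F s) g <= integ (big_union F s) h.
  by apply: ih; [case: ns|move=> j js; apply: H; rewrite inE js orbT].
rewrite /big_union big_cons -!/(big_union F s).
have [[j js lij]|d] := nested_cons ns.
  rewrite (_ : F i `|` big_union F s = big_union F s)//; apply/setUidPr => z Fz.
  by apply/in_union; exists j => //; exact: leF Fz.
by rewrite !integU// ?lerD//; [exact: H (mem_head _ _)|exact: bounded_union..].
Qed.

(** Since [G] is monotone for the same order, members dropped from the union of the [F i] add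
    nothing to that of the [G i] either. *)
Lemma nested_vol_le s (c : R) : nested s ->
  (forall i, i \in s -> vol (G i) <= c * vol (F i)) ->
  vol (big_union G s) <= c * vol (big_union F s).
Proof.
elim: s => [|i s ih] ns H.
  by rewrite /big_union !big_nil /vol /integ !Rintegral_set0 mulr0.
have {}ih : vol (big_union G s) <= c * vol (big_union F s).
  by apply: ih; [case: ns|move=> j js; apply: H; rewrite inE js orbT].
rewrite /big_union !big_cons -/(big_union F s) -/(big_union G s).
have [[j js lij]|d] := nested_cons ns.
  rewrite (_ : F i `|` big_union F s = big_union F s); last first.
    by apply/setUidPr => z Fz; apply/in_union; exists j => //; exact: leF Fz.
  rewrite (_ : G i `|` big_union G s = big_union G s)//.
  by apply/setUidPr => z Fz; apply/in_union; exists j => //; exact: leG Fz.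
rewrite [X in _ <= c * X]/vol integU//; [|exact: bounded_union|exact: loc_integrable_cst].
rewrite mulrDr; apply: le_trans (vol_U _ _) _ => //; first exact: bounded_union.
by rewrite lerD//; exact: H (mem_head _ _).
Qed.

End nested_families.

Section grid.
Context {R : realType} {n : nat} {S : box_space R n}.
Local Notation E := (bs_type S).
Variables (a0 : 'I_n -> R) (s0 : R) (N : nat) (gl gt : nat -> R) (gm : nat -> nat).
Hypotheses (N_gt0 : (0 < N)%N) (gm_gt0 : forall i, (0 < gm i)%N).
Hypotheses (gl_gt0 : forall i, 0 < gl i) (gt_gt0 : forall i, 0 < gt i).
Hypothesis glS : forall i, gl i = N%:R * gl i.+1.
Hypothesis gtS : forall i, gt i = (gm i)%:R * gt i.+1.

(** Generation, position in space and position in time. The positions are arbitrary integers, since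
    delayed copies may lie before the root. *)
Definition cell := (nat * {ffun 'I_n -> int} * int)%type.
Implicit Types (x y z : cell).
Definition gen x : nat := x.1.1.
Definition cx x : 'I_n -> R := corner a0 x.1.2 (gl (gen x)).
Definition ct x : R := s0 + (x.2)%:~R * gt (gen x).
Definition cbox x : set E := bx (cx x) (gl (gen x)) (ct x) (gt (gen x)).

Definition parent x : cell := if gen x is i.+1 then
  (i, [ffun l => (x.1.2 l %/ N)%Z], (x.2 %/ gm i)%Z) else x.

Definition csub x y : Prop :=
  [/\ forall l, cx y l <= cx x l /\ cx x l + gl (gen x) <= cx y l + gl (gen y),
      ct y <= ct x & ct x + gt (gen x) <= ct y + gt (gen y)].

Lemma csub_refl x : csub x x. Proof. by []. Qed.

Lemma csub_trans y x z : csub x y -> csub y z -> csub x z.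
Proof.
move=> [h1 h2 h3] [h4 h5 h6]; split.
- by move=> l; have [h7 h8] := h1 l; have [h9 h10] := h4 l; split;
    [exact: le_trans h7|exact: le_trans h10].
- exact: le_trans h2.
- exact: le_trans h6.
Qed.

Lemma csub_subset x y : csub x y -> cbox x `<=` cbox y.
Proof.
move=> [h1 h2 h3] w [hw /andP[hw1 hw2]]; split.
  move=> l; have /andP[h4 h5] := hw l; have [h6 h7] := h1 l; apply/andP; split.
    exact: le_trans h4.
  exact: lt_le_trans h7.
apply/andP; split; first exact: le_trans hw1.
exact: lt_le_trans h3.
Qed.

Lemma divz_interval (d : R) (k : int) (m : nat) : 0 < d -> (0 < m)%N ->
  (k %/ m)%Z%:~R * (m%:R * d) <= k%:~R * d /\
  k%:~R * d + d <= (k %/ m)%Z%:~R * (m%:R * d) + m%:R * d.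
Proof.
move=> d0 m0.
have e : k%:~R = (k %/ m)%Z%:~R * m%:R + (k %% m)%Z%:~R :> R.
  by rewrite {1}(divz_eq k m) intrD intrM.
have m0' : m%:Z != 0 by rewrite eqz_nat -lt0n.
have h1 : 0 <= (k %% m)%Z%:~R :> R by rewrite ler0z modz_ge0.
have h2 : (k %% m)%Z%:~R + 1 <= m%:R :> R.
  by rewrite -[1]/(1%:~R) -intrD -[m%:R]/(m%:~R) ler_int lezD1 ltz_pmod.
rewrite mulrA e !mulrDl; split.
  by rewrite lerDl mulr_ge0// ltW.
rewrite -addrA lerD2l -{2}[d]mul1r -mulrDl.
by rewrite ler_pM2r.
Qed.

Lemma csub_par x : csub x (parent x).
Proof.
case: x => [[[|i] k] j]; first exact: csub_refl.
split.
- move=> l; rewrite /cx /corner /parent /gen /= ffunE (glS i).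
  by have [h1 h2] := divz_interval (k l) (gl_gt0 i.+1) N_gt0; split;
    rewrite ?lerD2l// -!addrA lerD2l.
- by rewrite /ct /parent /gen /= (gtS i); have [h1 _] :=
    divz_interval j (gt_gt0 i.+1) (gm_gt0 i); rewrite lerD2l.
- by rewrite /ct /parent /gen /= (gtS i); have [_ h1] :=
    divz_interval j (gt_gt0 i.+1) (gm_gt0 i); rewrite -!addrA lerD2l.
Qed.

Lemma csub_iter_par d x : csub x (iter d parent x).
Proof.
elim: d => [|d ih]; first exact: csub_refl.
by apply: csub_trans ih _; exact: csub_par.
Qed.

Lemma gen_iter_par d x : gen (iter d parent x) = (gen x - d)%N.
Proof.
elim: d => [|d ih]; first by rewrite subn0.
rewrite iterS subnS -ih; case: (iter d parent x) => [[[|i] k] j] //.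
Qed.

Lemma cbox_uniq x y w : gen x = gen y -> cbox x w -> cbox y w -> x = y.
Proof.
case: x => [[i k] j]; case: y => [[i' k'] j']; rewrite /gen /= => <- {i'}.
move=> [h1 h2] [h3 h4]; congr (_, _, _).
  apply/ffunP => l; apply: (cell_uniq (gl_gt0 i)); first exact: h1.
  exact: h3.
by apply: (cell_uniq (gt_gt0 i)); [exact: h2|exact: h4].
Qed.

Lemma cbox_nested x y : (gen y <= gen x)%N ->
  csub x y /\ y = iter (gen x - gen y) parent x \/ cbox x `&` cbox y = set0.
Proof.
move=> yx; pose x' := iter (gen x - gen y) parent x.
have gx' : gen x' = gen y by rewrite gen_iter_par subKn.
have [e|ne] := eqVneq x' y.
  by left; split; [have := csub_iter_par (gen x - gen y) x; rewrite -/x' e|exact/esym].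
right; apply/seteqP; split=> // w [hx hy]; move/eqP: ne; apply.
by apply: (cbox_uniq gx' _ hy); apply: csub_subset hx; exact: csub_iter_par.
Qed.

Definition children x : seq cell :=
  [seq ((gen x).+1, [ffun l => N%:Z * x.1.2 l + (k l : nat)%:Z],
     (gm (gen x))%:Z * x.2 + r%:Z)
     | k : {ffun 'I_n -> 'I_N} <- enum {: {ffun 'I_n -> 'I_N}},
       r <- iota 0 (gm (gen x))].

Lemma childP x y : y \in children x -> gen y = (gen x).+1 /\ parent y = x.
Proof.
move=> /allpairsP[[k' r] /= [_ hr ->]]; rewrite /gen /parent /=; split=> //.
rewrite mem_iota /= add0n in hr.
case: x hr => [[i k] j]; rewrite /gen /= => hr; congr (_, _, _).
  apply/ffunP => l; rewrite !ffunE mulrC divzMDl ?eqz_nat -?lt0n//.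
  by rewrite divz_small ?addr0// ltz_nat ltn_ord.
rewrite mulrC divzMDl ?eqz_nat -?lt0n//.
by rewrite divz_small ?addr0// ltz_nat.
Qed.

Lemma cbox_children x : cbox x `<=` big_union cbox (children x).
Proof.
case: x => [[i k] j] w [h1 h2]; apply/in_union.
have /choice[k' hk'] : forall l, exists k' : 'I_N,
    cx (i, k, j) l + k'%:R * gl i.+1 <= bs_X l w <
    cx (i, k, j) l + k'%:R * gl i.+1 + gl i.+1.
  by move=> l; apply: cell_ex => //; rewrite -glS; exact: h1.
have [r hr] : exists r : 'I_(gm i), ct (i, k, j) + r%:R * gt i.+1 <= bs_T w <
    ct (i, k, j) + r%:R * gt i.+1 + gt i.+1.
  by apply: cell_ex => //; rewrite -gtS.
exists (i.+1, [ffun l => N%:Z * k l + (k' l : nat)%:Z], (gm i)%:Z * j + (r : nat)%:Z).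
  apply/allpairsP; exists ([ffun l => k' l], (r : nat)).
  split=> /=; [by rewrite mem_enum|by rewrite mem_iota /= add0n|].
  by congr (_, _, _); apply/ffunP => l; rewrite !ffunE.
split.
  move=> l; have := hk' l; rewrite /cx /corner /gen /= ffunE (glS i) intrD intrM.
  by rewrite mulrDl -!addrA mulrCA mulrA -[(Posz _)%:~R]/(_%:R).
have := hr; rewrite /ct /gen /= (gtS i) intrD intrM.
by rewrite mulrDl -!addrA mulrCA mulrA -[(Posz _)%:~R]/(_%:R).
Qed.

Lemma cbox_bounded x : bounded_measurable (cbox x).
Proof. exact: bounded_bx. Qed.

Lemma nested_gen (s : seq cell) : pairwise (fun x y => gen y <= gen x)%N s ->
  nested cbox csub s.
Proof.
elim: s => //= x s ih /andP[/allP h /ih ?]; split=> // y /h yx.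
by have [[? _]|?] := cbox_nested yx; [left|right].
Qed.

Variable live : pred cell.

Definition root_cell : cell := (0%N, [ffun=> 0], 0).

Fixpoint alive i : seq cell := if i is i'.+1 then
  [seq x <- flatten [seq children y | y <- alive i'] | live x] else [:: root_cell].

Definition stop i : seq cell := if i is i'.+1 then
  [seq x <- flatten [seq children y | y <- alive i'] | ~~ live x] else [::].

(** The finest generation comes first, which is the order that [nested] expects. *)
Fixpoint stops i : seq cell := if i is i'.+1 then stop i ++ stops i' else [::].

Lemma alive_gen i x : x \in alive i -> gen x = i.
Proof.
elim: i x => [|i ih] x /=; first by rewrite inE => /eqP ->.
by rewrite mem_filter => /andP[_ /flatten_mapP[y /ih <- /childP[-> _]]].
Qed.

Lemma aliveP i x : x \in alive i.+1 ->
  [/\ live x, parent x \in alive i & x \in children (parent x)].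
Proof.
rewrite /= mem_filter => /andP[lx /flatten_mapP[y yi yx]].
by have [_ px] := childP yx; split=> //; rewrite px.
Qed.

Lemma stopP i x : x \in stop i.+1 -> [/\ gen x = i.+1, ~~ live x,
  parent x \in alive i & x \in children (parent x)].
Proof.
rewrite /= mem_filter => /andP[lx /flatten_mapP[y yi yx]].
by have [gx px] := childP yx; rewrite gx (alive_gen yi) px.
Qed.

Lemma stopsP I x : x \in stops I -> exists2 i, (i < I)%N & x \in stop i.+1.
Proof.
elim: I => // I ih; rewrite [stops _]/= mem_cat => /orP[xI|/ih[i iI xi]].
  by exists I.
by exists i => //; exact: ltnW.
Qed.

Lemma alive_anc i d x : (d <= i)%N -> x \in alive i ->
  iter d parent x \in alive (i - d).
Proof.
elim: d => [|d ih] di xi; first by rewrite subn0.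
have := ih (ltnW di) xi; rewrite -(subnSK di) => /aliveP[_ h _].
by rewrite iterS.
Qed.

Lemma stop_anc i d x : (0 < d <= i.+1)%N -> x \in stop i.+1 ->
  iter d parent x \in alive (i.+1 - d).
Proof.
case: d => // d; rewrite ltnS => /andP[_ di] /stopP[_ _ px _].
by rewrite iterSr subSS; exact: alive_anc.
Qed.

Lemma alive_root i x : x \in alive i -> csub x root_cell.
Proof.
move=> xi; have := alive_anc (leqnn i) xi; rewrite subnn /= inE => /eqP <-.
exact: csub_iter_par.
Qed.

Lemma stops_root I x : x \in stops I -> csub x root_cell.
Proof.
move=> /stopsP[i _ /stopP[_ _ px _]].
by apply: csub_trans (csub_par x) (alive_root px).
Qed.

Lemma stops_disjoint I x y : x \in stops I -> y \in stops I ->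
  (gen y <= gen x)%N -> x = y \/ y != iter (gen x - gen y) parent x.
Proof.
move=> /stopsP[i _ xi] /stopsP[j _ yj] yx.
have [gx _ _ _] := stopP xi; have [gy ly _ _] := stopP yj.
have [d0|d0] := posnP (gen x - gen y).
  by rewrite d0 /=; have [->|ne] := eqVneq y x; [left|right].
right; apply: contraNneq ly => e.
have h : (0 < gen x - gen y <= i.+1)%N by rewrite d0 gx leq_subr.
have := stop_anc h xi; rewrite -e gx gy.
have <- : j.+1 = (i.+1 - (i.+1 - j.+1))%N by rewrite subKn// -gx -gy.
by move=> /aliveP[].
Qed.

Lemma cover_alive_stops I :
  cbox root_cell `<=` big_union cbox (alive I) `|` big_union cbox (stops I).
Proof.
elim: I => [|I ih] w hw.
  by left; apply/in_union; exists root_cell => //; rewrite mem_head.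
have [/in_union[x xI xw]|/in_union[x xI xw]] := ih w hw; last first.
  by right; apply/in_union; exists x => //=; rewrite mem_cat xI orbT.
have /in_union[y yx yw] := cbox_children xw.
have yf : y \in flatten [seq children z | z <- alive I].
  by apply/flatten_mapP; exists x.
have [ly|ly] := boolP (live y).
  by left; apply/in_union; exists y => //=; rewrite mem_filter ly.
by right; apply/in_union; exists y => //=; rewrite mem_cat mem_filter ly yf.
Qed.

Lemma pairwise_stops I : pairwise (fun x y => gen y <= gen x)%N (stops I).
Proof.
elim: I => // I ih; rewrite [stops _]/= pairwise_cat ih andbT; apply/andP; split.
  apply/allrelP => x y /stopP[gx _ _ _] /stopsP[i iI /stopP[gy _ _ _]].
  by rewrite gx gy ltnS ltnW.
apply/(pairwiseP root_cell) => i j; rewrite !inE => iI jI _.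
have [-> _ _ _] := stopP (mem_nth root_cell iI).
by have [-> _ _ _] := stopP (mem_nth root_cell jI).
Qed.

Variable q : nat.
Definition delay x : cell := (x.1, x.2 - q%:Z).
(** If a cell is moved back by at most [q] steps, the tower over the copy reaches up to the cell
    itself. Unlike a shift, towers are monotone in the cell. *)
Definition tower x : set E :=
  bx (cx x) (gl (gen x)) (ct x) (q.+1%:R * gt (gen x)).

Lemma gt_le i j : (i <= j)%N -> gt j <= gt i.
Proof.
move=> ij; rewrite -(subnKC ij); elim: (j - i)%N => [|d ih]; first by rewrite addn0.
apply: le_trans ih; rewrite addnS [leRHS]gtS ler_peMl ?(ltW (gt_gt0 _))//.
by rewrite ler1n.
Qed.

Lemma ct_delay x : ct (delay x) = ct x - q%:R * gt (gen x).
Proof. by rewrite /ct /delay /gen /= intrD intrN mulrDl mulNr addrA. Qed.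

Lemma csub_tower x y : (gen y <= gen x)%N -> csub x y -> tower x `<=` tower y.
Proof.
move=> yx [h1 h2 h3] w [hw /andP[hw1 hw2]]; split.
  move=> l; have /andP[h4 h5] := hw l; have [h6 h7] := h1 l; apply/andP; split.
    exact: le_trans h4.
  exact: lt_le_trans h7.
rewrite (le_trans h2)//=; apply: lt_le_trans hw2 _.
rewrite -natr1 !mulrDl !mul1r ![_ + gt _]addrC !addrA lerD// ler_wpM2l//.
exact: gt_le.
Qed.

Lemma pairwise_gen_map (D : cell -> cell) (s : seq cell) :
  (forall x, gen (D x) = gen x) ->
  pairwise (fun x y => gen y <= gen x)%N s ->
  pairwise (fun x y => gen y <= gen x)%N (map D s).
Proof.
move=> hD; rewrite pairwise_map => h; apply: sub_pairwise h => x y /=.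
by rewrite !hD.
Qed.

Lemma cbox_tower_delay x : cbox x `<=` tower (delay x).
Proof.
move=> w [h1 /andP[h2 h3]]; split=> //; rewrite ct_delay /gen /=.
have := ltW (gt_gt0 (gen x)); have := ler0n R q.
rewrite -natr1 mulrDl mul1r => h4 h5.
have : 0 <= q%:R * gt (gen x) by rewrite mulr_ge0.
by move: h2 h3; rewrite /gen => *; apply/andP; split; lra.
Qed.

Lemma vol_cbox x : vol (cbox x) = gl (gen x) ^+ n * gt (gen x).
Proof. by rewrite vol_bx// ltW. Qed.

Lemma vol_tower x : vol (tower x) = q.+1%:R * vol (cbox x).
Proof. by rewrite vol_cbox vol_bx ?mulr_ge0// ?(ltW (gt_gt0 _)) ?(ltW (gl_gt0 _))// mulrCA. Qed.

(* The nestedness of the grid replaces a Vitali covering: only the time direction is lost. *)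
Lemma vol_stops_le I (D : cell -> cell) : (forall x, gen (D x) = gen x) ->
  (forall x, cbox x `<=` tower (D x)) -> vol (big_union cbox (stops I)) <=
    q.+1%:R * vol (big_union cbox (map D (stops I))).
Proof.
move=> gD tD; have pD := pairwise_gen_map gD (pairwise_stops I).
apply: le_trans (_ : vol (big_union tower (map D (stops I))) <= _).
  apply: vol_subset.
  - by case: (bounded_union (stops I) cbox_bounded).
  - by apply: bounded_union => x; exact: bounded_bx.
  - move=> w /in_union[x xI xw]; apply/in_union; exists (D x); first exact: map_f.
    exact: tD.
apply: (@nested_vol_le _ _ _ _ _ _ _ _
   (fun x y => (gen y <= gen x)%N /\ csub x y)).
- exact: cbox_bounded.
- by move=> x; exact: bounded_bx.
- by move=> x y [_]; exact: csub_subset.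
- by move=> x y [yx]; exact: csub_tower.
- move: pD; move: (map _ _) => s.
  elim: s => //= x s ih /andP[/allP hx /ih ?]; split=> // y /hx yx.
  by have [[? _]|?] := cbox_nested yx; [left|right].
- by move=> x _; rewrite vol_tower.
Qed.

(* A stopped cell that is not contained in the delayed copy of a larger one meets such copies
   only in its top layer. *)
Definition fresh I : seq cell := [seq x <- stops I |
  ~~ `[< exists y, [/\ y \in stops I, (gen y <= gen x)%N & csub x (delay y)] >]].

Definition delayed I : set E := big_union cbox (map delay (stops I)).

Lemma fresh_sub I x : x \in fresh I -> x \in stops I.
Proof. by rewrite mem_filter => /andP[]. Qed.

Lemma bounded_delayed I : bounded_measurable (delayed I).
Proof. exact/bounded_union/cbox_bounded. Qed.

Lemma stops_cover I :
  big_union cbox (stops I) `<=` delayed I `|` big_union cbox (fresh I).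
Proof.
move=> w /in_union[x xI xw]; have [hx|hx] := boolP (x \in fresh I).
  by right; apply/in_union; exists x.
left; move: hx; rewrite mem_filter xI andbT negbK => /asboolP[y [yI _ xy]].
by apply/in_union; exists (delay y); [exact: map_f|exact: csub_subset xy _ xw].
Qed.

Lemma fresh_layer I x : x \in fresh I -> cbox x `&` delayed I `<=`
  bx (cx x) (gl (gen x)) (ct x + gt (gen x) - q%:R * gt (gen x).+1)
     (q%:R * gt (gen x).+1).
Proof.
move=> xf w [xw /in_union[_ /mapP[y yI ->] yw]].
have xI := fresh_sub xf.
have hxy : ~ ((gen y <= gen x)%N /\ csub x (delay y)).
  move=> [h1 h2]; move: xf; rewrite mem_filter => /andP[/negP + _]; apply.
  by apply/asboolP; exists y.
have yx : (gen x < gen y)%N.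
  rewrite ltnNge; apply/negP => yx.
  have [[h _]|] := @cbox_nested x (delay y) yx; first exact: hxy.
  by move/seteqP => [/(_ w (conj xw yw))].
have [[[dk dt1 dt2] _]|/seteqP[/(_ w (conj yw xw))]//] :=
  @cbox_nested (delay y) x (ltnW yx).
set y' := iter (gen y - gen x) parent y.
have gy' : gen y' = gen x by rewrite gen_iter_par subKn// ltnW.
have [yk yt1 yt2] : csub y y' by exact: csub_iter_par.
have gty := gt_gt0 (gen y); have gtx := gt_gt0 (gen x).
have qy : 0 <= q%:R * gt (gen y) by rewrite mulr_ge0// ltW.
have ne : x != y'.
  have [e|//] := stops_disjoint yI xI (ltnW yx).
  by move: yx; rewrite e ltnn.
have cy : ct x <= ct y by apply: le_trans dt1 _; rewrite ct_delay gerBl.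
(* [x] and [y'] have the same generation and share the spatial position of [y], so only their time
   indices can differ. *)
have lt2 : x.2 < y'.2.
  rewrite ltNge; apply/negP => h; move/eqP: ne; apply.
  move: yk yt1 yt2 gy' h; rewrite /ct; case: (y') => [[i' k'] j'] /=.
  rewrite /gen /= => yk yt1 yt2 gy' h.
  move: xw xI xf hxy yx dk dt1 dt2 gtx cy gy' h yk yt1 yt2.
  rewrite /ct /gen; case: (x) => [[i k] j] /= xw xI xf hxy yx dk dt1 dt2 gtx cy.
  move=> gy'; rewrite gy' => h yk yt1 yt2; congr (_, _, _).
    apply/ffunP => l; have [h1 h2] := dk l; have [h3 h4] := yk l.
    have gly := gl_gt0 (gen y).
    move: h1 h2 h3 h4; rewrite /cx /corner /gen /= => h1 h2 h3 h4.
    apply: (@cell_uniq _ (a0 l) (gl i) (a0 l + (y.1.2 l)%:~R * gl y.1.1)) => //.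
      by apply/andP; split; rewrite /gen in gly; lra.
    by apply/andP; split; rewrite /gen in gly; lra.
  apply/eqP; rewrite eq_le h andbT.
  rewrite leNgt; apply/negP => h'.
  have : (j' + 1)%:~R <= j%:~R :> R by rewrite ler_int lezD1.
  rewrite intrD -(ler_pM2r gtx) mulrDl mul1r.
  rewrite /gen in gty; lra.
have cy' : ct x + gt (gen x) <= ct y'.
  have : (x.2 + 1)%:~R <= (y'.2)%:~R :> R by rewrite ler_int lezD1.
  rewrite intrD -(ler_pM2r gtx) mulrDl mul1r /ct gy'; lra.
have gyx : q%:R * gt (gen y) <= q%:R * gt (gen x).+1.
  by rewrite ler_wpM2l// gt_le.
move: xw yw => [hw /andP[hw1 hw2]] [_ /andP[hw3 _]]; split=> //.
rewrite ct_delay in hw3; apply/andP; split; lra.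
Qed.

(** With that many time layers, the top [q] of them fill at most a proportion [b / 4] of a cell. *)
Hypothesis gm_large : forall i, (4 * q * q.+1 <= gm i)%N.
Let b : R := (q.+1%:R)^-1.

Lemma fresh_ratio i : q%:R * gt i.+1 <= b / 4 * gt i.
Proof.
rewrite [gt i]gtS mulrA ler_pM2r// /b -mulrA mulrC -mulrA.
rewrite -ler_pdivrMl ?invr_gt0// invrK mulrC -ler_pdivrMl ?invr_gt0 ?ltr0n//.
rewrite invrK -[4]/(4%:R) -!natrM ler_nat; apply: leq_trans (gm_large i).
by rewrite mulnC -mulnA mulnC.
Qed.

Lemma b_gt0 : 0 < b. Proof. by rewrite invr_gt0 ltr0n. Qed.
Lemma b_le1 : b <= 1. Proof. by rewrite invf_le1 ?ltr0n// ler1n. Qed.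

Lemma integ_indic A B : bounded_measurable A -> measurable B ->
  integ A (\1_B : E -> R) = vol (A `&` B).
Proof.
move=> bA mB; rewrite /integ /Rintegral integral_indic//; last by case: bA.
by rewrite setIC vol_fine//; apply: measurableI => //; case: bA.
Qed.

Lemma vol_fresh_delayed I : vol (big_union cbox (fresh I) `&` delayed I) <=
  b / 4 * vol (big_union cbox (fresh I)).
Proof.
have [mV _] := bounded_delayed I.
have bf : bounded_measurable (big_union cbox (fresh I)) by exact/bounded_union/cbox_bounded.
rewrite -integ_indic// -integ_cst//.
apply: (@nested_integ_le _ _ _ _ _ cbox_bounded csub csub_subset).
- by apply: nested_gen; apply: pairwise_filter; exact: pairwise_stops.
- exact: loc_integrable_indic.
- exact: loc_integrable_cst.
move=> x xf; have bx' := cbox_bounded x; rewrite integ_indic// integ_cst//.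
apply: le_trans (_ : vol (bx (cx x) (gl (gen x))
   (ct x + gt (gen x) - q%:R * gt (gen x).+1) (q%:R * gt (gen x).+1) : set E) <= _).
  apply: vol_subset; [by case: (boundedI bx' mV)|exact: bounded_bx|].
  exact: fresh_layer.
rewrite vol_bx ?mulr_ge0 ?(ltW (gl_gt0 _)) ?(ltW (gt_gt0 _))// vol_cbox [leRHS]mulrCA.
by rewrite ler_pM2l ?exprn_gt0//; exact: fresh_ratio.
Qed.

(** The root prolonged backwards by the longest possible delay: stopped cells have generation at
    least 1. *)
Definition frame : set E := bx a0 (gl 0) (s0 - q%:R * gt 1) (gt 0 + q%:R * gt 1).

Lemma cbox_root : cbox root_cell = bx a0 (gl 0) s0 (gt 0).
Proof.
rewrite /cbox /root_cell /ct /gen /= mulr0z mul0r addr0; congr bx.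
by apply/funext => l; rewrite /cx /corner /= ffunE mulr0z mul0r addr0.
Qed.

Lemma vol_frame : vol frame <= (1 + b / 4) * vol (cbox root_cell).
Proof.
have g0 := gt_gt0 0; have g1 := gt_gt0 1.
rewrite vol_cbox vol_bx ?(ltW (gl_gt0 _))//; last by rewrite addr_ge0// ?mulr_ge0// ltW.
rewrite /gen /= mulrCA ler_pM2l ?exprn_gt0// mulrDl mul1r lerD2l.
exact: fresh_ratio.
Qed.

Lemma root_frame : cbox root_cell `<=` frame.
Proof.
rewrite cbox_root => w [h1 h2]; split=> //.
have : 0 <= q%:R * gt 1 by rewrite mulr_ge0// ltW.
by move=> ?; apply/andP; split; lra.
Qed.

Lemma delayed_frame I : delayed I `<=` frame.
Proof.
move=> w /in_union[_ /mapP[x xI ->] [h1 h2]].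
have [i _ xi] := stopsP xI; have [gx _ _ _] := stopP xi.
have [k1 k2 k3] := stops_root xI.
have cr : ct root_cell = s0 by rewrite /ct /root_cell /= mulr0z mul0r addr0.
have qx : q%:R * gt (gen x) <= q%:R * gt 1 by rewrite ler_wpM2l// gt_le// gx.
have q0 : 0 <= q%:R * gt (gen x) by rewrite mulr_ge0// ltW.
move: h2; rewrite ct_delay -[gen (delay x)]/(gen x) => h2.
rewrite cr -[gen root_cell]/0%N in k2 k3; split; last by apply/andP; split; lra.
move=> l; have := k1 l; have := h1 l.
rewrite -[cx (delay x) l]/(cx x l) -[gen (delay x)]/(gen x) -[gen root_cell]/0%N.
by rewrite [cx root_cell l]/cx /corner ffunE mulr0z mul0r addr0; lra.
Qed.

Lemma vol_delayed I : vol (delayed I) <= (1 + b / 4) * vol (cbox root_cell).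
Proof.
apply: le_trans vol_frame; apply: vol_subset; last exact: delayed_frame.
  by case: (bounded_delayed I).
exact: bounded_bx.
Qed.

Lemma stops_in_root I : big_union cbox (stops I) `<=` cbox root_cell.
Proof. by move=> w /in_union[x /stops_root xr xw]; exact: csub_subset xr _ xw. Qed.

(** Here [x], [v] and [r] are the volumes of the fresh cells, of the delayed copies and of the root.
    The copies satisfy [v >= b * x], and the part of the fresh cells outside them shares the frame
    with them. The conclusion follows from [1 + b / 4 <= (1 - b / 4) * (1 + 3 * b / 4)], true for
    [0 <= b <= 1]. *)
Lemma fresh_arith (x v r : R) : 0 <= x -> 0 <= r ->
  x <= b / 4 * x + ((1 + b / 4) * r - v) -> x <= q.+1%:R * v ->
  x <= (1 - b / 4) * r.
Proof.
move=> x0 r0 h1; rewrite -ler_pdivrMl ?ltr0n// -/b => h2.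
have b0 := b_gt0; have b1 := b_le1.
have h3 : x * (1 + 3 * (b / 4)) <= (1 + b / 4) * r by lra.
have h4 : 0 < 1 + 3 * (b / 4) by lra.
rewrite -(ler_pM2r h4); apply: le_trans h3 _.
rewrite mulrAC ler_wpM2r//.
have : b * b <= b by rewrite ler_piMr// ltW.
lra.
Qed.

Lemma vol_fresh I : vol (big_union cbox (fresh I)) <= (1 - b / 4) * vol (cbox root_cell).
Proof.
have bV := bounded_delayed I; have [mV _] := bV.
have bf : bounded_measurable (big_union cbox (fresh I)) by exact/bounded_union/cbox_bounded.
have fs : big_union cbox (fresh I) `<=` big_union cbox (stops I).
  by move=> w /in_union[x /fresh_sub xI xw]; apply/in_union; exists x.
have [mf _] := bf.
apply: (@fresh_arith _ (vol (delayed I))); [exact: vol_ge0|exact: vol_ge0| |].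
- rewrite {1}/vol (integ_split bf mV); last exact: loc_integrable_cst.
  rewrite lerD//; first exact: vol_fresh_delayed.
  rewrite lerBrDr; apply: le_trans vol_frame.
  rewrite -[X in _ + X]/(integ _ _) -integU//.
  + apply: vol_subset.
    * by apply: measurableU => //; exact: measurableD.
    * exact: bounded_bx.
    * move=> w [[/fs/stops_in_root wr _]|]; first exact: root_frame.
      exact: delayed_frame.
  + exact: boundedD.
  + exact: loc_integrable_cst.
  + by apply/seteqP; split=> // w [[_ h] h'].
- have gD x : gen (delay x) = gen x by [].
  apply: le_trans (vol_stops_le I gD cbox_tower_delay); apply: vol_subset => //.
  exact/bounded_union/cbox_bounded.
Qed.

End grid.

Lemma integ_time_sum (R : realType) (n : nat) (S : box_space R n) (a : 'I_n -> R)
    (l s t : R) (m : nat) (g : bs_type S -> R) : loc_integrable g -> 0 <= t ->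
  integ (bx a l s (m%:R * t) : set (bs_type S)) g =
  \sum_(j < m) integ (bx a l (s + j%:R * t) t : set (bs_type S)) g.
Proof.
move=> lg t0; elim: m => [|m ih].
  by rewrite big_ord0 mul0r bx_empty// /integ Rintegral_set0.
rewrite big_ord_recr /= -ih -natr1 mulrDl mul1r integ_time_split//.
by rewrite mulr_ge0.
Qed.

(** * Oscillation from below *)

Section alive_cells.
Context {R : realType} {n : nat} {S : box_space R n}.
Variables (p gamma : R).
Hypotheses (p_gt1 : 1 < p) (gamma_gt0 : 0 < gamma) (gamma_lt1 : gamma < 1).
Local Notation E := (bs_type S).
Local Notation om := (om p).
Local Notation lag := (lag p gamma).
Local Notation rho := (rho p gamma).
Local Notation ebox := (@ebox R n S p gamma).
Local Notation emean := (@emean R n S p gamma).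
Local Notation bmo1 := (@bmo1 R n S p gamma).
Variables (a0 : 'I_n -> R) (s0 : R) (N : nat) (gl gt : nat -> R) (gm : nat -> nat).
Hypotheses (N_gt0 : (0 < N)%N) (gm_gt0 : forall i, (0 < gm i)%N).
Hypotheses (gl_gt0 : forall i, 0 < gl i) (gt_gt0 : forall i, 0 < gt i).
Hypothesis glS : forall i, gl i = N%:R * gl i.+1.
Hypothesis gtS : forall i, gt i = (gm i)%:R * gt i.+1.
Variable q : nat.
Local Notation cx := (cx a0 gl).
Local Notation ct := (ct s0 gt).
Local Notation cbox := (@cbox R n S a0 s0 gl gt).
Implicit Types (f g : E -> R) (x y : @cell n).

Lemma sum_cells (s : seq (@cell n)) i g : loc_integrable g -> uniq s ->
  (forall x, x \in s -> gen x = i) ->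
  integ (big_union cbox s) g = \sum_(x <- s) integ (cbox x) g.
Proof.
move=> lg us gs; pose F x := if gen x == i then cbox x else set0.
have [||_] := @integ_bigU _ _ _ (@cell n) s F g lg _ _ us.
- by move=> x; rewrite /F; case: ifP => _; [exact: cbox_bounded|exact: bounded_set0].
- move=> x y xy; rewrite /F; case: ifP => [/eqP gx|_]; last by rewrite set0I.
  case: ifP => [/eqP gy|_]; last by rewrite setI0.
  apply/seteqP; split=> // w [hx hy]; move/eqP: xy; apply.
  by apply: (cbox_uniq gl_gt0 gt_gt0 _ hx hy); rewrite gx gy.
have e : big_union cbox s = \big[setU/set0]_(x <- s) F x.
  by rewrite /big_union; apply: eq_big_seq => x xs; rewrite /F gs// eqxx.
by rewrite e => ->; apply: eq_big_seq => x xs; rewrite /F gs// eqxx.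
Qed.

Lemma sum_cells_le (s : seq (@cell n)) i g A : loc_integrable g ->
  (forall z, 0 <= g z) -> bounded_measurable A -> uniq s ->
  (forall x, x \in s -> gen x = i) -> (forall x, x \in s -> cbox x `<=` A) ->
  \sum_(x <- s) integ (cbox x) g <= integ A g.
Proof.
move=> lg g0 bA us gs sA; rewrite -(sum_cells lg us gs).
apply: integ_subset => //.
  by have [mU _] := bounded_union s (fun x => @cbox_bounded R n S a0 s0 gl gt x).
by move=> w /in_union[x xs xw]; exact: sA xw.
Qed.

(** The reference mean. Its box is the late half of a rectangle whose early half contains the
    delayed copy of [x], so an upper bound on [cval] limits the excess of [f] on that copy. *)
Definition cval f x : R := emean f (cx x) (gl (gen x))
  (ct x - q%:R * gt (gen x) + lag (gl (gen x))).

Hypothesis gt_om : forall i, 4 * om (gl i) <= q%:R * gt i.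
Hypothesis gt_rho : forall i, gt i <= rho (gl i).
Hypothesis gl_cvg : forall r, 0 < r -> exists i, gl i.+1 <= r.
Hypothesis gt_cvg : forall r, 0 < r -> exists i, gt i.+1 <= r.

(** The truncation at [k] makes the suprema of the stopping arguments finite; the final bounds do
    not contain it, or only through a limit. *)
Definition lower_part f (h k : R) : E -> R :=
  fun z => Num.min (Num.max (h - f z) 0) k.

Lemma loc_integrable_lower f h k : loc_integrable f ->
  loc_integrable (lower_part f h k).
Proof.
move=> lf; apply: loc_integrable_min; last exact: loc_integrable_cst.
apply: loc_integrable_max; last exact: loc_integrable_cst.
by apply: loc_integrableB => //; exact: loc_integrable_cst.
Qed.

Definition past_box x : set E :=
  bx (cx x) (gl (gen x)) (ct x - q%:R * gt (gen x)) (q%:R * gt (gen x)).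

Lemma reference_past x : ebox (cx x) (gl (gen x))
    (ct x - q%:R * gt (gen x) + lag (gl (gen x))) `<=` past_box x.
Proof.
have gg0 := gamma_gt0; have gg1 := gamma_lt1.
move=> w [h1 /andP[h2 h3]]; split=> //.
have o0 := om_gt0 p (gl_gt0 (gen x)); have := gt_om (gen x).
have lr : lag (gl (gen x)) + rho (gl (gen x)) = 2 * om (gl (gen x)).
  by rewrite /lag /rho; ring.
have : 0 < lag (gl (gen x)) by rewrite mulr_gt0//; lra.
by move=> *; apply/andP; split; lra.
Qed.

Lemma integ_past_box x g : loc_integrable g -> integ (past_box x) g =
  \sum_(j < q) integ (cbox (x.1, x.2 - q%:Z + (j : nat)%:Z)) g.
Proof.
move=> lg; rewrite /past_box integ_time_sum ?(ltW (gt_gt0 _))//.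
apply: eq_bigr => j _; rewrite /cbox; congr (integ (bx _ _ _ _) _).
rewrite /ct /gen /= intrD intrB -[(Posz j)%:~R]/(j%:R) -[(Posz q)%:~R]/(q%:R).
by rewrite mulrDl mulrBl !addrA.
Qed.

(* On a live cell the mean over the reference box is at least [h], so that only the oscillation
   of a locally constant approximation of [f] contributes. *)
Lemma alive_cell_le f g h k x : loc_integrable f -> loc_integrable g ->
  h <= cval f x -> forall c, (forall z, cbox x z -> g z = c) ->
  (forall z, ebox (cx x) (gl (gen x))
    (ct x - q%:R * gt (gen x) + lag (gl (gen x))) z -> g z = c) ->
  integ (cbox x) (lower_part f h k) <=
    integ (cbox x) (fun z => `|f z - g z|) +
    integ (past_box x) (fun z => `|f z - g z|).
Proof.
move=> lf lg hx c gc gc'.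
have bP := bounded_bx.
have lfg := loc_integrable_norm (loc_integrableB lf lg).
have lc c' : loc_integrable (fun=> c' : R) by exact: loc_integrable_cst.
pose d := Num.max (h - c) 0.
have d0 : 0 <= d by rewrite le_max lexx orbT.
apply: le_trans (_ : integ (cbox x) (fun z => `|f z - g z| + d) <= _).
  apply: integ_le; [exact: cbox_bounded|exact: loc_integrable_lower|exact: loc_integrableD|].
  move=> z xz; rewrite ge_min; apply/orP; left; rewrite ge_max; apply/andP; split.
    have h1 : h - c <= d by rewrite le_max lexx.
    have := ler_norm (- (f z - g z)); rewrite normrN gc//; lra.
  by rewrite addr_ge0.
rewrite integD//; last exact: cbox_bounded.
rewrite lerD2l integ_cst; last exact: cbox_bounded.
rewrite vol_cbox//.
set P := ebox _ _ _ in gc'.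
have bPb : bounded_measurable P by exact: bounded_ebox.
have vP : vol P = gl (gen x) ^+ n * rho (gl (gen x)) by rewrite vol_ebox.
have P0 : 0 < vol P by exact: vol_ebox_gt0.
apply: le_trans (_ : integ P (fun z => `|f z - g z|) <= _); last first.
  by apply: integ_subset => //; [exact: measurable_bx|exact: bP|exact: reference_past].
apply: le_trans (_ : d * vol P <= _).
  by rewrite vP ler_wpM2l// ler_pM2l ?exprn_gt0.
have [hc|hc] := leP (h - c) 0.
  by rewrite /d max_r// mul0r integ_ge0.
rewrite /d max_l; last exact: ltW.
have : h * vol P <= integ P f.
  by rewrite integ_ebox// -/P ler_pM2r.
have -> : integ P f = integ P (fun z => (f z - g z) + c).
  by apply: eq_Rintegral => z; rewrite inE => Pz; rewrite gc'// subrK.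
rewrite integD//; last exact: loc_integrableB.
rewrite integ_cst// mulrBl => h1.
apply: le_trans (_ : integ P (fun z => f z - g z) <= _); first by lra.
apply: integ_le => //; first exact: loc_integrableB.
by move=> z _; exact: ler_norm.
Qed.

Lemma delay_frame x : (0 < gen x)%N -> csub a0 s0 gl gt x root_cell ->
  forall j, (j <= q)%N -> cbox (x.1, x.2 - q%:Z + j%:Z) `<=` frame a0 s0 gl gt q.
Proof.
move=> gx [k1 k2 k3] j jq w [h1 h2].
have cr : ct (@root_cell n) = s0 by rewrite /ct /gen /= mulr0z mul0r addr0.
have qx : q%:R * gt (gen x) <= q%:R * gt 1.
  by rewrite ler_wpM2l//; exact: (gt_le gm_gt0 gt_gt0 gtS).
have g0 := gt_gt0 (gen x).
have e : ct (x.1, x.2 - q%:Z + j%:Z) = ct x - q%:R * gt (gen x) + j%:R * gt (gen x).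
  rewrite /ct /gen /= intrD intrB -[(Posz j)%:~R]/(j%:R) -[(Posz q)%:~R]/(q%:R).
  by rewrite mulrDl mulrBl !addrA.
have jq' : j%:R * gt (gen x) <= q%:R * gt (gen x) by rewrite ler_pM2r// ler_nat.
have j0 : 0 <= j%:R * gt (gen x) by rewrite mulr_ge0// ltW.
move: h2; rewrite e -[gen (_, _)]/(gen x) => h2.
rewrite cr -[gen root_cell]/0%N in k2 k3; split; last by apply/andP; split; lra.
move=> l; have := k1 l; have := h1 l.
rewrite -[cx (_, _) l]/(cx x l) -[gen (_, _)]/(gen x) -[gen root_cell]/0%N.
have -> : cx (@root_cell n) l = a0 l.
  by rewrite /cx /corner /gen /= ffunE mulr0z mul0r addr0.
lra.
Qed.

Lemma alive_small f h k : loc_integrable f -> 0 <= k -> forall e, 0 < e ->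
  exists i, integ (big_union cbox (alive N gm (fun x => h <= cval f x) i))
    (lower_part f h k) <= e.
Proof.
move=> lf k0 e e0.
pose K := frame a0 s0 gl gt q : set E.
have bK : bounded_measurable K by exact: bounded_bx.
have t0 : 0 <= gt 0 + q%:R * gt 1 by rewrite addr_ge0 ?mulr_ge0// ltW.
(* Three losses are added up: the integral of [|f - g|] over the cells, over the [q] shifted
   families that make up the past boxes, and [k] times the volume of the exceptional set. *)
pose e' := e / (1 + q%:R + k).
have d0 : 0 < 1 + q%:R + k by rewrite ltr_wpDr// ltr_wpDr.
have e'0 : 0 < e' by rewrite divr_gt0.
have [r [g [Z [r0 lg mZ [fg vZ gc]]]]] :=
  loc_integrable_locally_const a0 (s0 - q%:R * gt 1) (ltW (gl_gt0 0)) t0 lf e'0.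
rewrite -/(frame a0 s0 gl gt q) -/K in fg vZ gc.
have [i1 hi1] := gl_cvg r0.
have [i2 hi2] := gt_cvg (divr_gt0 r0 (ltr0Sn R q)).
pose i := (maxn i1 i2).+1.
have hgl : gl i <= r.
  apply: le_trans hi1; have : (i1.+1 <= i)%N by rewrite ltnS leq_maxl.
  move=> ij; rewrite -(subnKC ij); elim: (i - i1.+1)%N => [|d ih]; first by rewrite addn0.
  apply: le_trans ih; rewrite addnS [leRHS]glS ler_peMl ?(ltW (gl_gt0 _))//.
  by rewrite ler1n.
have hgt : q.+1%:R * gt i <= r.
  rewrite mulrC -ler_pdivlMr ?ltr0n//; apply: le_trans hi2.
  by apply: (gt_le gm_gt0 gt_gt0 gtS); rewrite ltnS leq_maxr.
exists i; set live := fun x => _.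
(* The sum over cells needs a list without repetitions, while the union does not depend on them. *)
set s := undup (alive N gm live i).
have us : uniq s by exact: undup_uniq.
have gs x : x \in s -> gen x = i by rewrite mem_undup; exact: alive_gen.
have rs x : x \in s -> csub a0 s0 gl gt x root_cell.
  by rewrite mem_undup; exact: (alive_root a0 s0 N_gt0 gm_gt0 gl_gt0 gt_gt0 glS gtS).
have ls x : x \in s -> h <= cval f x.
  by rewrite mem_undup /i => /aliveP[].
have -> : big_union cbox (alive N gm live i) = big_union cbox s.
  by apply/seteqP; split=> w /in_union[x xs xw]; apply/in_union; exists x => //;
    move: xs; rewrite mem_undup.
have lG : loc_integrable (lower_part f h k) by exact: loc_integrable_lower.
rewrite (sum_cells lG us gs).
have lfg := loc_integrable_norm (loc_integrableB lf lg).
have lZ := loc_integrable_indic mZ.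
have frameP x : x \in s -> forall j, (j <= q)%N ->
    cbox (x.1, x.2 - q%:Z + j%:Z) `<=` K.
  by move=> xs; apply: delay_frame; [rewrite gs|exact: rs].
have frameP' x : x \in s -> cbox x `<=` K.
  by move=> xs; have := frameP x xs q (leqnn q); rewrite subrK; case: (x).
have pastP x : x \in s -> past_box x `<=` K.
  move=> xs w [h1 /andP[h2 h3]].
  have [||j /andP[h4 h5]] := @cell_ex R (ct x - q%:R * gt (gen x)) (gt (gen x)) (bs_T w) q.
  - exact: gt_gt0.
  - by rewrite h2 h3.
  apply: (frameP x xs j (ltnW (ltn_ord j))); split => //.
  have -> : ct (x.1, x.2 - q%:Z + (j : nat)%:Z) =
      ct x - q%:R * gt (gen x) + j%:R * gt (gen x).
    rewrite /ct /gen /= intrD intrB -[(Posz j)%:~R]/(j%:R) -[(Posz q)%:~R]/(q%:R).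
    by rewrite mulrDl mulrBl !addrA.
  by rewrite h4 h5.
pose fgn := fun z => `|f z - g z|.
have cell_le x : x \in s -> integ (cbox x) (lower_part f h k) <=
    integ (cbox x) fgn + integ (past_box x) fgn +
    k * integ (cbox x) (\1_Z : E -> R).
  move=> xs; have bcx := @cbox_bounded R n S a0 s0 gl gt x.
  have fgn0 A : 0 <= integ A fgn by apply: integ_ge0 => z _; exact: normr_ge0.
  have i10 : 0 <= integ (cbox x) (\1_Z : E -> R).
    by apply: integ_ge0 => z _; rewrite indicE.
  (* A cell inside the exceptional set is estimated by [k] times its volume. Any other one has a
     point [z0] off this set, and [g] equals [g z0] on the whole cell and on its reference box. *)
  have [xZ|] := pselect (cbox x `<=` Z).
    apply: le_trans (_ : k * integ (cbox x) (\1_Z : E -> R) <= _); last first.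
      by rewrite lerDr addr_ge0.
    rewrite -integZ//; apply: integ_le => //; first exact: loc_integrableZ.
    by move=> z xz; rewrite indicE mem_set ?mulr1 ?ge_min ?lexx ?orbT//; exact: xZ.
  move=> /existsNP[z0 /not_implyP[xz0 Zz0]].
  apply: le_trans (_ : integ (cbox x) fgn + integ (past_box x) fgn <= _); last first.
    by rewrite lerDl mulr_ge0.
  apply: (alive_cell_le _ lf lg (ls x xs) (c := g z0)).
  - move=> z xz; apply/esym; apply: gc => //; first exact: (frameP' x xs).
    move: xz xz0 => [hz1 hz2] [hz3 hz4].
    have gq : gt (gen x) <= q.+1%:R * gt i.
      by rewrite gs// ler_peMl ?(ltW (gt_gt0 _))// ler1n.
    split=> [l|]; rewrite ler_norml; last by apply/andP; split; lra.
    by have := hz1 l; have := hz3 l; rewrite gs// in hz1 hz3 *; move=> *; apply/andP; split; lra.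
  - move=> z /reference_past [hz1 hz2]; apply/esym; apply: gc => //.
      exact: (frameP' x xs).
    move: xz0 => [hz3 hz4].
    have gq : gt (gen x) + q%:R * gt (gen x) <= r.
      by apply: le_trans hgt; rewrite gs// -[q.+1%:R]natr1 mulrDl mul1r addrC.
    split=> [l|]; rewrite ler_norml; last by apply/andP; split; lra.
    by have := hz1 l; have := hz3 l; rewrite gs//; move=> *; apply/andP; split; lra.
rewrite (le_trans (_ : _ <= \sum_(x <- s) (integ (cbox x) fgn +
    integ (past_box x) fgn + k * integ (cbox x) (\1_Z : E -> R))))//.
  by rewrite big_seq [leRHS]big_seq; apply: ler_sum.
rewrite !big_split /= -mulr_sumr.
have B1 : \sum_(x <- s) integ (cbox x) fgn <= e'.
  by apply: le_trans fg; apply: (sum_cells_le (i := i)) => // z; exact: normr_ge0.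
have B3 : \sum_(x <- s) integ (cbox x) (\1_Z : E -> R) <= e'.
  apply: le_trans vZ; rewrite -integ_indic//.
  by apply: (sum_cells_le (i := i)) => // z; rewrite indicE.
have B2 : \sum_(x <- s) integ (past_box x) fgn <= q%:R * e'.
  rewrite (eq_bigr _ (fun x _ => integ_past_box x lfg)) exchange_big /=.
  apply: le_trans (_ : \sum_(j < q) e' <= _); last first.
    by rewrite sumr_const card_ord mulr_natl.
  apply: ler_sum => j _; pose sh (x : @cell n) : @cell n := (x.1, x.2 - q%:Z + (j : nat)%:Z).
  apply: le_trans fg; rewrite -(big_map sh xpredT (fun x => integ (cbox x) fgn)).
  apply: (sum_cells_le (i := i)) => //.
  - by move=> z; exact: normr_ge0.
  - rewrite map_inj_uniq// => x y; case: x => [x1 x2]; case: y => [y1 y2] [-> /eqP].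
    by rewrite (inj_eq (addIr _)) (inj_eq (addIr _)) => /eqP ->.
  - by move=> _ /mapP[x xs ->]; rewrite -(gs x xs).
  - by move=> _ /mapP[x xs ->]; apply: frameP => //; exact: ltnW.
apply: le_trans (_ : e' + q%:R * e' + k * e' <= _).
  by rewrite !lerD// ler_wpM2l.
by rewrite -{1}[e']mul1r -!mulrDl /e' mulrC divfK// gt_eqF.
Qed.

End alive_cells.

(** * Parabolic grids with integer subdivisions in time *)

Section time_steps.
Context {R : realType}.

(** The witness is kept as data because the durations of a grid are defined by recursion from such
    choices. *)
Lemma ex_time_step (x y : R) (M : nat) : 0 < y -> (0 < M)%N -> M%:R * y <= x ->
  {m : nat | (M <= m)%N & y <= x / m%:R <= 2 * y}.
Proof.
move=> y0 M0 h; have x0 : 0 <= x by apply: le_trans h; rewrite mulr_ge0// ltW.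
have /andP[] := truncn_itv (divr_ge0 x0 (ltW y0)).
move: (Num.truncn _) => m; rewrite ler_pdivlMr// ltr_pdivrMr// => h1 h2.
have Mm : (M <= m)%N.
  by rewrite -ltnS -(ltr_nat R) -(ltr_pM2r y0); exact: le_lt_trans h2.
exists m => //; have m1 : (0 < m)%N by exact: leq_trans Mm.
have m0 : 0 < m%:R :> R by rewrite ltr0n.
rewrite ler_pdivlMr// ler_pdivrMr// mulrC h1/=.
apply: le_trans (ltW h2) _; rewrite mulrAC ler_pM2r// -natrM ler_nat mul2n -addnn -addn1.
by rewrite leq_add2l.
Qed.

Lemma halving_small (x : nat -> R) : (forall i, 0 < x i) ->
  (forall i, 2 * x i.+1 <= x i) -> forall r, 0 < r -> exists i, x i.+1 <= r.
Proof.
move=> x0 hx r r0; have [k hk] := ex_expr_ge (x 0%N / r) (@ltr01 R).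
have hxk i : 2 ^+ i * x i <= x 0%N.
  elim: i => [|i ih]; first by rewrite expr0 mul1r.
  by apply: le_trans ih; rewrite exprSr -mulrA ler_pM2l ?exprn_gt0.
exists k; have := hxk k.+1; have -> : 2 ^+ k.+1 = (1 + 1) ^+ k * 2 :> R.
  by rewrite exprSr.
rewrite ler_pdivrMr// in hk => h.
have K0 : 0 < (1 + 1) ^+ k :> R by rewrite exprn_gt0// addr_gt0.
rewrite -(ler_pM2l K0); apply: le_trans hk; apply: le_trans h.
by rewrite -mulrA ler_pM2l// ler_peMl ?ler1n ?ltW.
Qed.

End time_steps.

Section grids.
Context {R : realType}.
Variables (p gamma : R).
Hypotheses (p_gt1 : 1 < p) (gamma_gt0 : 0 < gamma) (gamma_lt1 : gamma < 1).
Local Notation om := (om p).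
Local Notation rho := (rho p gamma).

(** [om N] need not be an integer, so that subdividing a half exactly is impossible in general; a
    factor 2 of freedom is enough to continue at every generation. *)
Definition admissible (l t : R) : Prop := rho l / 2 <= t <= rho l.

Record parabolic_grid (N M : nat) (gl gt : nat -> R) (gm : nat -> nat) : Prop :=
  ParabolicGrid {
  grid_l_gt0 : forall i, 0 < gl i;
  grid_lS : forall i, gl i = N%:R * gl i.+1;
  grid_tS : forall i, gt i = (gm i)%:R * gt i.+1;
  grid_m : forall i, (M <= gm i)%N;
  grid_admissible : forall i, admissible (gl i) (gt i) }.

Lemma ex_grid (N M : nat) (l t : R) : (0 < N)%N -> (0 < M)%N -> M%:R <= om N%:R ->
  0 < l -> admissible l t -> exists gl gt gm,
    [/\ gl 0%N = l, gt 0%N = t & parabolic_grid N M gl gt gm].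
Proof.
have gg0 := gamma_gt0; have gg1 := gamma_lt1.
move=> N0 M0 MN l0 lt; have N0' : 0 < N%:R :> R by rewrite ltr0n.
pose gl i := l / N%:R ^+ i.
have gl0 i : 0 < gl i by rewrite divr_gt0// exprn_gt0.
have glS i : gl i = N%:R * gl i.+1.
  by rewrite /gl exprS invfM mulrCA mulVKf// gt_eqF.
have r0 i : 0 < rho (gl i) / 2 by rewrite divr_gt0// rho_gt0.
have step i (s : R) : admissible (gl i) s ->
    {m : nat | (M <= m)%N & admissible (gl i.+1) (s / m%:R)}.
  move=> /andP[h1 h2]; have [|m Mm] := @ex_time_step _ s (rho (gl i.+1) / 2) M (r0 _) M0.
    apply: le_trans h1; rewrite mulrA ler_pM2r ?invr_gt0// /rho [in leRHS]glS omM ?(ltW N0') ?(ltW (gl0 _))//.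
    rewrite mulrCA ler_pM2l ?subr_gt0// ler_pM2r//; exact: om_gt0.
  by rewrite [2 * _]mulrC divfK// => h; exists m.
have start : admissible (gl 0%N) t by rewrite /gl expr0 divr1.
pose next i (x : {s : R | admissible (gl i) s}) : {s | admissible (gl i.+1) s} :=
  let: exist2 m _ h := step i _ (projT2 x) in exist _ _ h.
pose fix F i : {s : R | admissible (gl i) s} :=
  if i is j.+1 then next j (F j) else exist _ t start.
pose gm i := s2val (step i _ (projT2 (F i))).
exists gl, (fun i => sval (F i)), gm; split => //.
  by rewrite /gl expr0 divr1.
split=> // i.
- rewrite /= /gm /next; case: (step _ _ _) => /= m Mm _.
  by rewrite mulrC divfK// pnatr_eq0 -lt0n (leq_trans M0).
- by rewrite /gm; case: (step _ _ _).
- exact: (projT2 (F i)).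
Qed.

Variables (N M : nat) (gl gt : nat -> R) (gm : nat -> nat).
Hypothesis G : parabolic_grid N M gl gt gm.

Lemma grid_t_gt0 i : 0 < gt i.
Proof.
have /andP[h _] := grid_admissible G i; apply: lt_le_trans h.
by rewrite divr_gt0// rho_gt0// (grid_l_gt0 G).
Qed.

Lemma grid_rho i : gt i <= rho (gl i).
Proof. by have /andP[] := grid_admissible G i. Qed.

Lemma rho_grid i : rho (gl i) <= 2 * gt i.
Proof. by have /andP[] := grid_admissible G i; rewrite ler_pdivrMr// mulrC. Qed.

Lemma grid_l_cvg : (1 < N)%N -> forall r, 0 < r -> exists i, gl i.+1 <= r.
Proof.
move=> N1; apply: halving_small; first exact: grid_l_gt0 G.
by move=> i; rewrite (grid_lS G i) ler_pM2r ?ler_nat// (grid_l_gt0 G).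
Qed.

Lemma grid_t_cvg : (1 < M)%N -> forall r, 0 < r -> exists i, gt i.+1 <= r.
Proof.
move=> M1; apply: halving_small; first exact: grid_t_gt0.
move=> i; rewrite (grid_tS G i) ler_pM2r ?ler_nat; last exact: grid_t_gt0.
exact: leq_trans (grid_m G i).
Qed.

End grids.

Section parent_means.
Context {R : realType} {n : nat} {S : box_space R n}.
Variables (p gamma : R).
Hypotheses (p_gt1 : 1 < p) (gamma_gt0 : 0 < gamma) (gamma_lt1 : gamma < 1).
Local Notation E := (bs_type S).
Local Notation om := (om p).
Local Notation lag := (lag p gamma).
Local Notation rho := (rho p gamma).
Local Notation ebox := (@ebox R n S p gamma).
Local Notation emean := (@emean R n S p gamma).
Local Notation bmo1 := (@bmo1 R n S p gamma).

(* The constant [T0] of the Harnack inequality is a parameter, so that [N] can be chosen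
   before the constant [C]. *)
Lemma coarse_le_fine (T0 : R) (N q : nat) :
  (forall (N : nat) (T : R), (0 < N)%N ->
    exists2 C, 0 <= C & forall f a k l v u, bmo1 f -> 0 < l ->
    (forall i, `|k i| <= N%:Z) -> N%:R * T0 * om l <= u - v <= T * om l ->
    emean f a l v <= emean f (corner a k l) l u + C) ->
  (0 < N)%N -> N%:R * T0 + 2 <= om N%:R -> 8 <= q%:R * (1 - gamma) ->
  exists2 C, 0 <= C & forall f b l (k : {ffun 'I_n -> 'I_N}) t v u,
    bmo1 f -> 0 < l -> admissible p gamma (N%:R * l) t ->
    v - om (N%:R * l) <= u <= v + om (N%:R * l) ->
    emean f b (N%:R * l) (v - q%:R * t + lag (N%:R * l)) <=
    emean f (corner b (fun i => k i) l) l u + C.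
Proof.
have gg0 := gamma_gt0; have gg1 := gamma_lt1.
move=> harnack N0 hN hq.
have [C1 C10 hC1] := harnack N ((1 + q%:R) * om N%:R) N0.
exists (C1 + 2); first by rewrite addr_ge0.
move=> f b l k t v u bf l0 /andP[ht1 ht2] /andP[hu1 hu2].
have lf : loc_integrable f by case: bf.
have N0' : 0 < N%:R :> R by rewrite ltr0n.
have Nl0 : 0 < N%:R * l by rewrite mulr_gt0.
have ol := om_gt0 p l0; have oNl := om_gt0 p Nl0.
have eo : om (N%:R * l) = om N%:R * om l by rewrite omM// ltW.
rewrite addrA; apply: emean_le_ep => //.
rewrite vol_ebox// exprMn -mulrA mulrCA.
have r0 := rho_gt0 p gamma_lt1 Nl0; have rl0 := rho_gt0 p gamma_lt1 l0.
(* From [t >= rho / 2] and [q * (1 - gamma) >= 8]. The reference box thus ends at least [2 * om]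
   before [v], which leaves room for the Harnack chain even if [u] comes one [om] before [v]. *)
have qt1 : 4 * om (N%:R * l) <= q%:R * t.
  apply: le_trans (_ : q%:R * (rho (N%:R * l) / 2) <= _); last by rewrite ler_wpM2l.
  by rewrite mulrA mulrA ler_pdivlMr// mulrAC ler_pM2r//; lra.
have qt2 : q%:R * t <= q%:R * om (N%:R * l).
  rewrite ler_wpM2l//; apply: le_trans ht2 _; rewrite /rho ler_piMl//; first exact: ltW.
  by rewrite gerBl ltW.
have lrN : lag (N%:R * l) + rho (N%:R * l) = 2 * om (N%:R * l).
  by rewrite /lag /rho; ring.
have lr : lag l + rho l = 2 * om l by rewrite /lag /rho; ring.
have lag0 : 0 < lag l by rewrite mulr_gt0//; lra.
have lagN0 : 0 < lag (N%:R * l) by rewrite mulr_gt0//; lra.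
have hNl : N%:R * T0 * om l + 2 * om l <= om (N%:R * l).
  by rewrite eo -mulrDl ler_pM2r.
set c := _ + C1.
rewrite -mulrCA; apply: le_trans (_ : _ <= N%:R ^+ n *
    (l ^+ n * (rho (N%:R * l) + rho l))) _; last first.
  rewrite [leRHS]mulrCA ler_pM2l ?exprn_gt0// [leRHS]mulrCA ler_pM2l ?exprn_gt0//.
  have : rho l <= rho (N%:R * l).
    rewrite /rho ler_pM2l ?subr_gt0// om_le ?(ltW l0)//.
    by rewrite ler_peMl ?(ltW l0)// ler1n.
  by lra.
apply: integ_tile_le => //; first exact: loc_ep.
move=> k'; set w := v - q%:R * t + lag (N%:R * l).
apply: (@ep_column _ _ _ _ _ gamma_lt1 f c _ l (w + lag l)
    (w + rho (N%:R * l) + lag l)) => //; last exact: ltW.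
move=> v' /andP[hv1 hv2].
have := hC1 f (corner b (fun i => k' i) l) (fun i => (k i : nat)%:Z - (k' i : nat)%:Z) l v' u bf l0.
rewrite corner_corner.
have -> : (fun i => (k' i : nat)%:Z + ((k i : nat)%:Z - (k' i : nat)%:Z)) =
    (fun i => (k i : nat)%:Z) by apply/funext => i; rewrite addrC subrK.
apply.
  by move=> i; apply: int_dist_range; exact: ord_range.
rewrite -/w in hv1 hv2; rewrite -[(_ + _) * _ * _]mulrA -eo mulrDl mul1r.
rewrite /w in hv1 hv2; move: (q%:R * t) (q%:R * om _) (N%:R * T0 * _) qt1 qt2 hNl hv1 hv2.
move=> x y z *; apply/andP; split; lra.
Qed.

End parent_means.

Lemma ge0_integral_le_trunc d (T : measurableType d) (R : realType)
    (mu : {measure set T -> \bar R}) (A : set T) (g : T -> R) (b : \bar R) :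
  measurable A -> measurable_fun A g -> (forall z, A z -> 0 <= g z) ->
  (forall k : nat, (\int[mu]_(z in A) (Num.min (g z) k%:R)%:E <= b)%E) ->
  (\int[mu]_(z in A) (g z)%:E <= b)%E.
Proof.
move=> mA mg g0 hb; pose G (k : nat) z := (Num.min (g z) k%:R)%:E.
have -> : (\int[mu]_(z in A) (g z)%:E)%E =
    (\int[mu]_(z in A) limn (G ^~ z))%E.
  apply: eq_integral => z _; apply/esym/cvg_lim => //; apply: cvg_near_cst.
  have [m hm] := ex_nat_ge (g z); exists m => // k /= mk.
  by rewrite /G min_l// (le_trans hm)// ler_nat.
rewrite monotone_convergence//.
- apply: lime_le; last by apply: nearW => k; exact: hb.
  apply: ereal_nondecreasing_is_cvgn => i j ij; apply: ge0_le_integral => //.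
  + by move=> z Az; rewrite lee_fin le_min g0/=.
  + by apply/measurable_EFinP; exact: measurable_minr.
  + by apply/measurable_EFinP; exact: measurable_minr.
  + move=> z _; rewrite lee_fin le_min ge_min lexx/= ge_min; apply/orP; right.
    by rewrite ler_nat.
- by move=> k; apply/measurable_EFinP; exact: measurable_minr.
- by move=> k z Az; rewrite lee_fin le_min g0/=.
- move=> z _ i j ij; rewrite lee_fin le_min ge_min lexx/= ge_min; apply/orP; right.
  by rewrite ler_nat.
Qed.

Lemma integral_integ (R : realType) (n : nat) (S : box_space R n)
    (A : set (bs_type S)) (g : bs_type S -> R) : bounded_measurable A ->
  loc_integrable g -> (\int[bs_mu S]_(z in A) (g z)%:E)%E = (integ A g)%:E.
Proof.
move=> bA lg; rewrite /integ /Rintegral fineK//.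
by apply: integrable_fin_num; [case: bA|exact: loc_integrable_on].
Qed.

Lemma integ_le_trunc (R : realType) (n : nat) (S : box_space R n)
    (A : set (bs_type S)) (g : bs_type S -> R) (b : R) : bounded_measurable A ->
  loc_integrable g -> (forall z, 0 <= g z) ->
  (forall k : nat, integ A (fun z => Num.min (g z) k%:R) <= b) -> integ A g <= b.
Proof.
move=> bA lg g0 hb; rewrite -lee_fin -integral_integ//.
apply: ge0_integral_le_trunc => //; first by case: bA.
  by apply: measurable_funTS; case: lg.
move=> k; rewrite integral_integ// ?lee_fin//.
by apply: loc_integrable_min => //; exact: loc_integrable_cst.
Qed.

(** The crude bound [k] only makes the supremum a real number; the bound obtained by solving the
    inequality is independent of it. *)
Lemma sup_contraction (R : realType) (A : set R) (k D t : R) : 0 <= t < 1 -> 0 <= D ->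
  (forall y, A y -> y <= k) ->
  (forall Y, 0 <= Y -> (forall y, A y -> y <= Y) -> forall y, A y -> y <= D + t * Y) ->
  forall y, A y -> y <= D / (1 - t).
Proof.
move=> /andP[t0 t1] D0 hk h y Ay.
have sA : has_sup A by split; [exists y|exists k => z; exact: hk].
have hs z : A z -> z <= Num.max (sup A) 0.
  by move=> Az; rewrite le_max; apply/orP; left; exact: sup_ubound (proj2 sA) _ Az.
have M0 : 0 <= Num.max (sup A) 0 by rewrite le_max lexx orbT.
apply: le_trans (hs y Ay) _; rewrite ler_pdivlMr ?subr_gt0//.
have [s0|s0] := leP (sup A) 0; first by rewrite mul0r.
have : sup A <= D + t * sup A.
  apply: ge_sup; first by case: sA.
  by move=> z Az; have := h _ M0 hs z Az; rewrite max_l// ltW.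
by move=> ?; rewrite mulrBr mulr1 mulrC; lra.
Qed.

Lemma child_window (R : realFieldType) (cy cx gx gy o oy qg d : R) :
  cy <= cx -> cx + gx <= cy + gy -> 4 * o <= qg -> 2 * qg <= oy -> 0 < o ->
  gy <= oy -> 0 <= d <= 2 * o -> 0 < gx -> cy - oy <= cx - qg + d <= cy + oy.
Proof. by move=> *; apply/andP; split; lra. Qed.

Lemma lower_part_shift (R : realType) (n : nat) (S : box_space R n)
    (f : bs_type S -> R) (h h' k d : R) z : 0 <= d -> h <= h' + d ->
  lower_part f h k z <= lower_part f h' k z + d.
Proof.
move=> d0 hd; rewrite /lower_part addr_minl le_min !ge_min lerDl d0 orbT andbT.
apply/orP; left; rewrite ge_max addr_maxl !le_max add0r d0 orbT andbT.
by apply/orP; left; lra.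
Qed.

Lemma loc_deficit (R : realType) (n : nat) (S : box_space R n)
    (f : bs_type S -> R) (c : R) :
  loc_integrable f -> loc_integrable (fun z => Num.max (c - f z) 0).
Proof.
move=> lf; apply: loc_integrable_max; last exact: loc_integrable_cst.
by apply: loc_integrableB => //; exact: loc_integrable_cst.
Qed.

(** * The stopping argument *)

Section stopping.
Context {R : realType} {n : nat} {S : box_space R n}.
Variables (p gamma : R).
Hypotheses (p_gt1 : 1 < p) (gamma_gt0 : 0 < gamma) (gamma_lt1 : gamma < 1).
Local Notation E := (bs_type S).
Local Notation om := (om p).
Local Notation lag := (lag p gamma).
Local Notation rho := (rho p gamma).
Local Notation ebox := (@ebox R n S p gamma).
Local Notation emean := (@emean R n S p gamma).
Local Notation bmo1 := (@bmo1 R n S p gamma).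
Variables (N M q : nat) (C : R).
Hypotheses (N_gt1 : (1 < N)%N) (M_large : (4 * q * q.+1 <= M)%N).
Hypothesis q_large : 8 <= q%:R * (1 - gamma).
Hypothesis N_large : 2 * q%:R <= om N%:R.
Hypothesis C_ge0 : 0 <= C.
Hypothesis coarse : forall (f : E -> R) b l (k : {ffun 'I_n -> 'I_N}) t v u,
  bmo1 f -> 0 < l -> admissible p gamma (N%:R * l) t ->
  v - om (N%:R * l) <= u <= v + om (N%:R * l) ->
  emean f b (N%:R * l) (v - q%:R * t + lag (N%:R * l)) <=
  emean f (corner b (fun i => k i) l) l u + C.

Lemma q_gt0 : (0 < q)%N.
Proof.
rewrite lt0n; apply/negP => /eqP q0; move: q_large; rewrite q0 mul0r.
by rewrite real_leNgt ?ltr0n.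
Qed.

Lemma M_gt1 : (1 < M)%N.
Proof.
apply: leq_trans M_large; have := q_gt0; by case: (q).
Qed.

Section one_grid.
Variables (a0 : 'I_n -> R) (s0 : R) (gl gt : nat -> R) (gm : nat -> nat).
Hypothesis G : parabolic_grid p gamma N M gl gt gm.
Variable f : E -> R.
Hypothesis bf : bmo1 f.
Local Notation cx := (cx a0 gl).
Local Notation ct := (ct s0 gt).
Local Notation cbox := (@cbox R n S a0 s0 gl gt).
Local Notation cval := (cval p gamma a0 s0 gl gt q f).
Implicit Types (x y : @cell n).

Let N_gt0 : (0 < N)%N. Proof. exact: ltnW. Qed.
Let gm_gt0 i : (0 < gm i)%N.
Proof. exact: leq_trans (ltnW M_gt1) (grid_m G i). Qed.
Let gl_gt0 := grid_l_gt0 G.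
Let gt_gt0 := grid_t_gt0 gamma_lt1 G.
Let glS := grid_lS G.
Let gtS := grid_tS G.
Let gm_large i : (4 * q * q.+1 <= gm i)%N.
Proof. exact: leq_trans M_large (grid_m G i). Qed.

Lemma grid_q_om i : 4 * om (gl i) <= q%:R * gt i.
Proof.
have q0 : 0 < q%:R :> R by rewrite ltr0n q_gt0.
have hq := q_large.
apply: le_trans (_ : q%:R * (rho (gl i) / 2) <= _); last first.
  by rewrite ler_pM2l//; have /andP[] := grid_admissible G i.
by rewrite /rho !mulrA ler_pdivlMr// mulrAC ler_pM2r ?om_gt0//; lra.
Qed.

Lemma om_grid_q i : 2 * (q%:R * gt i.+1) <= om (gl i).
Proof.
rewrite glS omM; [|exact: ler0n|exact: ltW].
rewrite mulrA; apply: le_trans (_ : 2 * q%:R * om (gl i.+1) <= _).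
  rewrite ler_wpM2l ?mulr_ge0//; apply: le_trans (grid_rho G i.+1) _.
  by rewrite /rho ler_piMl ?(ltW (om_gt0 _ _))// gerBl ltW.
by rewrite ler_pM2r// om_gt0.
Qed.

Lemma parent_le_child y x u : x \in children N gm y ->
  ct y - om (gl (gen y)) <= u <= ct y + om (gl (gen y)) ->
  cval y <= emean f (cx x) (gl (gen x)) u + C.
Proof.
move=> /allpairsP[[k r] /= [_ _ ->]] hu.
have -> : cx ((gen y).+1, [ffun l => N%:Z * y.1.2 l + (k l : nat)%:Z],
    (gm (gen y))%:Z * y.2 + r%:Z) = corner (cx y) (fun i => k i) (gl (gen y).+1).
  apply/funext => l; rewrite /cx /corner /gen /= ffunE (glS y.1.1) intrD intrM.
  by rewrite mulrDl -!addrA mulrCA mulrA.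
rewrite /cval glS -[gen (_, _, _)]/(gen y).+1.
apply: coarse => //; rewrite -?glS//; exact: grid_admissible G _.
Qed.

Lemma child_time y x : x \in children N gm y ->
  [/\ gen x = (gen y).+1, ct y <= ct x & ct x + gt (gen x) <= ct y + gt (gen y)].
Proof.
move=> hx; have [gx px] := childP N_gt0 gm_gt0 hx.
have [_ h1 h2] := csub_par a0 s0 N_gt0 gm_gt0 gl_gt0 gt_gt0 glS gtS x.
by rewrite px in h1 h2.
Qed.

Lemma parent_le_cval y x : x \in children N gm y -> cval y <= cval x + C.
Proof.
have gg0 := gamma_gt0; have gg1 := gamma_lt1.
move=> hx; have [gx h1 h2] := child_time hx; apply: parent_le_child hx _.
have := om_grid_q (gen y); have := grid_q_om (gen x); rewrite -gx => h3 h4.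
have ox := om_gt0 p (gl_gt0 (gen x)).
have gy : gt (gen y) <= om (gl (gen y)).
  apply: le_trans (grid_rho G _) _.
  by rewrite /rho ler_piMl ?(ltW (om_gt0 _ _))// gerBl ltW.
have l0 : 0 <= lag (gl (gen x)) <= 2 * om (gl (gen x)).
  rewrite mulr_ge0 ?addr_ge0 ?(ltW ox) ?(ltW gg0)//= /lag ler_pM2r//; lra.
exact: child_window h1 h2 h3 h4 ox gy l0 (gt_gt0 (gen x)).
Qed.

Lemma parent_le_delayed y x : x \in children N gm y ->
  cval y <= emean f (cx x) (gl (gen x)) (ct x - q%:R * gt (gen x)) + C.
Proof.
move=> hx; have [gx h1 h2] := child_time hx; apply: parent_le_child hx _.
have := om_grid_q (gen y); have := grid_q_om (gen x); rewrite -gx => h3 h4.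
have ox := om_gt0 p (gl_gt0 (gen x)).
have gy : gt (gen y) <= om (gl (gen y)).
  apply: le_trans (grid_rho G _) _.
  by rewrite /rho ler_piMl ?(ltW (om_gt0 _ _))// gerBl ltW.
rewrite -[ct x - _]addr0; apply: (child_window h1 h2 h3 h4 ox gy) => //.
by rewrite lexx mulr_ge0// ltW.
Qed.

Definition above h : pred (@cell n) := fun x => h <= cval x.

(** The parent is alive, hence has a reference mean at least [h]. The passage to the child costs
    [C], both for its reference mean and for the mean over the early half that contains its delayed
    copy. *)
Lemma stopped_cell h I x : h <= cval (@root_cell n) -> x \in stops N gm (above h) I ->
  [/\ (0 < gen x)%N, cval x < h, h <= cval x + C &
   h <= emean f (cx x) (gl (gen x)) (ct x - q%:R * gt (gen x)) + C].
Proof.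
move=> hr /stopsP[i _ /(stopP N_gt0 gm_gt0)[gx lx px hx]].
have hp : h <= cval (parent N gm x).
  case: i px {gx} => [|i]; first by rewrite inE => /eqP ->.
  by move=> /(aliveP N_gt0 gm_gt0)[].
split; first by rewrite gx.
- by rewrite ltNge.
- by apply: le_trans hp _; exact: parent_le_cval.
- by apply: le_trans hp _; exact: parent_le_delayed.
Qed.

Let lf : loc_integrable f. Proof. by case: bf. Qed.

Lemma lower_part_ge0 h k z : 0 <= k -> 0 <= lower_part f h k z.
Proof. by move=> k0; rewrite le_min le_max lexx orbT k0. Qed.

(** [(h - f)_+ = (f - h)_+ + (h - f)]. The low reference mean of the stopped cell bounds the
    integral of the first term, the high mean of its parent that of the second; the factor 2 is the
    volume ratio of half and cell. *)
Lemma lower_delayed h k x : 0 <= k -> cval x < h ->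
  h <= emean f (cx x) (gl (gen x)) (ct x - q%:R * gt (gen x)) + C ->
  integ (cbox (delay q x)) (lower_part f h k) <=
  2 * (1 + C) * vol (cbox (delay q x)).
Proof.
have gg0 := gamma_gt0; have gg1 := gamma_lt1.
move=> k0 h1 h2; have gx := gl_gt0 (gen x).
set s := ct x - _ in h2 *; set A := ebox (cx x) (gl (gen x)) s.
have bA : bounded_measurable A by exact: bounded_ebox.
have vA : vol A <= 2 * vol (cbox (delay q x)).
  rewrite /A vol_ebox// (vol_cbox a0 s0 gl_gt0 gt_gt0) [leRHS]mulrCA ler_pM2l ?exprn_gt0//.
  exact: rho_grid G _.
have lG : loc_integrable (lower_part f h k) by exact: loc_integrable_lower.
have lc (c : R) : loc_integrable (fun=> c : R) by exact: loc_integrable_cst.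
apply: le_trans (_ : (1 + C) * vol A <= _); last first.
  by rewrite [2 * _]mulrC -mulrA ler_wpM2l// addr_ge0.
apply: le_trans (_ : integ A (lower_part f h k) <= _).
  apply: integ_subset => //; first exact: measurable_bx.
    by move=> z _; exact: lower_part_ge0.
  move=> w [h3]; rewrite ct_delay -[gen (delay q x)]/(gen x) -/s => /andP[h4 h5].
  split=> //; rewrite h4/=; apply: lt_le_trans h5 _; rewrite lerD2l.
  exact: grid_rho G _.
apply: le_trans (_ : integ A (fun z => Num.max (f z - h) 0 + (h - f z)) <= _).
  apply: integ_le => //.
    by apply: loc_integrableD; [exact: loc_ep|exact: loc_integrableB].
  move=> z _; rewrite ge_min; apply/orP; left.
  by case: (leP (h - f z) 0) => ?; case: (leP (f z - h) 0) => ?; lra.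
rewrite integD//; [|exact: loc_ep|exact: loc_integrableB].
rewrite integB// integ_cst// mulrDl mul1r lerD//.
  apply: ep_ebox => //; first exact: measurable_bx.
  exact: ltW.
rewrite integ_ebox// -mulrBl ler_wpM2r ?vol_ge0//; lra.
Qed.

(** In [5 + 5 * C], the alive cells account for 1, the delayed copies, whose union is at most twice
    the root, for [4 * (1 + C)], and the change of level on fresh cells for the last [C]. *)
Lemma lower_contraction k Y : 0 <= k -> 0 <= Y ->
  (forall x, integ (cbox x) (lower_part f (cval x) k) <= Y * vol (cbox x)) ->
  integ (cbox (@root_cell n)) (lower_part f (cval (@root_cell n)) k) <=
  (5 + 5 * C + (1 - q.+1%:R^-1 / 4) * Y) * vol (cbox (@root_cell n)).
Proof.
move=> k0 Y0 hY; set c := cval _; set V := vol _.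
have V0 : 0 < V by rewrite /V (vol_cbox a0 s0 gl_gt0 gt_gt0) mulr_gt0 ?exprn_gt0.
have lG : loc_integrable (lower_part f c k) by exact: loc_integrable_lower.
have G0 z : 0 <= lower_part f c k z by exact: lower_part_ge0.
have lc (d : R) : loc_integrable (fun=> d : R) by exact: loc_integrable_cst.
have bc x := @cbox_bounded R n S a0 s0 gl gt x.
have bU s := bounded_union s bc.
have [I hI] : exists I, integ (big_union cbox (alive N gm (above c) I))
    (lower_part f c k) <= V.
  apply: (alive_small gamma_gt0 gamma_lt1 a0 s0 N_gt0 gm_gt0 gl_gt0 gt_gt0 glS gtS
    grid_q_om (grid_rho G) (grid_l_cvg G N_gt1)
    (grid_t_cvg gamma_lt1 G M_gt1) c lf k0 V0).
have b0 : 0 < q.+1%:R^-1 :> R by rewrite invr_gt0.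
have b1 : q.+1%:R^-1 <= 1 :> R by rewrite invf_le1 ?ltr0n// ler1n.
set b := q.+1%:R^-1 in b0 b1 *.
have bD := @bounded_delayed R n S a0 s0 N gl gt gm (above c) q I.
have pS := pairwise_stops N_gt0 gm_gt0 (above c) I.
have subs := @csub_subset R n S a0 s0 gl gt.
have dl : integ (delayed a0 s0 N gl gt gm (above c) q I) (lower_part f c k) <=
    4 * (1 + C) * V.
  apply: le_trans (_ : 2 * (1 + C) *
    vol (delayed a0 s0 N gl gt gm (above c) q I) <= _); last first.
    rewrite (_ : 4 * (1 + C) = 2 * (1 + C) * 2); last by ring.
    rewrite -[leRHS]mulrA ler_wpM2l ?mulr_ge0 ?addr_ge0//.
    apply: le_trans (@vol_delayed R n S a0 s0 _ _ _ _
      N_gt0 gm_gt0 gl_gt0 gt_gt0 glS gtS _ _ gm_large _) _.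
    by rewrite -/V ler_pM2r// -/b; lra.
  rewrite -integ_cst//; apply: (nested_integ_le bc (@subs)) => //.
    apply: (nested_gen a0 s0 N_gt0 gm_gt0 gl_gt0 gt_gt0 glS gtS).
    exact: pairwise_gen_map.
  move=> _ /mapP[x /(stopped_cell (lexx c))[gx h1 h2 h3] ->].
  by rewrite integ_cst//; exact: lower_delayed.
have fr : integ (big_union cbox (fresh a0 s0 N gl gt gm (above c) q I))
    (lower_part f c k) <= (Y + C) * ((1 - b / 4) * V).
  apply: le_trans (_ : (Y + C) *
    vol (big_union cbox (fresh a0 s0 N gl gt gm (above c) q I)) <= _); last first.
    rewrite ler_wpM2l ?addr_ge0//.
    exact: (vol_fresh a0 s0 N_gt0 gm_gt0 gl_gt0 gt_gt0 glS gtS _ gm_large).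
  rewrite -integ_cst//; apply: (nested_integ_le bc (@subs)) => //.
    apply: (nested_gen a0 s0 N_gt0 gm_gt0 gl_gt0 gt_gt0 glS gtS).
    exact: pairwise_filter.
  move=> x /fresh_sub /(stopped_cell (lexx c))[gx h1 h2 h3].
  have lx : loc_integrable (lower_part f (cval x) k) by exact: loc_integrable_lower.
  apply: le_trans (_ : integ (cbox x) (fun z => lower_part f (cval x) k z + C) <= _).
    apply: integ_le => //; first exact: loc_integrableD.
    by move=> z _; exact: lower_part_shift.
  by rewrite integD// !integ_cst// mulrDl lerD2r.
apply: le_trans (_ : integ (big_union cbox (alive N gm (above c) I) `|`
    (delayed a0 s0 N gl gt gm (above c) q I `|`
     big_union cbox (fresh a0 s0 N gl gt gm (above c) q I))) (lower_part f c k) <= _).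
  apply: integ_subset => //; first by case: (bc (@root_cell n)).
    by do 2! [apply: boundedU => //].
  move=> w /(cover_alive_stops gl_gt0 gt_gt0 glS gtS (above c) I)[hw|/(stops_cover q) hw];
    by [left|right].
apply: le_trans (integU_le _ _ lG G0) _ => //; first exact: boundedU.
have df := integU_le bD (bU (fresh a0 s0 N gl gt gm (above c) q I)) lG G0.
apply: le_trans (_ : V + (4 * (1 + C) * V + (Y + C) * ((1 - b / 4) * V)) <= _).
  by rewrite lerD// (le_trans df)// lerD.
rewrite mulrA -[X in X + _]mul1r -!mulrDl ler_pM2r//.
have : 0 <= b * C by rewrite mulr_ge0// ltW.
move: C_ge0; lra.
Qed.

End one_grid.

Hypothesis N_large_M : M%:R <= om N%:R.

Definition past_mean (f : E -> R) b l v t := emean f b l (v - q%:R * t + lag l).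

Lemma cval_root f a0 s0 gl gt :
  cval p gamma a0 s0 gl gt q f (@root_cell n) = past_mean f a0 (gl 0%N) s0 (gt 0%N).
Proof.
rewrite /cval /past_mean /ct /gen /= mulr0z mul0r addr0; congr (emean _ _ _ _).
by apply/funext => l; rewrite /cx /corner /= ffunE mulr0z mul0r addr0.
Qed.

Lemma lower_bound k : 0 <= k -> forall f b l v t, bmo1 f -> 0 < l ->
  admissible p gamma l t ->
  integ (bx b l v t) (lower_part f (past_mean f b l v t) k) <=
  (5 + 5 * C) / (q.+1%:R^-1 / 4) * (l ^+ n * t).
Proof.
move=> k0.
have t0 l t : 0 < l -> admissible p gamma l t -> 0 < t.
  by move=> l0 /andP[h _]; apply: lt_le_trans h; rewrite divr_gt0// rho_gt0.
(* The supremum runs over all boxes with an admissible duration, because every cell of a grid is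
   again such a box, with [cval] as its past mean. *)
pose A : set R := fun y => exists f b l v t, [/\ bmo1 f, 0 < l, admissible p gamma l t &
  y = integ (bx b l v t) (lower_part f (past_mean f b l v t) k) / (l ^+ n * t)].
have b0 : 0 < q.+1%:R^-1 :> R by rewrite invr_gt0.
have b1 : q.+1%:R^-1 <= 1 :> R by rewrite invf_le1 ?ltr0n// ler1n.
suff H : forall y, A y -> y <= (5 + 5 * C) / (1 - (1 - q.+1%:R^-1 / 4)).
  move=> f b l v t bf l0 lt; rewrite -ler_pdivrMr.
    apply: le_trans (H _ _) _; first by exists f, b, l, v, t.
    by rewrite subKr.
  by rewrite mulr_gt0 ?exprn_gt0// (t0 l).
apply: (@sup_contraction _ A k).
- by move: (q.+1%:R^-1) b0 b1 => b *; apply/andP; split; lra.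
- by rewrite addr_ge0// mulr_ge0.
- move=> _ [f [b [l [v [t [[lf _] l0 lt ->]]]]]].
  have t00 := t0 _ _ l0 lt; rewrite ler_pdivrMr ?mulr_gt0 ?exprn_gt0//.
  rewrite -(@vol_bx _ _ S b l v) ?(ltW l0) ?(ltW t00)//.
  rewrite -integ_cst; last exact: bounded_bx.
  apply: integ_le; [exact: bounded_bx|exact: loc_integrable_lower|
    exact: loc_integrable_cst|].
  by move=> z _; rewrite /lower_part ge_min lexx orbT.
move=> Y Y0 hY _ [f [b [l [v [t [bf l0 lt ->]]]]]].
have t00 := t0 _ _ l0 lt; rewrite ler_pdivrMr ?mulr_gt0 ?exprn_gt0//.
have [gl [gt [gm [e1 e2 G]]]] := ex_grid gamma_gt0 gamma_lt1 (ltnW N_gt1)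
  (ltnW M_gt1) N_large_M l0 lt.
have gl0 := grid_l_gt0 G; have gt0 := grid_t_gt0 gamma_lt1 G.
have := @lower_contraction b v gl gt gm G f bf k Y k0 Y0.
rewrite cbox_root cval_root e1 e2 vol_bx ?(ltW l0) ?(ltW t00)//; apply.
move=> x; rewrite vol_cbox// -ler_pdivrMr ?mulr_gt0 ?exprn_gt0//.
apply: hY; exists f, (cx b gl x), (gl (gen x)), (ct v gt x), (gt (gen x)).
by split=> //; exact: grid_admissible G _.
Qed.

(** Since [exp y <= 1 + y * exp y], the exponential is bounded linearly by the lower part at the
    level decreased by [D]. Its integral over alive cells can be made so small that the factor
    [expR (d * k)] does no harm. *)
Lemma exp_lower_alive (d D h k x : R) : 0 <= d -> 0 <= x <= k ->
  d * (D + C) = ln 2 -> 0 <= D -> h <= x + D ->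
  expR (d * h) <= 2 + 2 * d * expR (d * k) * x.
Proof.
have c0 := C_ge0.
move=> d0 /andP[x0 xk] dD D0 hx.
have e2 : expR (d * (D + C)) = 2 :> R by rewrite dD lnK// posrE.
apply: le_trans (_ : 2 * expR (d * x) <= _).
  by rewrite -e2 -expRD ler_expR -mulrDr ler_wpM2l//; lra.
rewrite -[X in X + _]mulr1 -!mulrA -mulrDr ler_pM2l//.
have dx : d * x <= d * k by rewrite ler_wpM2l.
have h1 : (1 - d * x) * expR (d * x) <= 1.
  rewrite -[X in _ <= X](mulVf (lt0r_neq0 (expR_gt0 (d * x)))).
  by rewrite ler_pM2r ?expR_gt0// -expRN; exact: expR_ge1Dx.
have : d * x * expR (d * x) <= d * x * expR (d * k).
  by rewrite ler_wpM2l ?mulr_ge0// ler_expR.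
rewrite [expR (d * k) * x]mulrC mulrA; lra.
Qed.

Section one_grid_exponential.
Variables (a0 : 'I_n -> R) (s0 : R) (gl gt : nat -> R) (gm : nat -> nat).
Hypothesis G : parabolic_grid p gamma N M gl gt gm.
Variable f : E -> R.
Hypothesis bf : bmo1 f.
Variable C1 : R.
Hypothesis C1_ge0 : 0 <= C1.
Hypothesis deficit_bound : forall b l v t, 0 < l -> admissible p gamma l t ->
  integ (bx b l v t : set E) (fun z => Num.max (past_mean f b l v t - f z) 0) <=
  C1 * (l ^+ n * t).
Local Notation cx := (cx a0 gl).
Local Notation ct := (ct s0 gt).
Local Notation cbox := (@cbox R n S a0 s0 gl gt).
Local Notation cval := (cval p gamma a0 s0 gl gt q f).
Local Notation top := (cval (@root_cell n)).
Implicit Types (x y : @cell n).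

Let N_gt0 : (0 < N)%N. Proof. exact: ltnW. Qed.
Let gm_gt0 i : (0 < gm i)%N.
Proof. exact: leq_trans (ltnW M_gt1) (grid_m G i). Qed.
Let gl_gt0 := grid_l_gt0 G.
Let gt_gt0 := grid_t_gt0 gamma_lt1 G.
Let glS := grid_lS G.
Let gtS := grid_tS G.
Let gm_large i : (4 * q * q.+1 <= gm i)%N.
Proof. exact: leq_trans M_large (grid_m G i). Qed.
Let lf : loc_integrable f. Proof. by case: bf. Qed.

(** Boxes of the size of generation 1 tile the frame. On each of them the known bound, relative to
    its own past mean, is moved to the level [top] at the cost [C]. *)
Lemma deficit_frame : integ (frame a0 s0 gl gt q) (fun z => Num.max (top - f z) 0) <=
  (C1 + C) * vol (frame a0 s0 gl gt q : set E).
Proof.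
have gg0 := gamma_gt0; have gg1 := gamma_lt1.
have g1 := gt_gt0 1; have l1 := gl_gt0 1; have l0 := gl_gt0 0.
rewrite /frame vol_bx ?(ltW l0)//; last by rewrite addr_ge0// ?mulr_ge0// ltW.
have -> : gt 0%N + q%:R * gt 1%N = (gm 0%N + q)%:R * gt 1%N.
  by rewrite (gtS 0) natrD mulrDl.
rewrite (glS 0); apply: le_trans (_ : _ <= N%:R ^+ n * ((gm 0%N + q)%:R *
    ((C1 + C) * (gl 1%N ^+ n * gt 1%N)))) _; last first.
  by rewrite exprMn le_eqVlt; apply/orP; left; apply/eqP; ring.
apply: integ_tile_le => //; first exact: loc_deficit.
move=> k; rewrite integ_time_sum//; [|exact: loc_deficit|exact: ltW].
set X := (C1 + C) * _.
have -> : (gm 0%N + q)%:R * X = \sum_(j < gm 0%N + q) X.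
  by rewrite sumr_const card_ord mulr_natl.
apply: ler_sum => j _.
set b := corner _ _ _; set v := _ + j%:R * _.
have hj : j%:R * gt 1%N + gt 1%N <= gt 0%N + q%:R * gt 1%N.
  rewrite -[X in _ + X <= _]mul1r -mulrDl natr1 (gtS 0) -mulrDl -natrD.
  by rewrite ler_pM2r// ler_nat.
have hc : top <= past_mean f b (gl 1%N) v (gt 1%N) + C.
  rewrite cval_root /past_mean (glS 0); apply: coarse => //.
    by rewrite -glS; exact: grid_admissible G _.
  rewrite -glS.
  have := om_grid_q G 0; have := grid_q_om G 1.
  have lag0 : 0 <= lag (gl 1%N) <= 2 * om (gl 1%N).
    rewrite /lag mulr_ge0 ?(ltW (om_gt0 _ _))//= ?ler_pM2r ?om_gt0//; lra.
  have h0 : 0 <= j%:R * gt 1%N by rewrite mulr_ge0// ltW.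
  have g0 : gt 0%N <= om (gl 0%N).
    apply: le_trans (grid_rho G _) _.
    by rewrite /rho ler_piMl ?(ltW (om_gt0 _ _))// gerBl ltW.
  have o1 := om_gt0 p l1.
  rewrite /v; move: (q%:R * _) (lag _) (om (gl 1%N)) (om (gl 0%N)) (j%:R * _) hj lag0 h0 g0 o1 g1.
  by move=> qg lg o1 o0 jg *; apply/andP; split; lra.
have bB : bounded_measurable (bx b (gl 1%N) v (gt 1%N) : set E) by exact: bounded_bx.
apply: le_trans (_ : integ (bx b (gl 1%N) v (gt 1%N)) (fun z =>
    Num.max (past_mean f b (gl 1%N) v (gt 1%N) - f z) 0 + C) <= _).
  apply: integ_le => //; first exact: loc_deficit.
    by apply: loc_integrableD; [exact: loc_deficit|exact: loc_integrable_cst].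
  move=> z _; have c0 := C_ge0; move: hc; move: (past_mean _ _ _ _ _) => m hc.
  have h1 : m - f z <= Num.max (m - f z) 0 by rewrite le_max lexx.
  have h2 : 0 <= Num.max (m - f z) 0 by rewrite le_max lexx orbT.
  by rewrite ge_max; apply/andP; split; lra.
rewrite integD//; [|exact: loc_deficit|exact: loc_integrable_cst].
rewrite /X [leRHS]mulrDl lerD//; last by rewrite integ_cst// vol_bx// ltW.
apply: deficit_bound => //.
exact: grid_admissible G 1.
Qed.

(** A reference mean below [top - D] creates a deficit in the past box, which consists of [q] cells
    of the same size; one of them carries a share of at least [1 / q]. *)
Lemma deficit_cell D x : 0 <= D -> cval x < top - D -> exists j : 'I_q,
  D / q%:R * vol (cbox x) <=
  integ (cbox (x.1, x.2 - q%:Z + (j : nat)%:Z)) (fun z => Num.max (top - f z) 0).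
Proof.
move=> D0 hx; apply: contrapT => /forallNP h.
have q0 : 0 < q%:R :> R by rewrite ltr0n q_gt0.
have lg := loc_deficit top lf.
have : integ (past_box a0 s0 gl gt q x) (fun z => Num.max (top - f z) 0) < D * vol (cbox x).
  rewrite integ_past_box//.
  apply: lt_le_trans (_ : \sum_(j < q) D / q%:R * vol (cbox x) <= _).
    apply: ltr_sum; first by apply/hasP; exists (Ordinal q_gt0); rewrite // mem_index_enum.
    by move=> j _; rewrite ltNge; apply/negP; exact: h.
  by rewrite sumr_const card_ord -[_ *+ q]mulr_natl mulrA [_ * (D / _)]mulrC divfK// gt_eqF.
rewrite ltNge => /negP; apply.
set P := ebox (cx x) (gl (gen x)) (ct x - q%:R * gt (gen x) + lag (gl (gen x))).
have bP : bounded_measurable P by exact: bounded_ebox.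
apply: le_trans (_ : integ P (fun z => Num.max (top - f z) 0) <= _); last first.
  apply: integ_subset => //; first exact: measurable_bx.
  - exact: bounded_bx.
  - by move=> z _; rewrite le_max lexx orbT.
  - exact: (reference_past gamma_gt0 gamma_lt1 gl_gt0 (grid_q_om G)).
have lc : loc_integrable ((fun=> top) : E -> R) by exact: loc_integrable_cst.
apply: le_trans (_ : integ P (fun z => top - f z) <= _); last first.
  apply: integ_le => //; first exact: loc_integrableB.
  by move=> z _; rewrite le_max lexx.
rewrite integB// integ_cst// integ_ebox// -/(cval x) -mulrBl.
apply: le_trans (_ : D * vol P <= _).
  rewrite ler_wpM2l// (vol_cbox a0 s0 gl_gt0 gt_gt0) /P vol_ebox// ler_pM2l ?exprn_gt0//.
  exact: grid_rho G _.
by rewrite ler_wpM2r ?vol_ge0//; lra.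
Qed.

(** Chebyshev's inequality on the cells chosen by [deficit_cell]. They lie in the frame, of volume
    at most twice that of the root, and returning to the stopped cells costs [q + 1]; the constant 8
    then leaves one quarter. *)
Lemma vol_stops_small D I : 0 < D -> 8 * (q.+1%:R * q%:R * (C1 + C)) <= D ->
  vol (big_union cbox (stops N gm (above a0 s0 gl gt f (top - D)) I)) <=
  4^-1 * vol (cbox (@root_cell n)).
Proof.
move=> D0 hD; have q0 : 0 < q%:R :> R by rewrite ltr0n q_gt0.
have tD : top - D <= top by rewrite gerBl ltW.
have q10 : 0 < q.+1%:R :> R by rewrite ltr0n.
set V := vol (cbox (@root_cell n)); have V0 : 0 <= V by exact: vol_ge0.
have /choice[j hj] : forall x, exists j : 'I_q, cval x < top - D ->
    D / q%:R * vol (cbox x) <=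
    integ (cbox (x.1, x.2 - q%:Z + (j : nat)%:Z)) (fun z => Num.max (top - f z) 0).
  move=> x; have [/(deficit_cell (ltW D0))[j hj]|h] := pselect (cval x < top - D).
    by exists j.
  by exists (Ordinal q_gt0).
pose J x : @cell n := (x.1, x.2 - q%:Z + (j x : nat)%:Z).
set s := stops _ _ _ _.
have ctJ x : ct (J x) = ct x - q%:R * gt (gen x) + (j x)%:R * gt (gen x).
  rewrite /ct /gen /= intrD intrB -[(Posz (j x))%:~R]/((j x)%:R) -[(Posz q)%:~R]/(q%:R).
  by rewrite mulrDl mulrBl !addrA.
have gJ x : gen (J x) = gen x by [].
have tJ x : cbox x `<=` tower a0 s0 gl gt q (J x).
  move=> w [h1 /andP[h2 h3]]; split=> //; rewrite ctJ gJ.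
  have hq : (j x)%:R * gt (gen x) <= q%:R * gt (gen x).
    by rewrite ler_pM2r// ler_nat ltnW.
  have h0 : 0 <= (j x)%:R * gt (gen x) by rewrite mulr_ge0// ltW.
  by rewrite -natr1 mulrDl mul1r; apply/andP; split; lra.
have bc x := @cbox_bounded R n S a0 s0 gl gt x.
have subs := @csub_subset R n S a0 s0 gl gt.
have lg := loc_deficit top lf.
apply: le_trans (@vol_stops_le R n S a0 s0 _ _ _ _
  N_gt0 gm_gt0 gl_gt0 gt_gt0 glS gtS _ q I J gJ tJ) _.
rewrite -/s; set U := big_union _ _.
have bU : bounded_measurable U by exact: bounded_union.
have hV : 1 + q.+1%:R^-1 / 4 <= 2 :> R.
  have : q.+1%:R^-1 <= 1 :> R by rewrite invf_le1 ?ltr0n// ler1n.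
  by move: (q.+1%:R^-1) => x *; lra.
have : D / q%:R * vol U <= (C1 + C) * (2 * V).
  apply: le_trans (_ : (C1 + C) * vol (frame a0 s0 gl gt q : set E) <= _); last first.
    rewrite ler_wpM2l ?addr_ge0//.
    apply: le_trans (@vol_frame R n S a0 s0 _ _ _ gl_gt0 gt_gt0 gtS q gm_large) _.
    by rewrite ler_wpM2r.
  apply: le_trans deficit_frame.
  apply: le_trans (_ : integ U (fun z => Num.max (top - f z) 0) <= _); last first.
    apply: integ_subset => //; [by case: bU|exact: bounded_bx| |].
      by move=> z _; rewrite le_max lexx orbT.
    move=> w /in_union[_ /mapP[x xs ->] xw].
    have [gx _ _ _] := stopped_cell G bf tD xs.
    apply: (delay_frame gm_gt0 gt_gt0 gtS gx _ _ xw); last exact: ltnW.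
    exact: (stops_root a0 s0 N_gt0 gm_gt0 gl_gt0 gt_gt0 glS gtS xs).
  rewrite -integ_cst//; apply: (nested_integ_le bc (@subs)) => //.
  - apply: (nested_gen a0 s0 N_gt0 gm_gt0 gl_gt0 gt_gt0 glS gtS).
    by apply: pairwise_gen_map => //; exact: pairwise_stops.
  - exact: loc_integrable_cst.
  - move=> _ /mapP[x xs ->]; rewrite integ_cst//.
    have [_ hx _ _] := stopped_cell G bf tD xs.
    apply: le_trans (hj x hx); rewrite !(vol_cbox a0 s0 gl_gt0 gt_gt0).
    by [].
rewrite mulrAC ler_pdivrMr// -(ler_pM2l q10) => h.
rewrite -(ler_pM2r D0); have := ler_wpM2r V0 hD.
move: (q.+1%:R) (q%:R) (vol U) h => x y u h *; lra.
Qed.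

Lemma loc_exp_lower d h k : 0 <= d -> loc_integrable (fun z => expR (d * lower_part f h k z)).
Proof.
move=> d0; have [ml _] := loc_integrable_lower h k lf.
apply: (@loc_integrable_le _ _ _ _ (fun=> expR (d * k))).
- by apply: measurableT_comp => //; exact: measurable_funM.
- exact: loc_integrable_cst.
- move=> z; rewrite ger0_norm ?expR_ge0// ler_expR ler_wpM2l//.
  by rewrite /lower_part ge_min lexx orbT.
Qed.

(** On a stopped cell the level drops by at most [D + C], a factor [expR (d * (D + C)) = 2]. As
    these cells fill at most a quarter of the root, [Y] is multiplied by one half. *)
Lemma exp_contraction D d k Y : 0 <= k -> 0 <= Y -> 0 < D ->
  8 * (q.+1%:R * q%:R * (C1 + C)) <= D -> d * (D + C) = ln 2 ->
  (forall x, integ (cbox x) (fun z => expR (d * lower_part f (cval x) k z)) <=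
     Y * vol (cbox x)) ->
  integ (cbox (@root_cell n)) (fun z => expR (d * lower_part f top k z)) <=
  (3 + 2^-1 * Y) * vol (cbox (@root_cell n)).
Proof.
move=> k0 Y0 D0 hD hd hY; set V := vol (cbox (@root_cell n)).
have V0 : 0 < V by rewrite /V (vol_cbox a0 s0 gl_gt0 gt_gt0) mulr_gt0 ?exprn_gt0.
have tD : top - D <= top by rewrite gerBl ltW.
have DC0 : 0 < D + C by rewrite ltr_wpDr.
have d0 : 0 < d by rewrite -(pmulr_lgt0 _ DC0) hd ln_gt0// ltr1n.
have e0 : 0 < 2 * d * expR (d * k) by rewrite !mulr_gt0 ?expR_gt0.
have lE h := loc_exp_lower h k (ltW d0).
have lc (c : R) : loc_integrable (fun=> c : R) by exact: loc_integrable_cst.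
have bc x := @cbox_bounded R n S a0 s0 gl gt x.
have bU s := bounded_union s bc.
have subs := @csub_subset R n S a0 s0 gl gt.
have [I hI] := alive_small gamma_gt0 gamma_lt1 a0 s0 N_gt0 gm_gt0 gl_gt0 gt_gt0 glS gtS
  (grid_q_om G) (grid_rho G) (grid_l_cvg G N_gt1)
  (grid_t_cvg gamma_lt1 G M_gt1) (top - D) lf k0 (divr_gt0 V0 e0).
rewrite -/(above a0 s0 gl gt f (top - D)) in hI.
set A := big_union cbox (alive N gm (above a0 s0 gl gt f (top - D)) I) in hI.
set B := big_union cbox (stops N gm (above a0 s0 gl gt f (top - D)) I).
have bA : bounded_measurable A by exact: bU.
have bB : bounded_measurable B by exact: bU.
have hA : integ A (fun z => expR (d * lower_part f top k z)) <= 3 * V.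
  apply: le_trans (_ : integ A (fun z => 2 + 2 * d * expR (d * k) *
      lower_part f (top - D) k z) <= _).
    apply: integ_le => //.
      apply: loc_integrableD => //; apply: loc_integrableZ.
      exact: loc_integrable_lower.
    move=> z _; apply: (@exp_lower_alive _ D) => //; [exact: ltW| |exact: ltW|].
      by rewrite (@lower_part_ge0 _ _ k z k0) /lower_part ge_min lexx orbT.
    by apply: lower_part_shift; [exact: ltW|rewrite subrK].
  rewrite integD//; last by apply: loc_integrableZ; exact: loc_integrable_lower.
  rewrite integ_cst// integZ//; last exact: loc_integrable_lower.
  have : vol A <= V.
    apply: vol_subset; [by case: bA|exact: bc|move=> w /in_union[x xs xw]].
    apply: (subs _ _ _ _ xw).
    exact: (alive_root a0 s0 N_gt0 gm_gt0 gl_gt0 gt_gt0 glS gtS xs).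
  by move: hI; rewrite ler_pdivlMr// mulrC; lra.
have hB : integ B (fun z => expR (d * lower_part f top k z)) <= 2^-1 * Y * V.
  apply: le_trans (_ : 2 * Y * vol B <= _); last first.
    have := vol_stops_small I D0 hD; rewrite -/B -/V => h.
    rewrite [2 * Y]mulrC [2^-1 * Y]mulrC -!mulrA ler_wpM2l//; lra.
  rewrite -integ_cst//; apply: (nested_integ_le bc (@subs)) => //.
    apply: (nested_gen a0 s0 N_gt0 gm_gt0 gl_gt0 gt_gt0 glS gtS).
    exact: pairwise_stops.
  move=> x xs; have [_ _ hx _] := stopped_cell G bf tD xs.
  apply: le_trans (_ : integ (cbox x) (fun z => 2 * expR (d * lower_part f (cval x) k z)) <= _).
    apply: integ_le => //; first exact: loc_integrableZ.
    have e2 : expR (d * (D + C)) = 2 by rewrite hd lnK// posrE.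
    move=> z _; rewrite -[X in _ <= X * _]e2 -expRD ler_expR.
    rewrite -mulrDr ler_pM2l// addrC; apply: lower_part_shift; first exact: ltW.
    by rewrite addrCA; lra.
  by rewrite integZ// integ_cst// -mulrA ler_pM2l.
apply: le_trans (_ : integ (A `|` B) (fun z => expR (d * lower_part f top k z)) <= _).
  apply: integ_subset => //; first by case: (bc (@root_cell n)).
  - exact: boundedU.
  - exact: (cover_alive_stops gl_gt0 gt_gt0 glS gtS).
apply: le_trans (_ : 3 * V + 2^-1 * Y * V <= _); last by rewrite -mulrDl.
apply: le_trans (integU_le bA bB (lE _) _) _; last exact: lerD.
by move=> z; exact: expR_ge0.
Qed.

End one_grid_exponential.

Lemma deficit_bound f b l v t : bmo1 f -> 0 < l -> admissible p gamma l t ->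
  integ (bx b l v t : set E) (fun z => Num.max (past_mean f b l v t - f z) 0) <=
  (5 + 5 * C) / (q.+1%:R^-1 / 4) * (l ^+ n * t).
Proof.
move=> bf l0 lt; have [lf _] := bf; apply: integ_le_trunc.
- exact: bounded_bx.
- exact: loc_deficit.
- by move=> z; rewrite le_max lexx orbT.
- by move=> k; exact: lower_bound.
Qed.

Lemma exp_bound : exists2 d, 0 < d & forall k f b l v t, 0 <= k -> bmo1 f -> 0 < l ->
  admissible p gamma l t ->
  integ (bx b l v t) (fun z => expR (d * lower_part f (past_mean f b l v t) k z)) <=
  6 * (l ^+ n * t).
Proof.
pose C1 := (5 + 5 * C) / (q.+1%:R^-1 / 4).
have C10 : 0 <= C1 by rewrite divr_ge0 ?addr_ge0 ?mulr_ge0.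
pose D := 8 * (q.+1%:R * q%:R * (C1 + C)) + 1.
have D0 : 0 < D by rewrite ltr_wpDl// !mulr_ge0// addr_ge0.
have DC0 : 0 < D + C by rewrite ltr_wpDr.
have hD : 8 * (q.+1%:R * q%:R * (C1 + C)) <= D by rewrite lerDl.
pose d := ln 2 / (D + C) : R.
have d0 : 0 < d by rewrite divr_gt0// ln_gt0// ltr1n.
have hd : d * (D + C) = ln 2 by rewrite divfK// gt_eqF.
exists d => // k f b l v t k0 bf l0 lt.
have t0 l' t' : 0 < l' -> admissible p gamma l' t' -> 0 < t'.
  by move=> l0' /andP[h _]; apply: lt_le_trans h; rewrite divr_gt0// rho_gt0.
pose A : set R := fun y => exists f b l v t, [/\ bmo1 f, 0 < l, admissible p gamma l t &
  y = integ (bx b l v t) (fun z => expR (d * lower_part f (past_mean f b l v t) k z)) /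
    (l ^+ n * t)].
suff H : forall y, A y -> y <= 3 / (1 - 2^-1).
  have t00 := t0 _ _ l0 lt; rewrite -ler_pdivrMr; last by rewrite mulr_gt0// exprn_gt0.
  apply: le_trans (H _ _) _; first by exists f, b, l, v, t.
  by rewrite ler_pdivrMr; lra.
apply: (@sup_contraction _ A (expR (d * k))) => //.
- by apply/andP; split; lra.
- move=> _ {f b l v t bf l0 lt} [f [b [l [v [t [bf l0 lt ->]]]]]].
  have t00 := t0 _ _ l0 lt; rewrite ler_pdivrMr ?mulr_gt0 ?exprn_gt0//.
  rewrite -(@vol_bx _ _ S b l v) ?(ltW l0) ?(ltW t00)//.
  rewrite -integ_cst; last exact: bounded_bx.
  apply: integ_le; [exact: bounded_bx|apply: loc_exp_lower => //; exact: ltW|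
    exact: loc_integrable_cst|].
  by move=> z _; rewrite ler_expR ler_pM2l// /lower_part ge_min lexx orbT.
move=> Y Y0 hY _ {f b l v t bf l0 lt} [f [b [l [v [t [bf l0 lt ->]]]]]].
have t00 := t0 _ _ l0 lt; rewrite ler_pdivrMr ?mulr_gt0 ?exprn_gt0//.
have [gl [gt [gm [e1 e2 G]]]] := ex_grid gamma_gt0 gamma_lt1 (ltnW N_gt1)
  (ltnW M_gt1) N_large_M l0 lt.
have gl0 := grid_l_gt0 G; have gt0 := grid_t_gt0 gamma_lt1 G.
have := @exp_contraction b v gl gt gm G f bf C1 C10 _ D d k Y k0 Y0 D0 hD hd.
rewrite cbox_root cval_root e1 e2 vol_bx ?(ltW l0) ?(ltW t00)//; apply.
  by move=> b' l' v' t' *; exact: deficit_bound.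
move=> x; rewrite vol_cbox// -ler_pdivrMr ?mulr_gt0 ?exprn_gt0//.
apply: hY; exists f, (cx b gl x), (gl (gen x)), (ct v gt x), (gt (gen x)).
by split=> //; exact: grid_admissible G _.
Qed.

End stopping.

Lemma ord_norm_le (N : nat) (k : 'I_N) : `|(k : nat)%:Z| <= N%:Z.
Proof. by have := ltn_ord k; lia. Qed.

Lemma gap_scales (R : realFieldType) (g q T N o r : R) : 0 < g -> 0 <= q -> 0 < T ->
  0 < N -> 0 < r -> (4 + 2 * q + 2 * T) / g <= o -> (4 + 2 * q + 2 * T) / g * N <= o ->
  [/\ 2 * r <= g / 2 * (o * r), q * r <= g / 2 * (o * r) & N * T * r <= g / 2 * (o * r)].
Proof.
move=> g0 q0 T0 N0 r0; rewrite mulrAC !ler_pdivrMr// => h1 h2.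
have qN : 0 <= q * N by rewrite mulr_ge0// ltW.
by split; rewrite mulrA ler_pM2r//; lra.
Qed.

(** * Chaining across the gap *)

Section core.
Context {R : realType} {n : nat} {S : box_space R n}.
Variables (p gamma : R).
Hypotheses (p_gt1 : 1 < p) (gamma_gt0 : 0 < gamma) (gamma_lt1 : gamma < 1).
Hypothesis n_gt0 : (0 < n)%N.
Local Notation E := (bs_type S).
Local Notation om := (om p).
Local Notation lag := (lag p gamma).
Local Notation rho := (rho p gamma).
Local Notation ebox := (@ebox R n S p gamma).
Local Notation emean := (@emean R n S p gamma).
Local Notation bmo1 := (@bmo1 R n S p gamma).

(** The constants are fixed in the order [T0], [q], [M], [N], [C], [d]: [N] has to dominate the
    first three, while [C] depends on [N]. *)
Lemma exp_lower_bound : exists q d, 0 < d /\ forall k f b l v t,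
  0 <= k -> bmo1 f -> 0 < l -> admissible p gamma l t ->
  integ (bx b l v t) (fun z => expR (d * lower_part f (past_mean p gamma q f b l v t) k z))
    <= 6 * (l ^+ n * t).
Proof.
have gg1 : 0 < 1 - gamma by rewrite subr_gt0.
have [T0 T00 harn] := harnack (S := S) p_gt1 gamma_gt0 gamma_lt1 n_gt0.
have [q hq] := ex_nat_ge (8 / (1 - gamma)); rewrite ler_pdivrMr// in hq.
pose M := (4 * q * q.+1)%N.
have [N [N1 hN1 hN2]] := ex_om_large p_gt1 (T0 + 2 + 2 * q%:R + M%:R).
have N1' : 1 <= N%:R :> R by rewrite ler1n ltnW.
have hN : N%:R * T0 + 2 <= om N%:R.
  apply: le_trans hN2; have : 0 <= (2 * q%:R + M%:R) * N%:R :> R.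
    by rewrite mulr_ge0// addr_ge0// mulr_ge0.
  by move: (M%:R) => m; lra.
have [C C0 coarse] := coarse_le_fine p_gt1 gamma_gt0 gamma_lt1 harn (ltnW N1) hN hq.
have hqN : 2 * q%:R <= om N%:R.
  by apply: le_trans hN1; have := ler0n R M; lra.
have hMN : M%:R <= om N%:R.
  by apply: le_trans hN1; have := ler0n R q; lra.
have [d d0 hd] := exp_bound gamma_gt0 gamma_lt1 N1 (leqnn M) hq hqN C0 coarse hMN.
by exists q, d.
Qed.

Lemma past_sum_le (W : E -> R) (Z l s t : R) b : loc_integrable W -> (forall z, 0 <= W z) ->
  0 <= Z -> 0 < l -> rho l <= t ->
  (forall j : nat, j%:R * rho l <= t ->
    integ (ebox b l (s + j%:R * rho l)) W <= Z * (l ^+ n * rho l)) ->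
  integ (bx b l s t) W <= 2 * Z * (l ^+ n * t).
Proof.
move=> lW W0 Z0 l0 lt h; have r0 := rho_gt0 p gamma_lt1 l0.
have t0 : 0 <= t by exact: le_trans (ltW r0) lt.
have /andP[] := truncn_itv (divr_ge0 t0 (ltW r0)).
move: (Num.truncn _) => m; rewrite ler_pdivlMr// ltr_pdivrMr// => h1 h2.
apply: le_trans (_ : integ (bx b l s (m.+1%:R * rho l)) W <= _).
  apply: integ_subset => //; [exact: measurable_bx|exact: bounded_bx|].
  by move=> w [h3 /andP[h4 h5]]; split=> //; rewrite h4/=; lra.
rewrite integ_time_sum//; last exact: ltW.
apply: le_trans (_ : \sum_(j < m.+1) Z * (l ^+ n * rho l) <= _).
  apply: ler_sum => j _; apply: h; apply: le_trans h1.
  by rewrite ler_pM2r// ler_nat -ltnS.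
rewrite sumr_const card_ord -[_ *+ _]mulr_natl mulrCA [2 * Z]mulrC -!mulrA ler_wpM2l//.
rewrite mulrCA [leRHS]mulrCA ler_pM2l ?exprn_gt0// -natr1 mulrDl mul1r; lra.
Qed.

(** [W] stays free because it is used twice: as [(f - c - C)_+] for oscillations and as an
    exponential of a multiple of [f] for weights. Early boxes enter only through the fact that their
    later means are at most [c + C]. *)
Lemma core : exists C d, [/\ 0 < C, 0 < d & forall f a L t, bmo1 f -> 0 < L -> exists c,
  (forall W Z, loc_integrable W -> (forall z, 0 <= W z) -> 0 <= Z ->
     (forall b l s, 0 < l -> emean f b l (s + lag l) <= c + C ->
        integ (ebox b l s) W <= Z * (l ^+ n * rho l)) ->
     integ (bx a L (t - om L) (rho L)) W <= 2 * Z * (L ^+ n * rho L)) /\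
  (forall k, 0 <= k -> integ (bx a L (t + gamma * om L) (rho L))
     (fun z => expR (d * lower_part f c k z)) <= C * (L ^+ n * rho L))].
Proof.
have gg0 := gamma_gt0; have gg1 := gamma_lt1.
have [q [d [d0 hexp]]] := exp_lower_bound.
have [T0 T00 harn] := harnack (S := S) p_gt1 gamma_gt0 gamma_lt1 n_gt0.
have [N [N1 hN1 hN2]] := ex_om_large p_gt1 ((4 + 2 * q%:R + 2 * T0) / gamma).
have N0 : 0 < N%:R :> R by rewrite ltr0n ltnW.
have [C1 C10 hC1] := harn N (2 * om N%:R) (ltnW N1).
exists (C1 + 6 * expR (d * C1)), d; split=> //.
  by rewrite ltr_wpDl// mulr_gt0// expR_gt0.
move=> f a L t bf L0; have [lf _] := bf.
pose l := L / N%:R; have l0 : 0 < l by rewrite divr_gt0.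
have Ll : L = N%:R * l by rewrite /l mulrC divfK// gt_eqF.
have eL : L ^+ n = N%:R ^+ n * l ^+ n by rewrite {1}Ll exprMn.
clearbody l.
have oL : om L = om N%:R * om l by rewrite Ll omM ?ltW.
have ol := om_gt0 p l0; have oL0 := om_gt0 p L0; have oN := om_gt0 p N0.
have rl := rho_gt0 p gamma_lt1 l0; have rL := rho_gt0 p gamma_lt1 L0.
have q0 := ler0n R q.
have lag1 : 0 < lag l by rewrite mulr_gt0//; lra.
have [hN3 qom NT] := gap_scales gg0 q0 T00 N0 ol hN1 hN2.
rewrite -oL in hN3 qom NT.
have lag2 : lag l <= gamma / 2 * om L.
  by apply: le_trans hN3; rewrite /lag ler_pM2r//; lra.
have lagL : lag l <= om L.
  by apply: le_trans lag2 _; rewrite ler_piMl ?(ltW oL0)//; lra.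
have rhoL : rho L = om L - gamma * om L by rewrite /rho mulrBl mul1r.
(* The level is a mean at scale [L / N], taken in the middle of the gap. By the choice of [N], the
   lags and the delay at this scale and the time of a Harnack chain are each at most
   [gamma / 2 * om L], so that [c] is linked to both halves. *)
exists (emean f a l t); split.
- move=> W Z lW W0 Z0 hW; rewrite {1}Ll.
  apply: le_trans (_ : N%:R ^+ n * (2 * Z * (l ^+ n * rho L)) <= _); last first.
    by rewrite eL mulrCA !mulrA.
  apply: integ_tile_le => // k; apply: past_sum_le => //.
    by rewrite /rho ler_pM2l ?subr_gt0// om_le ?(ltW l0)// Ll ler_peMl ?(ltW l0)// ler1n ltnW.
  move=> j hj; apply: hW => //.
  apply: le_trans (_ : emean f a l t + C1 <= _); last first.
    by rewrite addrA lerDl mulr_ge0 ?expR_ge0.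
  have := hC1 f (corner a (fun i => k i) l) (fun i => - (k i : nat)%:Z) l
    (t - om L + j%:R * rho l + lag l) t bf l0.
  rewrite corner_corner.
  have -> : corner a (fun i => (k i : nat)%:Z - (k i : nat)%:Z) l = a.
    by apply/funext => i; rewrite /corner subrr mul0r addr0.
  apply.
    by move=> i; rewrite normrN; exact: ord_norm_le.
  have jr : 0 <= j%:R * rho l by rewrite mulr_ge0// ltW.
  rewrite rhoL in hj; rewrite -[2 * _ * _]mulrA -oL.
  move: (j%:R * rho l) (om L) (lag l) (N%:R * T0 * om l) NT hj jr lag1 lag2 oL0 => x y z w.
  by move=> *; apply/andP; split; lra.
move=> k k0.
have [|m m1 hm] := @ex_time_step R (rho L) (rho l / 2) 1 (divr_gt0 rl (ltr0Sn R 1)) isT.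
  rewrite mul1r /rho mulrAC -mulrA ler_pM2l ?subr_gt0//.
  have : om l <= om L by rewrite om_le ?(ltW l0)// Ll ler_peMl ?(ltW l0)// ler1n ltnW.
  lra.
set tau := rho L / m%:R in hm.
have m0 : 0 < m%:R :> R by rewrite ltr0n.
have lt : admissible p gamma l tau by move: hm; rewrite [2 * _]mulrC divfK.
have Lt : rho L = m%:R * tau by rewrite /tau mulrC divfK// gt_eqF.
have tau0 : 0 < tau by rewrite divr_gt0.
have qtau : q%:R * tau <= gamma / 2 * om L.
  apply: le_trans qom; rewrite ler_wpM2l//; have /andP[_ h] := lt.
  by apply: le_trans h _; rewrite /rho ler_piMl ?(ltW ol)//; lra.
have lE c : loc_integrable (fun z => expR (d * lower_part f c k z)).
  by apply: (loc_exp_lower bf); exact: ltW.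
rewrite {1}Ll; apply: le_trans (_ : N%:R ^+ n * (m%:R *
    (6 * expR (d * C1) * (l ^+ n * tau))) <= _); last first.
  rewrite {1}Lt eL.
  rewrite (_ : N%:R ^+ n * (m%:R * (6 * expR (d * C1) * (l ^+ n * tau))) =
    (6 * expR (d * C1)) * (N%:R ^+ n * l ^+ n * (m%:R * tau))); last by ring.
  rewrite ler_wpM2r ?lerDr//; apply: mulr_ge0; last exact: mulr_ge0 (ltW m0) (ltW tau0).
  by rewrite mulr_ge0 ?exprn_ge0 ?ltW.
apply: integ_tile_le => // k'; rewrite Lt integ_time_sum//; last exact: ltW.
set Z := 6 * _ * _.
have -> : m%:R * Z = \sum_(j < m) Z by rewrite sumr_const card_ord mulr_natl.
apply: ler_sum => j _; set b := corner _ _ _; set v := _ + j%:R * _.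
have hc : emean f a l t <= past_mean p gamma q f b l v tau + C1.
  apply: hC1 => //.
    by move=> i; exact: ord_norm_le.
  have j0 : 0 <= j%:R * tau by rewrite mulr_ge0// ltW.
  have jm : j%:R * tau <= rho L by rewrite Lt ler_pM2r// ler_nat ltnW.
  have qt0 : 0 <= q%:R * tau by rewrite mulr_ge0// ltW.
  rewrite rhoL in jm; rewrite -[2 * _ * _]mulrA -oL /v.
  move: (j%:R * tau) (q%:R * tau) (om L) (lag l) (N%:R * T0 * om l)
    NT j0 jm qt0 qtau lag1 lagL oL0 => x y z w u.
  by move=> *; apply/andP; split; lra.
apply: le_trans (_ : integ (bx b l v tau) (fun z => expR (d * C1) *
    expR (d * lower_part f (past_mean p gamma q f b l v tau) k z)) <= _).
  apply: integ_le => //; [exact: bounded_bx|exact: loc_integrableZ|].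
  move=> z _; rewrite -expRD ler_expR -mulrDr ler_pM2l// addrC.
  exact: lower_part_shift.
rewrite integZ//; last exact: bounded_bx.
by rewrite /Z -mulrA mulrCA ler_pM2l ?expR_gt0//; exact: hexp.
Qed.

End core.

Lemma lebesgue_tuple_box (R : realType) (n : nat) (a b : 'I_n -> R) :
  (forall i, a i <= b i) ->
  let Q := [set y : n.-tuple (measurableTypeR R) |
              forall i, a i <= tnth y i < b i] in
  measurable Q /\ lebesgue_tuple R n Q = (\prod_i (b i - a i))%:E.
Proof.
elim: n a b => [|n ih] a b ab Q.
  have -> : Q = setT by apply/seteqP; split=> // y _ -[].
  by split; [exact: measurableT|rewrite big_ord0 /= diracT].
have mQ : measurable Q.
  rewrite (_ : Q = \bigcap_(i in [set: 'I_n.+1])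
      ([set: n.+1.-tuple (measurableTypeR R)] `&` (@tnth _ _ ^~ i) @^-1` `[a i, b i[)).
    by apply: fin_bigcap_measurable => // i _; apply: measurable_tnth.
  apply/seteqP; split=> [y hy i _|y hy i]; first by split=> //=; rewrite in_itv/=.
  by have [_ /=] := hy i Logic.I; rewrite in_itv/=.
split => //.
rewrite /= /lebesgue_tupleS /pushforward.
have [mQ' e] := ih (fun i => a (lift ord0 i)) (fun i => b (lift ord0 i))
  (fun i => ab _).
rewrite (_ : _ @^-1` Q = [set y : n.-tuple (measurableTypeR R) | forall i,
    a (lift ord0 i) <= tnth y i < b (lift ord0 i)] `*` `[a ord0, b ord0[); last first.
  apply/seteqP; split=> [[y t] hy|[y t] [hy ht] i].
    split=> /=; last by have := hy ord0; rewrite tnth0 in_itv.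
    by move=> i; have := hy (lift ord0 i); rewrite tnthS.
  rewrite /= in_itv /= in ht; have [->|[j ->]] : i = ord0 \/ exists j, i = lift ord0 j.
    by case: (unliftP ord0 i) => [j ->|->]; [right; exists j|left].
    by rewrite tnth0.
  by rewrite tnthS; exact: hy.
rewrite product_measure1E//.
rewrite e big_ord_recl mulrC EFinM; congr (_ * _)%E.
apply: etrans (lebesgue_measure_itv _) _ => /=; rewrite lte_fin; case: ltP => h //.
by have := ab ord0; rewrite le_eqVlt ltNge h orbF => /eqP ->; rewrite subrr.
Qed.

(** * Space-time and its time reversal *)

Section spacetime_coordinates.
Variables (R : realType) (n : nat) (past : bool).
Local Notation BT := (n.-tuple (measurableTypeR R) * measurableTypeR R)%type.
Local Notation E := (spacetime R n).

Definition st_X (i : 'I_n) (z : E) : R :=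
  tnth (z : n.-tuple R * R).1 i.
(* Reversing time turns BMO^- into BMO^+. *)
Definition st_T (z : E) : R :=
  if past then - (z : n.-tuple R * R).2 else (z : n.-tuple R * R).2.

Lemma borel_measurable (A : set BT) : measurable A -> measurable (A : set E).
Proof. exact: caratheodory_measurable_mu_ext. Qed.

Lemma lebesgue_spacetimeE (A : set BT) : measurable A ->
  @lebesgue_spacetime R n A = borel_spacetime_measure R n A.
Proof. exact: measurable_mu_extE. Qed.

Lemma borel_measurable_fun (f : BT -> R) : measurable_fun setT f ->
  measurable_fun setT (f : E -> R).
Proof.
move=> mf _ Y mY; rewrite setTI; apply: borel_measurable.
by rewrite -[X in measurable X]setTI; exact: mf.
Qed.

Lemma measurable_st_X i : measurable_fun setT (st_X i).
Proof.
apply: borel_measurable_fun.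
exact: (measurableT_comp (measurable_tnth i) measurable_fst).
Qed.

Lemma measurable_st_T : measurable_fun setT st_T.
Proof.
apply: borel_measurable_fun; rewrite /st_T; case: past; last exact: measurable_snd.
by apply: measurableT_comp => //; exact: measurable_snd.
Qed.

Lemma lebesgue_spacetime_box (a b : 'I_n -> R) (J : set R) (c : R) :
  (forall i, a i <= b i) -> measurable (J : set (measurableTypeR R)) ->
  lebesgue_measure J = c%:E ->
  lebesgue_spacetime [set z : E | (forall i, a i <= st_X i z < b i) /\
    J (z : n.-tuple R * R).2] = (\prod_i (b i - a i) * c)%:E.
Proof.
move=> ab mJ eJ; have [mQ eQ] := lebesgue_tuple_box ab.
rewrite (_ : [set z : E | _] = [set y : n.-tuple (measurableTypeR R) |
    forall i, a i <= tnth y i < b i] `*` J)//.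
rewrite lebesgue_spacetimeE; last exact: measurableX.
rewrite -[LHS]/((lebesgue_tuple R n \x @lebesgue_measure R)%E _).
by rewrite product_measure1E// eQ EFinM; congr (_ * _)%E.
Qed.

Lemma st_mu_box (a b : 'I_n -> R) s s' : (forall i, a i <= b i) -> s <= s' ->
  lebesgue_spacetime [set z : E | (forall i, a i <= st_X i z < b i) /\
    s <= st_T z < s'] = (\prod_i (b i - a i) * (s' - s))%:E.
Proof.
move=> ab ss; pose J : set R := [set` if past then `]- s', - s] else `[s, s'[].
have -> : [set z : E | (forall i, a i <= st_X i z < b i) /\ s <= st_T z < s'] =
    [set z : E | (forall i, a i <= st_X i z < b i) /\ J (z : n.-tuple R * R).2].
  apply/seteqP; split=> -[y t] [h1 h2]; split=> //; move: h2;
    by rewrite /st_T /J; case: past => /=; rewrite in_itv//= lerNr ltrNl andbC.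
apply: lebesgue_spacetime_box => //.
  by rewrite /J; case: past; exact: measurable_itv.
rewrite /J; case: past; rewrite lebesgue_measure_itv /= lte_fin.
  rewrite ltrN2 opprK; case: ltP => h; first by rewrite addrC.
  by rewrite (le_anti (introT andP (conj ss h))) subrr.
case: ltP => h //; by rewrite (le_anti (introT andP (conj ss h))) subrr.
Qed.

Let H := [set H : set E | (exists i r, H = [set z | st_X i z < r]) \/
                           (exists r, H = [set z | st_T z < r])].

Lemma borel_generated (A : set BT) : measurable A -> <<s H >> (A : set E).
Proof.
pose G := g_sigma_algebraType H.
have mlt (f : G -> R) : (forall r, H [set z | f z < r]) ->
    measurable_fun setT (f : G -> measurableTypeR R).
  move=> hf; apply: (measurability _ (RGenInftyO.measurableE R)).
  move=> _ [_ [r ->] <-]; apply: sub_sigma_algebra.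
  by rewrite setTI (_ : _ @^-1` _ = [set z | f z < r]).
have mX i : measurable_fun setT (fun z : G => st_X i z : measurableTypeR R).
  by apply: mlt => r; left; exists i, r.
have mT : measurable_fun setT (fun z : G => st_T z : measurableTypeR R).
  by apply: mlt => r; right; exists r.
have m2 : measurable_fun setT (fun z : G => (z : BT).2).
  move: mT; rewrite /st_T; case: past => // mT.
  rewrite (_ : (fun z : G => (z : BT).2) = (fun z : G => - - (z : BT).2)).
    exact: measurableT_comp.
  by apply/funext => z; rewrite opprK.
have mid : measurable_fun setT (fun z : G => ((z : BT).1, (z : BT).2) : BT).
  by apply: measurable_fun_pair => //; apply/measurable_fun_tnthP => i; exact: mX.
move=> mA; have := mid measurableT A mA; rewrite setTI.
by rewrite (_ : _ @^-1` A = A)//; apply/seteqP; split=> -[].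
Qed.

(** The measure is an outer measure built on Borel covers. A cover of [K] intersected with [A],
    optimal up to [e], is enough: inside [K], it differs from [A] only by its excess. *)
Lemma st_approx (A K : set E) (e : R) : measurable A -> measurable K ->
  (lebesgue_spacetime K < +oo)%E -> 0 < e ->
  exists2 B, <<s H >> B &
    (lebesgue_spacetime (K `&` ((A `\` B) `|` (B `\` A))) <= e%:E)%E.
Proof.
move=> mA mK K_fin e0.
have mKA : measurable (K `&` A) by exact: measurableI.
have fKA : lebesgue_spacetime (K `&` A) \is a fin_num.
  rewrite ge0_fin_numE//; apply: le_lt_trans K_fin.
  by apply: le_measure; rewrite ?inE//; exact: subIsetl.
have [_ [F [mF sF] <-] hF] := lb_ereal_inf_adherent e0 fKA.
rewrite -[ereal_inf _]/(lebesgue_spacetime (K `&` A)) in hF.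
pose B : set BT := \bigcup_k F k.
have mB : measurable B by exact: bigcupT_measurable.
have mB' : measurable (B : set E) by exact: borel_measurable.
exists B; first exact: borel_generated.
have -> : K `&` (A `\` B `|` B `\` A) = K `&` (B `\` A).
  apply/seteqP; split=> [z [Kz [[Az Bz]|h]]|z [Kz h]] //; last by split=> //; right.
  by exfalso; apply: Bz; exact: sF.
apply: le_trans (_ : lebesgue_spacetime ((B : set E) `\` (K `&` A)) <= _)%E.
  apply: le_measure; rewrite ?inE//.
  - by apply: measurableI => //; exact: measurableD.
  - exact: measurableD.
  - by move=> z [Kz [Bz Az]]; split=> // -[].
have hB : (lebesgue_spacetime (B : set E) <= lebesgue_spacetime (K `&` A) + e%:E)%E.
  apply: le_trans (ltW hF); rewrite lebesgue_spacetimeE//.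
  exact: measure_sigma_subadditive.
have sB : K `&` A `<=` B by exact: sF.
rewrite measureD//; last by apply: le_lt_trans hB _; rewrite ltey_eq fin_numD fKA.
by rewrite (setIidr sB) leeBlDl.
Qed.

Definition st_box_space : box_space R n :=
  BoxSpace measurable_st_X measurable_st_T st_mu_box st_approx.

End spacetime_coordinates.

Section rectangles.
Context {R : realType} {n : nat}.
Variables (p gamma : R).
Hypotheses (p_gt1 : 1 < p) (gamma_gt0 : 0 < gamma) (gamma_lt1 : gamma < 1).
Local Notation E := (spacetime R n).
Local Notation mu := (@lebesgue_spacetime R n).
Local Notation S := (st_box_space R n).
Local Notation om := (om p).
Local Notation lag := (lag p gamma).
Local Notation rho := (rho p gamma).
Local Notation rect := (@parabolic_rectangle R n).
Implicit Types (f g : E -> R) (Q : rect) (A : set E).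

Lemma L1loc_integrable past f : L1loc f -> loc_integrable (S := S past) f.
Proof.
move=> [mf hf]; split=> // a l s t.
pose s0 : R := if past then - (s + t) else s.
pose s1 : R := if past then - s else s + t.
pose K : set E := [set z | (forall i, a i <= st_X i z <= a i + l) /\
  s0 <= (z : n.-tuple R * R).2 <= s1].
have sK : (bx a l s t : set (S past)) `<=` K.
  move=> z [h1 h2]; split.
    by move=> i; have /andP[-> /ltW] := h1 i.
  move: h2; rewrite /s0 /s1 /= /st_T; case: (past).
    by move=> /andP[h2 h3]; apply/andP; split; lra.
  by move=> /andP[-> /ltW].
have mK : measurable K.
  rewrite (_ : K = (\bigcap_(i in [set: 'I_n])
      ([set: E] `&` st_X i @^-1` `[a i, a i + l])) `&`
      ([set: E] `&` st_T false @^-1` `[s0, s1])).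
    apply: measurableI; last exact: measurable_st_T.
    by apply: fin_bigcap_measurable => // i _; exact: measurable_st_X.
  apply/seteqP; split=> [z [h1 h2]|z [h1 [_ h2]]].
    by split=> [i _|]; split=> //; rewrite /= in_itv//=; exact: h1.
  split=> [i|]; last by move: h2; rewrite /= in_itv.
  by have [_] := h1 i Logic.I; rewrite /= in_itv.
have cK : compact (spacetime_rV @` K).
  rewrite (_ : _ @` K = [set v : 'rV[R]_n | forall i, `[a i, a i + l]%classic (v ord0 i)]
      `*` `[s0, s1]).
    apply: compact_setX; last exact: segment_compact.
    apply: (@rV_compact R n (fun i => `[a i, a i + l]%classic)) => i.
    exact: segment_compact.
  apply/seteqP; split=> [_ [[y u] [h1 h2] <-]|[v u] [h1 h2]].
    split=> /=; last by rewrite in_itv.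
    by move=> i; rewrite mxE in_itv; exact: h1.
  rewrite /= in_itv/= in h2.
  exists (([tuple v ord0 i | i < n], u) : n.-tuple R * R).
    split=> // i; rewrite /st_X tnth_mktuple.
    by have := h1 i; rewrite /= in_itv.
  by congr pair; apply/rowP => i; rewrite mxE tnth_mktuple.
have : mu.-integrable K (EFin \o f).
  apply/integrableP; split; last exact: hf.
  by apply/measurable_EFinP; exact: measurable_funTS.
by apply: integrableS => //; exact: (@measurable_bx R n (S past)).
Qed.

Definition rect_corner Q : 'I_n -> R := fun i => tnth (rect_center Q) i - rect_edge Q / 2.

(* With [past] set time runs backwards, in agreement with [st_T], so that the early half is
   R^+. *)
Definition rect_start (past : bool) Q : R :=
  (if past then - rect_time Q else rect_time Q) - om (rect_edge Q).

Definition early (past : bool) Q : set E :=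
  if past then rect_plus p gamma Q else rect_minus p gamma Q.

Definition late (past : bool) Q : set E :=
  if past then rect_minus p gamma Q else rect_plus p gamma Q.

Definition ebox_early past Q : set (S past) :=
  ebox p gamma (rect_corner Q) (rect_edge Q) (rect_start past Q).

Definition ebox_late past Q : set (S past) :=
  ebox p gamma (rect_corner Q) (rect_edge Q) (rect_start past Q + lag (rect_edge Q)).

(** Reversing time turns [[s, t[] into []-t, -s]], so that the halves of a rectangle agree with the
    boxes of the reversed space only up to two time slices. *)
Definition ae_same A (B : set E) := [/\ measurable A, measurable B &
  exists N, [/\ measurable N, mu N = 0%E & A `\` N = B `\` N]].

Lemma null_slice (a b : 'I_n -> R) (s t : R) : (forall i, a i <= b i) ->
  exists N : set E, [/\ measurable N, mu N = 0%E & forall z : E,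
    (forall i, a i <= st_X i z < b i) ->
    (z : n.-tuple R * R).2 = s \/ (z : n.-tuple R * R).2 = t -> N z].
Proof.
move=> ab; pose J : set R := [set s] `|` [set t].
have mJ : measurable (J : set (measurableTypeR R)).
  by apply: measurableU; exact: measurable_set1.
have eJ : lebesgue_measure J = 0%:E.
  by apply: countable_lebesgue_measure0; apply: finite_set_countable; rewrite finite_setU.
exists [set z : E | (forall i, a i <= st_X i z < b i) /\ J (z : n.-tuple R * R).2].
split; last by move=> z; split.
  have [mC _] := lebesgue_tuple_box ab.
  by apply: borel_measurable; exact: (measurableX mC mJ).
by rewrite (lebesgue_spacetime_box ab mJ eJ) mulr0.
Qed.

Lemma rect_ae_bx past Q s0 s1 s
    (A : set E := cube (rect_center Q) (rect_edge Q) `*` `[s0, s1[) :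
  s = (if past then - s1 else s0) ->
  ae_same A (bx (rect_corner Q) (rect_edge Q) s (s1 - s0) : set (S past)).
Proof.
move=> es; have L0 := rect_edge_gt0 Q.
have ab i : rect_corner Q i <= rect_corner Q i + rect_edge Q by rewrite lerDl ltW.
have eA : A = [set z : E | (forall i, rect_corner Q i <= st_X i z <
    rect_corner Q i + rect_edge Q) /\ `[s0, s1[%classic (z : n.-tuple R * R).2].
  apply/seteqP; split=> -[y u] [h1 h2]; split=> // i; have := h1 i;
    by rewrite /rect_corner /st_X /= => /andP[h3 h4]; apply/andP; split; lra.
have mA : measurable A.
  rewrite eA; have [mC _] := lebesgue_tuple_box ab.
  by apply: borel_measurable; apply: (measurableX mC); exact: measurable_itv.
have [N [mN N0 hN]] := null_slice s0 s1 ab.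
split=> //; first exact: (@measurable_bx R n (S past)).
exists N; split=> //; rewrite eA es; apply/seteqP; split=> z [[h1 h2] Nz]; split=> //;
  split=> //; move: h2; rewrite /= /st_T in_itv/=; case: (past) => /=.
- move=> /andP[h2 h3]; apply/andP; split; first by lra.
  rewrite lt_neqAle; apply/andP; split; last by lra.
  by apply: contra_notN Nz => /eqP h4; apply: hN => //; left; lra.
- by move=> /andP[h2 h3]; apply/andP; split; lra.
- move=> /andP[h2 h3]; apply/andP; split; first by lra.
  rewrite lt_neqAle; apply/andP; split; last by lra.
  by apply: contra_notN Nz => /eqP h4; apply: hN => //; right; lra.
- by move=> /andP[h2 h3]; apply/andP; split; lra.
Qed.

Lemma omE (l : R) : om l = l `^ p. Proof. by rewrite unlock. Qed.

Lemma early_ae past Q : ae_same (early past Q) (@ebox_early past Q).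
Proof.
rewrite /early /ebox_early /ebox /rect_start; case: past.
  rewrite /rect_plus (_ : rho _ = (rect_time Q + rect_edge Q `^ p) -
    (rect_time Q + gamma * rect_edge Q `^ p)); last by rewrite /rho omE; ring.
  by apply: rect_ae_bx; rewrite omE; ring.
rewrite /rect_minus (_ : rho _ = (rect_time Q - gamma * rect_edge Q `^ p) -
  (rect_time Q - rect_edge Q `^ p)); last by rewrite /rho omE; ring.
by apply: rect_ae_bx; rewrite omE.
Qed.

Lemma late_ae past Q : ae_same (late past Q) (@ebox_late past Q).
Proof.
rewrite /late /ebox_late /ebox /rect_start; case: past.
  rewrite /rect_minus (_ : rho _ = (rect_time Q - gamma * rect_edge Q `^ p) -
    (rect_time Q - rect_edge Q `^ p)); last by rewrite /rho omE; ring.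
  by apply: rect_ae_bx; rewrite /lag omE; ring.
rewrite /rect_plus (_ : rho _ = (rect_time Q + rect_edge Q `^ p) -
  (rect_time Q + gamma * rect_edge Q `^ p)); last by rewrite /rho omE; ring.
by apply: rect_ae_bx; rewrite /lag omE; ring.
Qed.

Lemma ae_same_mu A (B : set E) : ae_same A B -> mu A = mu B.
Proof.
move=> [mA mB [N [mN N0 AB]]].
have h C : measurable C -> mu C = mu (C `\` N).
  move=> mC; have := @ge0_negligible_integral _ _ _ mu C N (cst 1%E) mN mC.
  rewrite !integral_cst ?mul1e//; last exact: measurableD.
  by apply => //; exact: measurable_cst.
by rewrite (h A)// (h B)// AB.
Qed.

Lemma ae_same_integral A (B : set E) (g : E -> \bar R) : ae_same A B ->
  measurable_fun setT g -> (\int[mu]_(z in A) g z = \int[mu]_(z in B) g z)%E.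
Proof.
move=> [mA mB [N [mN N0 AB]]] mg.
have h (k : E -> \bar R) : measurable_fun setT k -> (forall z, (0 <= k z)%E) ->
    (\int[mu]_(z in A) k z = \int[mu]_(z in B) k z)%E.
  move=> mk k0; rewrite (ge0_negligible_integral mN mA)//; last exact: measurable_funTS.
  by rewrite AB -(ge0_negligible_integral mN mB)//; exact: measurable_funTS.
rewrite [LHS]integralE [RHS]integralE; congr (_ - _)%E.
- by apply: h => [|z]; [exact: measurable_funepos|exact: funepos_ge0].
- by apply: h => [|z]; [exact: measurable_funeneg|exact: funeneg_ge0].
Qed.

Lemma avg_integ past A (B : set (S past)) (g : E -> R) : ae_same A B ->
  bounded_measurable B -> 0 < vol B -> loc_integrable (S := S past) g ->
  avg A g = (integ B g / vol B)%:E.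
Proof.
move=> AB bB B0 lg; rewrite /avg (ae_same_mu AB).
have -> : mu B = (vol B)%:E by exact: (@mu_vol R n (S past)).
rewrite inver gt_eqF// (ae_same_integral AB).
  rewrite -[X in (_ * X)%E]/(\int[bs_mu (S past)]_(z in B) (g z)%:E)%E.
  by rewrite integral_integ// -EFinM mulrC.
by apply/measurable_EFinP; case: lg.
Qed.

End rectangles.

(** * Scaling, change of level, and oscillations over a rectangle *)

Section scaling.
Context {R : realType} {n : nat} {S : box_space R n}.
Local Notation E := (bs_type S).
Implicit Types (f : E -> R) (A : set E).

Lemma ep_scale f A (m c : R) : bounded_measurable A -> loc_integrable f -> 0 <= m ->
  ep (fun z => m * f z) A (m * c) = m * ep f A c.
Proof.
move=> bA lf m0; rewrite /ep -integZ//; last exact: loc_ep.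
by congr (integ A _); apply/funext => z; rewrite -mulrBr maxr_pMr// mulr0.
Qed.

Lemma emean_scale (p gamma : R) f a l s (m : R) : loc_integrable f ->
  emean p gamma (fun z => m * f z) a l s = m * emean p gamma f a l s.
Proof.
by move=> lf; rewrite !emeanE /mean_on integZ//; [rewrite mulrA|exact: bounded_ebox].
Qed.

Lemma mean_deficit f B (c : R) : bounded_measurable B -> 0 < vol B -> loc_integrable f ->
  c - mean_on f B <= integ B (fun z => Num.max (c - f z) 0) / vol B.
Proof.
move=> bB B0 lf; have lc : loc_integrable ((fun=> c) : E -> R) by exact: loc_integrable_cst.
rewrite ler_pdivlMr// mulrBl -mean_onK// -integ_cst// -integB//.
apply: integ_le => //; [exact: loc_integrableB|exact: loc_deficit|].
by move=> z _; rewrite le_max lexx.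
Qed.

Lemma ep_recenter f A (c c' y : R) : bounded_measurable A -> loc_integrable f -> 0 <= y ->
  c - c' <= y -> ep f A c' <= ep f A c + y * vol A.
Proof.
move=> bA lf y0 hy.
have lc : loc_integrable ((fun=> y) : E -> R) by exact: loc_integrable_cst.
rewrite -integ_cst// -integD//; last exact: loc_ep.
apply: integ_le => //; [exact: loc_ep|by apply: loc_integrableD => //; exact: loc_ep|].
move=> z _; have h3 : f z - c <= Num.max (f z - c) 0 by rewrite le_max lexx.
have h4 : 0 <= Num.max (f z - c) 0 by rewrite le_max lexx orbT.
by rewrite ge_max; apply/andP; split; lra.
Qed.

(** The mean over [B] falls below [c] by at most the average of [(c - f)_+] over [B]. This is the
    easy inequality between BMO^+ and PBMO^-, with constant 1. *)
Lemma ep_mean_le f A B c : bounded_measurable A -> bounded_measurable B -> 0 < vol B ->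
  vol A = vol B -> loc_integrable f ->
  ep f A (mean_on f B) <= ep f A c + integ B (fun z => Num.max (c - f z) 0).
Proof.
move=> bA bB B0 AB lf; set I := integ B _.
have I0 : 0 <= I by apply: integ_ge0 => z _; rewrite le_max lexx orbT.
have -> : I = I / vol B * vol A by rewrite AB divfK// gt_eqF.
apply: ep_recenter => //; first by rewrite divr_ge0// ltW.
exact: mean_deficit.
Qed.

Lemma lower_part_le_exp f (d c k : R) z : 0 < d ->
  lower_part f c k z <= d^-1 * expR (d * lower_part f c k z).
Proof.
move=> d0; rewrite ler_pdivlMl//; apply: le_trans (expR_ge1Dx _).
by rewrite lerDr.
Qed.

Lemma deficit_le_exp f A (d c b : R) : bounded_measurable A -> loc_integrable f -> 0 < d ->
  (forall k, loc_integrable (fun z => expR (d * lower_part f c k z))) ->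
  (forall k, 0 <= k -> integ A (fun z => expR (d * lower_part f c k z)) <= b) ->
  integ A (fun z => Num.max (c - f z) 0) <= d^-1 * b.
Proof.
move=> bA lf d0 lE hb; apply: integ_le_trunc => //; first exact: loc_deficit.
  by move=> z; rewrite le_max lexx orbT.
move=> k.
apply: le_trans (_ : integ A (fun z => d^-1 * expR (d * lower_part f c k%:R z)) <= _).
  apply: integ_le => //; [exact: loc_integrable_lower|exact: loc_integrableZ|].
  by move=> z _; exact: lower_part_le_exp.
by rewrite integZ// ler_pM2l ?invr_gt0//; exact: hb.
Qed.

Lemma core_osc (p gamma : R) : 1 < p -> 0 < gamma -> gamma < 1 -> (0 < n)%N ->
  exists2 C : R, 0 < C & forall f (M : R) a L s, loc_integrable f -> 0 < M ->
    bmo1 p gamma (fun z => M^-1 * f z) -> 0 < L -> exists c,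
    ep f (ebox p gamma a L s) c +
      integ (ebox p gamma a L (s + lag p gamma L)) (fun z => Num.max (c - f z) 0) <=
    C * M * (L ^+ n * rho p gamma L).
Proof.
move=> p1 g0 g1 n0; have [C [d [C0 d0 hcore]]] := core (S := S) p1 g0 g1 n0.
exists (2 + C + C / d); first by rewrite !addr_gt0// divr_gt0.
move=> f M a L s lf M0 bg L0; have [lg _] := bg.
set g := (fun z => M^-1 * f z) in bg lg *.
have fg z : f z = M * g z by rewrite /g mulrA mulfV ?mul1r// gt_eqF.
have [c [hearly hlate]] := hcore g a L (s + om p L) bg L0.
rewrite addrK -/(ebox p gamma a L s) in hearly.
have el : bx a L (s + om p L + gamma * om p L) (rho p gamma L) =
    ebox p gamma a L (s + lag p gamma L) :> set E.
  by rewrite /ebox /lag mulrDl mul1r addrA.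
rewrite el in hlate; set v := L ^+ n * rho p gamma L in hearly hlate *.
have v0 : 0 < v by rewrite mulr_gt0 ?exprn_gt0 ?rho_gt0.
set A := ebox p gamma a L s in hearly *.
set B := ebox p gamma a L (s + lag p gamma L) in hlate *.
have bA : bounded_measurable A by exact: bounded_ebox.
have bB : bounded_measurable B by exact: bounded_ebox.
have vA : vol A = v by rewrite vol_ebox.
(* [core] with [W = (g - c - C)_+] and [Z = 1]: where the later mean is at most [c + C], the
   normalisation bounds the integral of [W] by the volume. Returning to the level [c] adds [C]. *)
have h1 : ep g A c <= (2 + C) * v.
  apply: le_trans (@ep_recenter g A (c + C) c C bA lg (ltW C0) _) _.
    by rewrite addrC addKr.
  rewrite vA mulrDl lerD2r -[2]mulr1; apply: hearly => //; first exact: loc_ep.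
    by move=> z; rewrite le_max lexx orbT.
  move=> b l s' l0 hb; rewrite mul1r -(@vol_ebox R n S p gamma g1 b l s' l0).
  by apply: (ep_ebox bg) => //; exact: measurable_bx.
have h2 : integ B (fun z => Num.max (c - g z) 0) <= d^-1 * (C * v).
  apply: deficit_le_exp => // k; apply: (loc_exp_lower bg); exact: ltW.
exists (M * c).
have -> : ep f A (M * c) = M * ep g A c.
  by rewrite -ep_scale// ?(ltW M0)//; congr ep; apply/funext.
have -> : integ B (fun z => Num.max (M * c - f z) 0) =
    M * integ B (fun z => Num.max (c - g z) 0).
  rewrite -integZ//; last exact: loc_deficit.
  by congr (integ _ _); apply/funext => z; rewrite fg -mulrBr maxr_pMr ?mulr0// ltW.
rewrite -mulrDr [_ * M]mulrC -mulrA ler_pM2l//.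
apply: le_trans (lerD h1 h2) _; rewrite [d^-1 * _]mulrA [d^-1 * C]mulrC -mulrDl lexx//.
Qed.

End scaling.

(** * The spaces of bounded mean oscillation *)

Section bmo.
Context {R : realType} {n : nat}.
Hypothesis n_gt0 : (0 < n)%N.
Variables (p gamma : R).
Hypotheses (p_gt1 : 1 < p) (gamma_gt0 : 0 < gamma) (gamma_lt1 : gamma < 1).
Local Notation E := (spacetime R n).
Local Notation S := (st_box_space R n).
Local Notation om := (om p).
Local Notation lag := (lag p gamma).
Local Notation rho := (rho p gamma).
Local Notation rect := (@parabolic_rectangle R n).
Local Notation early := (@early R n p gamma).
Local Notation late := (@late R n p gamma).
Local Notation ebox_early := (@ebox_early R n p gamma).
Local Notation ebox_late := (@ebox_late R n p gamma).
Implicit Types (f g : E -> R) (Q : rect).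

Lemma ex_rect past (a : 'I_n -> R) l s : 0 < l -> exists Q : rect,
  [/\ rect_corner Q = a, rect_edge Q = l & rect_start p past Q = s].
Proof.
move=> l0.
exists (ParabolicRectangle [tuple a i + l / 2 | i < n]
  (if past then - (s + om l) else s + om l) l0); split=> //=.
  by apply/funext => i; rewrite /rect_corner /= tnth_mktuple addrK.
by rewrite /rect_start /=; case: past; rewrite ?opprK addrK.
Qed.

Lemma bounded_early past Q : bounded_measurable (@ebox_early past Q).
Proof. exact: bounded_ebox. Qed.

Lemma bounded_late past Q : bounded_measurable (@ebox_late past Q).
Proof. exact: bounded_ebox. Qed.

Lemma vol_early past Q :
  vol (@ebox_early past Q) = rect_edge Q ^+ n * rho (rect_edge Q).
Proof. by rewrite vol_ebox//; exact: rect_edge_gt0. Qed.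

Lemma vol_late past Q :
  vol (@ebox_late past Q) = rect_edge Q ^+ n * rho (rect_edge Q).
Proof. by rewrite vol_ebox//; exact: rect_edge_gt0. Qed.

Lemma rect_vol_gt0 Q : 0 < rect_edge Q ^+ n * rho (rect_edge Q).
Proof. by have h := rect_edge_gt0 Q; rewrite mulr_gt0 ?exprn_gt0 ?rho_gt0. Qed.

Lemma mean_late past Q f : L1loc f -> mean (late past Q) f =
  emean p gamma (S := S past) f (rect_corner Q) (rect_edge Q)
    (rect_start p past Q + lag (rect_edge Q)).
Proof.
move=> lf; rewrite /mean (@avg_integ R n past _ (@ebox_late past Q)).
- by rewrite emeanE.
- exact: late_ae.
- exact: bounded_late.
- by rewrite vol_late rect_vol_gt0.
- exact: L1loc_integrable.
Qed.

Lemma avg_early_pos past Q f c : L1loc f -> avg (early past Q) (f \- cst c)^\+ =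
  (ep (S := S past) f (ebox_early Q) c / (rect_edge Q ^+ n * rho (rect_edge Q)))%:E.
Proof.
move=> /(L1loc_integrable past) lf; rewrite -(vol_early past Q).
apply: avg_integ; [exact: early_ae|exact: bounded_early| |].
  by rewrite vol_early rect_vol_gt0.
exact: loc_ep.
Qed.

Lemma avg_late_neg past Q f c : L1loc f -> avg (late past Q) (f \- cst c)^\- =
  (integ (S := S past) (ebox_late Q) (fun z => Num.max (c - f z) 0) /
    (rect_edge Q ^+ n * rho (rect_edge Q)))%:E.
Proof.
move=> /(L1loc_integrable past) lf; rewrite -(vol_late past Q).
have -> : (f \- cst c)^\- = fun z => Num.max (c - f z) 0.
  by apply/funext => z; rewrite /funrneg /= opprB.
apply: avg_integ; [exact: late_ae|exact: bounded_late| |].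
  by rewrite vol_late rect_vol_gt0.
exact: loc_deficit.
Qed.

Definition bmo_norm past f : \bar R := sup_rect (fun Q =>
  avg (early past Q) (f \- cst (mean (late past Q) f))^\+).

Definition osc past f c Q : \bar R :=
  (avg (early past Q) ((f \- cst c)^\+)%R + avg (late past Q) ((f \- cst c)^\-)%R)%E.

Lemma bmo_norm_bmo1 past f (M : R) : L1loc f -> 0 < M -> (bmo_norm past f <= M%:E)%E ->
  bmo1 p gamma (S := S past) (fun z => M^-1 * f z).
Proof.
move=> Lf M0 hM; have lf := L1loc_integrable past Lf.
split; first exact: loc_integrableZ.
move=> a l s l0; have [Q [ea el es]] := ex_rect past a s l0.
have : (avg (early past Q) ((f \- cst (mean (late past Q) f))^\+)%R <= M%:E)%E.
  by apply: le_trans hM; apply: ereal_sup_ubound; exists Q.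
rewrite avg_early_pos// mean_late// lee_fin ler_pdivrMr ?rect_vol_gt0//.
rewrite /ebox_early ea el es => h; rewrite emean_scale// ep_scale//; last first.
- by rewrite invr_ge0 ltW.
- exact: bounded_ebox.
by rewrite mulrC ler_pdivrMr// vol_ebox// mulrC.
Qed.

Lemma osc_le past : exists2 C : R, 0 < C & forall f (M : R) Q, L1loc f -> 0 < M ->
  (bmo_norm past f <= M%:E)%E -> exists c, (osc past f c Q <= (C * M)%:E)%E.
Proof.
have [C C0 hcore] := core_osc (S := S past) p_gt1 gamma_gt0 gamma_lt1 n_gt0.
exists C => // f M Q Lf M0 hM.
have [c hc] := hcore f M (rect_corner Q) (rect_edge Q) (rect_start p past Q)
  (L1loc_integrable past Lf) M0 (bmo_norm_bmo1 Lf M0 hM) (rect_edge_gt0 Q).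
exists c; rewrite /osc (avg_early_pos past Q c Lf) (avg_late_neg past Q c Lf).
rewrite -EFinD lee_fin -mulrDl ler_pdivrMr; last exact: rect_vol_gt0.
exact: hc.
Qed.

Lemma early_le_osc past f c Q : L1loc f ->
  (avg (early past Q) ((f \- cst (mean (late past Q) f))^\+)%R <= osc past f c Q)%E.
Proof.
move=> Lf; rewrite /osc !(avg_early_pos past Q _ Lf) (avg_late_neg past Q c Lf).
rewrite -EFinD lee_fin (mean_late past Q Lf) -mulrDl ler_pM2r; last first.
  by rewrite invr_gt0; exact: rect_vol_gt0.
rewrite emeanE; apply: ep_mean_le.
- exact: bounded_early.
- exact: bounded_late.
- by rewrite vol_late; exact: rect_vol_gt0.
- by rewrite vol_early vol_late.
- exact: L1loc_integrable.
Qed.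

(* Since [PBMO^-] is stable under [f |-> - f] combined with time reversal, each of
   the two one-sided spaces is compared with it separately. *)
Definition signed past f : E -> R := if past then \- f else f.

Lemma L1loc_opp f : L1loc f -> L1loc (\- f).
Proof.
move=> [mf hf]; split; first exact: measurableT_comp.
by move=> K /hf; under eq_integral do rewrite -normrN.
Qed.

Lemma L1loc_signed past f : L1loc f -> L1loc (signed past f).
Proof. by rewrite /signed; case: past => [|//]; exact: L1loc_opp. Qed.

Lemma osc_signed past f c Q : osc past (signed past f) c Q =
  osc false f (if past then - c else c) Q.
Proof.
rewrite /osc /signed /early /late; case: past; last by [].
have -> : ((\- f \- cst c)^\+)%R = ((f \- cst (- c))^\-)%R.
  by apply/funext => z; rewrite /funrneg /funrpos /=; congr (Num.max _ 0); ring.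
have -> : ((\- f \- cst c)^\-)%R = ((f \- cst (- c))^\+)%R.
  by apply/funext => z; rewrite /funrneg /funrpos /=; congr (Num.max _ 0); ring.
exact: addeC.
Qed.

Lemma bmo_norm_le_PBMO past f : L1loc f ->
  (bmo_norm past (signed past f) <= PBMO_minus_norm p gamma f)%E.
Proof.
move=> /(L1loc_signed past) Lf; apply: ge_ereal_sup => _ [Q _ <-].
apply: le_trans (ereal_sup_ubound _); last by exists Q.
apply: le_ereal_inf_tmp => _ [c _ <-].
have := @early_le_osc past _ (if past then - c else c) Q Lf; rewrite osc_signed.
by case: past Lf => Lf; rewrite ?opprK.
Qed.

Lemma PBMO_le_bmo_norm past : exists2 C : R, 0 < C & forall f, L1loc f ->
  (PBMO_minus_norm p gamma f <= C%:E * bmo_norm past (signed past f))%E.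
Proof.
have [C C0 hC] := osc_le past; exists C => // f /(L1loc_signed past) Lf.
have [Q0 _] := ex_rect past (fun=> 0) 0 (@ltr01 R).
have N0 : (0 <= bmo_norm past (signed past f))%E.
  apply: le_trans (ereal_sup_ubound _); last by exists Q0.
  by rewrite avg_early_pos// lee_fin divr_ge0 ?ep_ge0// ltW// rect_vol_gt0.
move: (erefl (bmo_norm past (signed past f))) N0.
case: {2 3}(bmo_norm _ _) => [r| |]// er; last first.
  by move=> _; rewrite er gt0_muley ?lte_fin// leey.
rewrite er lee_fin => r0; apply/lee_addgt0Pr => e e0.
apply: ge_ereal_sup => _ [Q _ <-].
(* [osc_le] divides by the bound on the norm, and [r] may be zero; the slack [e / C] keeps the bound
   positive and contributes only [e]. *)
have [||c hc] := hC _ (r + e / C) Q Lf.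
- by rewrite ltr_wpDl// divr_gt0.
- by rewrite er lee_fin lerDl divr_ge0 ?ltW.
rewrite osc_signed mulrDr [C * (e / C)]mulrC divfK ?gt_eqF// in hc.
apply: ge_ereal_inf; exists (osc false f (if past then - c else c) Q) => //.
Qed.

End bmo.

(** * Exponentials of functions of bounded mean oscillation *)

Section exponentials.
Context {R : realType} {n : nat} {S : box_space R n}.
Variables (p gamma : R).
Hypotheses (p_gt1 : 1 < p) (gamma_gt0 : 0 < gamma) (gamma_lt1 : gamma < 1).
Hypothesis n_gt0 : (0 < n)%N.
Local Notation E := (bs_type S).
Local Notation lag := (lag p gamma).
Local Notation rho := (rho p gamma).
Local Notation ebox := (@ebox R n S p gamma).
Local Notation emean := (@emean R n S p gamma).
Local Notation bmo1 := (@bmo1 R n S p gamma).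
Implicit Types (f : E -> R) (A : set E).

Lemma integ_exp_gt0 f A : bounded_measurable A -> 0 < vol A ->
  loc_integrable (fun z => expR (f z)) -> 0 < integ A (fun z => expR (f z)).
Proof.
move=> bA A0 le; have [mA _] := bA; have [me _] := le.
rewrite lt_neqAle integ_ge0 ?andbT; last by move=> z _; exact: expR_ge0.
apply/eqP => i0; move: A0; rewrite vol_fine// (_ : bs_mu S A = 0%E) ?ltxx//.
have : (\int[bs_mu S]_(z in A) `|(expR (f z))%:E| = 0)%E.
  rewrite (eq_integral (fun z => (expR (f z))%:E)); last first.
    by move=> z _; rewrite gee0_abs ?lee_fin ?expR_ge0.
  by rewrite integral_integ// -i0.
have mE : measurable_fun A (fun z => (expR (f z))%:E).
  by apply/measurable_EFinP; exact: measurable_funTS.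
move/(ae_eq_integral_abs (bs_mu S) mA mE) => [N [mN N0 hN]].
apply/eqP; rewrite -measure_le0 -N0; apply: le_measure; rewrite ?inE//.
move=> z Az; apply: hN => /(_ Az) /eqP; rewrite eqe.
by rewrite gt_eqF ?expR_gt0.
Qed.

(** Integrates [1 + y <= expR y] for [y = c * (f - m)], where [m] is the mean of [f], so that the
    linear term vanishes. *)
Lemma exp_jensen f A c : bounded_measurable A -> 0 < vol A -> loc_integrable f ->
  loc_integrable (fun z => expR (c * f z)) ->
  expR (c * mean_on f A) <= integ A (fun z => expR (c * f z)) / vol A.
Proof.
move=> bA A0 lf le; rewrite ler_pdivlMr//; set m := mean_on f A.
have lc (b : R) : loc_integrable ((fun=> b) : E -> R) by exact: loc_integrable_cst.
have -> : expR (c * m) * vol A =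
    integ A (fun z => expR (c * m) * (1 + (c * f z + - (c * m)))).
  have lcf : loc_integrable (fun z => c * f z + - (c * m)).
    by apply: loc_integrableD => //; exact: loc_integrableZ.
  rewrite integZ//; last by apply: loc_integrableD.
  rewrite integD// integD//; last exact: loc_integrableZ.
  rewrite integZ// !integ_cst// mean_onK// -/m; congr (_ * _); ring.
apply: integ_le => //.
  apply: loc_integrableZ; apply: loc_integrableD => //; apply: loc_integrableD => //.
  exact: loc_integrableZ.
move=> z _; have -> : c * f z = c * m + (c * f z + - (c * m)) by ring.
rewrite expRD ler_pM2l ?expR_gt0//; have -> : c * m + (c * f z + - (c * m)) + - (c * m) =
  c * f z + - (c * m) by ring.
exact: expR_ge1Dx.
Qed.

(** [(f - m)_+ <= expR (f - m)], and the hypothesis bounds the average of the right side by [K] when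
    [m] is the later mean. *)
Lemma bmo1_of_exp f (K : R) : 0 < K -> loc_integrable f ->
  loc_integrable (fun z => expR (f z)) ->
  (forall a l s, 0 < l -> integ (ebox a l s) (fun z => expR (f z)) <=
     K * expR (emean f a l (s + lag l)) * vol (ebox a l s)) ->
  bmo1 (fun z => K^-1 * f z).
Proof.
move=> K0 lf le hK; split; first exact: loc_integrableZ.
move=> a l s l0; have bA := bounded_ebox p gamma (S := S) a l s.
rewrite emean_scale// ep_scale// ?invr_ge0 ?(ltW K0)//.
rewrite ler_pdivrMl//; set m := emean _ _ _ _.
apply: le_trans (_ : integ (ebox a l s) (fun z => expR (- m) * expR (f z)) <= _).
  apply: integ_le => //; [exact: loc_ep|exact: loc_integrableZ|].
  move=> z _; rewrite -expRD ge_max expR_ge0 andbT addrC.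
  by apply: le_trans (expR_ge1Dx _); rewrite lerDr.
rewrite integZ// -ler_pdivlMl ?expR_gt0// expRN invrK mulrCA [expR m * _]mulrC mulrA.
by apply: le_trans (hK a l s l0) _; rewrite -/m mulrAC.
Qed.

(** The truncation level is chosen so that [d] times it is [k * expR (d * c)]: where the lower part
    is cut off, its exponential already exceeds what [k] requires. *)
Lemma min_exp_le f (d c k : R) z : 0 < d -> 0 <= k ->
  Num.min (expR (- d * f z)) k <=
  expR (- (d * c)) * expR (d * lower_part f c (k * expR (d * c) / d) z).
Proof.
move=> d0 k0; rewrite -expRD; set k' := k * _ / d.
have k'0 : 0 <= k' by rewrite divr_ge0 ?mulr_ge0 ?expR_ge0// ltW.
rewrite /lower_part; have [h|h] := leP (Num.max (c - f z) 0) k'.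
  rewrite ge_min ler_expR; apply/orP; left.
  have : d * (c - f z) <= d * Num.max (c - f z) 0.
    by rewrite ler_pM2l// le_max lexx.
  by lra.
rewrite ge_min; apply/orP; right; rewrite expRD expRN ler_pdivlMl ?expR_gt0//.
rewrite mulrC; apply: le_trans (expR_ge1Dx _).
by rewrite /k' mulrCA mulfV ?gt_eqF// mulr1 lerDr.
Qed.

(** With [g = f / K], the exponent [r = 1 + K / d] gives [f / (1 - r) = - d * g]. The level [c] then
    cancels in the product, since [expR (K * c) * expR (- (d * c)) ^ (K / d) = 1]. *)
Lemma core_exp (K : R) : 0 < K -> exists r C : R, [/\ 1 < r, 0 < C &
  forall f, loc_integrable f -> loc_integrable (fun z => expR (f z)) ->
  (forall a l s, 0 < l -> integ (ebox a l s) (fun z => expR (f z)) <=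
     K * expR (emean f a l (s + lag l)) * vol (ebox a l s)) ->
  forall a L s, 0 < L -> exists x y : R, [/\
    0 <= x, 0 <= y, x * y `^ (r - 1) <= C,
    integ (ebox a L s) (fun z => expR (f z)) <= x * (L ^+ n * rho L) &
    (\int[bs_mu S]_(z in ebox a L (s + lag L)) (expR (1 / (1 - r) * f z))%:E <=
      (y * (L ^+ n * rho L))%:E)%E]].
Proof.
move=> K0; have [C [d [C0 d0 hcore]]] := core (S := S) p_gt1 gamma_gt0 gamma_lt1 n_gt0.
exists (1 + K / d), (2 * K * expR (K * C) * C `^ (K / d)); split.
- by rewrite ltrDl divr_gt0.
- by rewrite !mulr_gt0// ?expR_gt0// powR_gt0.
move=> f lf lE hK a L s L0; have bg := bmo1_of_exp K0 lf lE hK.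
have [lg _] := bg; set g := (fun z => K^-1 * f z) in bg lg.
have [c [hearly hlate]] := hcore g a L (s + om p L) bg L0.
rewrite addrK -/(ebox a L s) in hearly.
have el : bx a L (s + om p L + gamma * om p L) (rho L) = ebox a L (s + lag L).
  by rewrite /ebox /lag mulrDl mul1r addrA.
rewrite el in hlate; set v := L ^+ n * rho L in hearly hlate *.
have v0 : 0 < v by rewrite mulr_gt0 ?exprn_gt0 ?rho_gt0.
exists (2 * (K * expR (K * (c + C)))), (expR (- (d * c)) * C); split.
- by rewrite !mulr_ge0 ?expR_ge0// ltW.
- by rewrite mulr_ge0 ?expR_ge0// ltW.
- rewrite [1 + _]addrC addrK powRM ?expR_ge0 ?(ltW C0)// -[expR (- (d * c)) `^ _]expRM.
  rewrite (_ : - (d * c) * (K / d) = - (K * c)); last first.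
    by field; rewrite gt_eqF.
  have e : expR (K * (c + C)) * expR (- (K * c)) = expR (K * C).
    by rewrite -expRD; congr expR; ring.
  by rewrite -e le_eqVlt; apply/orP; left; apply/eqP; ring.
- apply: hearly => //.
    by rewrite mulr_ge0 ?expR_ge0// ltW.
  move=> b l s' l0 hb; apply: le_trans (hK b l s' l0) _.
  rewrite (@vol_ebox R n S p gamma gamma_lt1 b l s' l0).
  rewrite ler_pM2r; last by rewrite mulr_gt0 ?exprn_gt0 ?rho_gt0.
  rewrite ler_pM2l// ler_expR.
  by move: hb; rewrite emean_scale// mulrC ler_pdivrMr// mulrC.
have bB : bounded_measurable (ebox a L (s + lag L)) by exact: bounded_ebox.
have eg z : 1 / (1 - (1 + K / d)) * f z = - d * g z.
  rewrite /g opprD addrA subrr sub0r mulrA; congr (_ * _).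
  by rewrite mul1r invrN invf_div mulNr.
have [mf _] := lf; have [mB _] := bB.
have mE : measurable_fun setT (fun z => expR (1 / (1 - (1 + K / d)) * f z)).
  by apply: measurableT_comp => //; exact: measurable_funM.
apply: ge0_integral_le_trunc => //.
  exact: measurable_funTS.
move=> k; have lk : loc_integrable (fun z =>
    Num.min (expR (1 / (1 - (1 + K / d)) * f z)) k%:R).
  apply: (@loc_integrable_le _ _ _ _ (fun=> k%:R)).
  - exact: measurable_minr.
  - exact: loc_integrable_cst.
  - move=> z; rewrite ger0_norm; first by rewrite ge_min lexx orbT.
    by rewrite le_min expR_ge0/=.
rewrite integral_integ// lee_fin -mulrA.
set k' := k%:R * expR (d * c) / d.
have k'0 : 0 <= k' by rewrite divr_ge0 ?mulr_ge0 ?expR_ge0// ltW.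
have lE' : loc_integrable (fun z => expR (d * lower_part g c k' z)).
  by apply: (loc_exp_lower bg); exact: ltW.
apply: le_trans (_ : integ (ebox a L (s + lag L)) (fun z => expR (- (d * c)) *
    expR (d * lower_part g c k' z)) <= _).
  apply: integ_le => //; first exact: loc_integrableZ.
  by move=> z _; rewrite eg; exact: min_exp_le.
by rewrite integZ// ler_pM2l ?expR_gt0//; exact: hlate.
Qed.

End exponentials.

(** * Weights *)

Section weights.
Context {R : realType} {n : nat} {S : box_space R n}.
Hypothesis n_gt0 : (0 < n)%N.
Variables (p gamma : R).
Hypotheses (p_gt1 : 1 < p) (gamma_gt0 : 0 < gamma) (gamma_lt1 : gamma < 1).
Local Notation E := (bs_type S).
Local Notation mu := (bs_mu S).
Local Notation om := (om p).
Local Notation lag := (lag p gamma).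
Local Notation rho := (rho p gamma).
Local Notation ebox := (@ebox R n S p gamma).
Local Notation emean := (@emean R n S p gamma).
Implicit Types (f g w : E -> R) (a : 'I_n -> R).

Definition mavg (A : set E) (g : E -> R) : \bar R :=
  ((mu A)^-1 * \int[mu]_(z in A) (g z)%:E)%E.

Lemma mavg_ae A g h : measurable A -> measurable_fun setT g ->
  measurable_fun setT h -> {ae mu, forall z, g z = h z} -> mavg A g = mavg A h.
Proof.
move=> mA mg mh gh; congr (_ * _)%E; apply: ae_eq_integral => //.
- by apply/measurable_EFinP; exact: measurable_funTS.
- by apply/measurable_EFinP; exact: measurable_funTS.
- by apply: filterS gh => z /= -> _.
Qed.

Lemma mavgE A g : bounded_measurable A -> 0 < vol A ->
  mavg A g = ((vol A)^-1%:E * \int[mu]_(z in A) (g z)%:E)%E.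
Proof. by move=> bA A0; rewrite /mavg mu_vol// inver gt_eqF. Qed.

Lemma mavg_integ A g : bounded_measurable A -> 0 < vol A -> loc_integrable g ->
  mavg A g = (integ A g / vol A)%:E.
Proof. by move=> bA A0 lg; rewrite mavgE// integral_integ// -EFinM mulrC. Qed.

(** Carries integrability from late halves to all boxes. The edge is taken at least 1 so that
    [L <= om L], and thus the duration also becomes as large as needed. *)
Lemma ex_late_cover a l s t : exists b L v, 0 < L /\
  (bx a l s t : set E) `<=` ebox b L (v + lag L).
Proof.
have gg0 := gamma_gt0; have gg1 : 0 < 1 - gamma by rewrite subr_gt0.
pose L := Num.max 1 (Num.max l (t / (1 - gamma))).
have L1 : 1 <= L by rewrite le_max lexx.
have L0 : 0 < L by exact: lt_le_trans L1.
have Ll : l <= L by rewrite !le_max lexx !orbT.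
have Lt : t <= rho L.
  rewrite /rho -ler_pdivrMl// mulrC; apply: le_trans (_ : L <= _).
    by rewrite !le_max lexx !orbT.
  rewrite unlock -[leLHS](powRr1 (ltW L0)); apply: ler_powR => //; exact: ltW.
exists a, L, (s - lag L); split=> //; rewrite subrK => z [h1 /andP[h2 h3]]; split.
  by move=> i; have /andP[-> /= h4] := h1 i; apply: lt_le_trans h4 _; rewrite lerD2l.
by rewrite h2/=; apply: lt_le_trans h3 _; rewrite lerD2l.
Qed.

Lemma loc_integrable_late g : measurable_fun setT g ->
  (forall a L s, 0 < L -> mu.-integrable (ebox a L (s + lag L)) (EFin \o g)) ->
  loc_integrable g.
Proof.
move=> mg hg; split=> // a l s t; have [b [L [v [L0 hQ]]]] := ex_late_cover a l s t.
by apply: integrableS (hg b L v L0) => //; exact: measurable_bx.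
Qed.

Lemma integrable_late_of_lty g a L s : 0 < L -> measurable_fun setT g ->
  (forall z, 0 <= g z) -> (mavg (ebox a L s) g < +oo)%E ->
  mu.-integrable (ebox a L s) (EFin \o g).
Proof.
move=> L0 mg g0; have bA := bounded_ebox p gamma (S := S) a L s.
have A0 : 0 < vol (ebox a L s) by exact: vol_ebox_gt0.
rewrite mavgE// => h; apply/integrableP; split.
  by apply/measurable_EFinP; exact: measurable_funTS.
rewrite (eq_integral (fun z => (g z)%:E)); last by move=> z _; rewrite gee0_abs// lee_fin.
rewrite ltey; apply/eqP => e; move: h; rewrite e gt0_muley ?ltxx//.
by rewrite lte_fin invr_gt0.
Qed.

Section one_weight.
Variable w : E -> R.
Hypothesis lw : loc_integrable w.
Hypothesis w_ge0 : forall z, 0 <= w z.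
Hypothesis w_gt0 : {ae mu, forall z, 0 < w z}.
Let f z := ln (w z).

Let mw : measurable_fun setT w. Proof. by case: lw. Qed.
Let mf : measurable_fun setT f.
Proof. exact: measurableT_comp (@measurable_ln R) mw. Qed.

Lemma measurable_exp_ln (c : R) : measurable_fun setT (fun z => expR (c * f z)).
Proof. by apply: measurableT_comp => //; exact: measurable_funM. Qed.

Lemma measurable_weight_pow (c : R) : measurable_fun setT (fun z => w z `^ c)%R.
Proof. exact: (measurableT_comp (@measurable_powR R c) mw). Qed.

Lemma weight_inv : (fun z => 1 / w z) = (fun z => w z `^ (-1))%R.
Proof. by apply/funext => z; rewrite powR_inv1// div1r. Qed.

Lemma measurable_weight_ln : measurable_fun setT (fun z => ln (1 / w z)).
Proof.
have h := measurable_weight_pow (-1); rewrite -weight_inv in h.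
exact: (measurableT_comp (@measurable_ln R) h).
Qed.

Lemma weight_exp : {ae mu, forall z, w z = expR (f z)}.
Proof. by apply: filterS w_gt0 => z w0; rewrite /f lnK. Qed.

Lemma weight_pow (c : R) : {ae mu, forall z, (w z `^ c)%R = expR (c * f z)}.
Proof. by apply: filterS w_gt0 => z w0; rewrite /powR gt_eqF. Qed.

Lemma weight_ln : {ae mu, forall z, ln (1 / w z) = - f z}.
Proof. by apply: filterS w_gt0 => z w0; rewrite div1r lnV. Qed.

Lemma loc_integrable_weight : loc_integrable (fun z => expR (f z)).
Proof.
have mE : measurable_fun setT (fun z => expR (f z)) by exact: measurableT_comp.
split=> // a l s t; have [_ /(_ a l s t) /integrableP[_ iw]] := lw.
apply/integrableP; split; first by apply/measurable_EFinP; exact: measurable_funTS.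
rewrite (_ : integral _ _ _ = (\int[mu]_(z in bx a l s t) `|(EFin \o w) z|)%E)//.
apply: ae_eq_integral.
- exact: measurable_bx.
- by apply: measurableT_comp => //; apply/measurable_EFinP; exact: measurable_funTS.
- by apply: measurableT_comp => //; apply/measurable_EFinP; exact: measurable_funTS.
- by apply: filterS weight_exp => z /= -> _.
Qed.

Lemma mavg_weight A : bounded_measurable A -> 0 < vol A ->
  mavg A w = (integ A (fun z => expR (f z)) / vol A)%:E /\
  0 < integ A (fun z => expR (f z)) / vol A.
Proof.
move=> bA A0; have lE := loc_integrable_weight; split.
  rewrite -mavg_integ//; apply: mavg_ae; [by case: bA|exact: mw|by case: lE|].
  exact: weight_exp.
by rewrite divr_gt0//; exact: integ_exp_gt0.
Qed.

(** Almost everywhere [|ln w| <= w + w^c / (- c)], by [1 + y <= expR y] at [y = ln w] and at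
    [y = c * ln w]. *)
Lemma loc_ln_of_neg_exp (c : R) : c < 0 ->
  (forall a L s, 0 < L ->
     (mavg (ebox a L (s + lag L)) (fun z => w z `^ c)%R < +oo)%E) ->
  loc_integrable (fun z => expR (c * f z)) /\ loc_integrable f.
Proof.
move=> c0 h; have mE := measurable_exp_ln c.
have lE : loc_integrable (fun z => expR (c * f z)).
  apply: loc_integrable_late => // a L s L0; apply: integrable_late_of_lty => //.
  rewrite -(mavg_ae _ (measurable_weight_pow c) mE (weight_pow c)); first exact: h.
  exact: measurable_bx.
split=> //; apply: (@loc_integrable_le _ _ _ _
  (fun z => expR (f z) + (- c)^-1 * expR (c * f z))) => //.
  by apply: loc_integrableD; [exact: loc_integrable_weight|exact: loc_integrableZ].
move=> z; have nc : 0 < - c by rewrite oppr_gt0.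
have h1 := expR_ge1Dx (f z); have h2 := expR_ge1Dx (c * f z).
have e0 := expR_ge0 (f z).
have h3 : - f z <= (- c)^-1 * expR (c * f z).
  by rewrite ler_pdivlMl// mulrNN; lra.
have e1 : 0 <= (- c)^-1 * expR (c * f z) by rewrite mulr_ge0 ?expR_ge0// invr_ge0 ltW.
by rewrite ler_norml; apply/andP; split; lra.
Qed.

Lemma mavg_ln A : bounded_measurable A -> 0 < vol A -> loc_integrable f ->
  mavg A (fun z => ln (1 / w z)) = (- mean_on f A)%:E.
Proof.
move=> bA A0 lf; have mN : measurable_fun setT (fun z => - f z) by exact: measurableT_comp.
rewrite (mavg_ae _ measurable_weight_ln mN weight_ln); last by case: bA.
rewrite mavg_integ//; last exact: loc_integrableN.
rewrite /mean_on -mulNr -mulN1r -integZ//; congr (integ _ _ / _)%:E.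
by apply/funext => z; rewrite mulN1r.
Qed.

(** The positive part of [ln w] is at most [w]. If the negative part had an infinite integral over a
    late half, the exponential factor would be infinite and so would the product, the mean of [w]
    being positive. *)
Lemma loc_ln_of_ln (K : R) :
  (forall a L s, 0 < L -> (mavg (ebox a L s) w *
     expeR (mavg (ebox a L (s + lag L)) (fun z => ln (1 / w z))) <= K%:E)%E) ->
  loc_integrable f.
Proof.
move=> hK; apply: loc_integrable_late => // a L s L0.
have bA := bounded_ebox p gamma (S := S) a L s.
have bB := bounded_ebox p gamma (S := S) a L (s + lag L).
have A0 : 0 < vol (ebox a L s) by exact: vol_ebox_gt0.
have B0 : 0 < vol (ebox a L (s + lag L)) by exact: vol_ebox_gt0.
set B := ebox a L (s + lag L) in bB B0 *; have [mB _] := bB.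
have [ew w0] := mavg_weight bA A0.
have := hK a L s L0; rewrite ew -/B; set x := _ / _ in w0 * => h.
have mN : measurable_fun setT (fun z => - f z) by exact: measurableT_comp.
rewrite (mavg_ae mB measurable_weight_ln mN weight_ln) mavgE// in h.
have hlt : (\int[mu]_(z in B) (- f z)%:E < +oo)%E.
  rewrite ltey; apply/eqP => e; move: h; rewrite e gt0_muley ?lte_fin ?invr_gt0//=.
  by rewrite gt0_muley ?lte_fin.
have mfB : measurable_fun B (EFin \o f) by apply/measurable_EFinP; exact: measurable_funTS.
have iE := loc_integrable_on bB loc_integrable_weight.
have ip : mu.-integrable B (fun z => (Num.max (f z) 0)%:E).
  apply: (le_integrable mB _ _ iE).
    by apply/measurable_EFinP; apply: measurable_maxr => //; exact: measurable_funTS.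
  move=> z _ /=; rewrite lee_fin !ger0_norm ?expR_ge0 ?le_max ?lexx ?orbT//.
  rewrite ge_max expR_ge0 andbT; apply: le_trans (expR_ge1Dx _); by rewrite lerDr.
have in_ : mu.-integrable B (fun z => (Num.max (- f z) 0)%:E).
  apply/integrableP; split.
    by apply/measurable_EFinP; apply: measurable_maxr => //; exact: measurable_funTS.
  rewrite (eq_integral (fun z => (Num.max (- f z) 0)%:E)); last first.
    by move=> z _; rewrite gee0_abs// lee_fin le_max lexx orbT.
  move: hlt; rewrite integralE.
  have -> : (\int[mu]_(z in B) (fun z => (- f z)%:E)^\+ z =
      \int[mu]_(z in B) (Num.max (- f z) 0)%:E)%E.
    by apply: eq_integral => z _; rewrite funeposE EFin_max.
  have -> : (\int[mu]_(z in B) (fun z => (- f z)%:E)^\- z =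
      \int[mu]_(z in B) (Num.max (f z) 0)%:E)%E.
    by apply: eq_integral => z _; rewrite funenegE -EFinN opprK EFin_max.
  have fp := integrable_fin_num mB ip.
  by rewrite lteBlDr// => h'; apply: lt_le_trans h' _; rewrite leey.
have := integrableB mB ip in_; apply: eq_integrable => // z _ /=.
rewrite -EFinB; congr _%:E; case: (leP (f z) 0) => h1; case: (leP (- f z) 0) => h2; lra.
Qed.

(** The second factor is finite because the first is positive. This makes [ln w] locally integrable,
    so that its mean is a real number to which Jensen's inequality applies. *)
Lemma Ar_le_Ainfty (r K : R) : 1 < r ->
  (forall a L s, 0 < L -> (mavg (ebox a L s) w *
     mavg (ebox a L (s + lag L)) (fun z => w z `^ (1 / (1 - r)))%R `^ (r - 1) <= K%:E)%E) ->
  forall a L s, 0 < L -> (mavg (ebox a L s) w *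
     expeR (mavg (ebox a L (s + lag L)) (fun z => ln (1 / w z))) <= K%:E)%E.
Proof.
move=> r1 hK; have r10 : 0 < r - 1 by rewrite subr_gt0.
have c0 : 1 / (1 - r) < 0 by rewrite mul1r invr_lt0 subr_lt0.
have hlt a L s : 0 < L ->
    (mavg (ebox a L (s + lag L)) (fun z => w z `^ (1 / (1 - r)))%R < +oo)%E.
  move=> L0; have bA := bounded_ebox p gamma (S := S) a L s.
  have [ew w0] := mavg_weight bA (vol_ebox_gt0 p gamma_lt1 (S := S) a s L0).
  rewrite ltey; apply/eqP => e; have := hK a L s L0.
  by rewrite e poweRyr ?gt_eqF// ew gt0_muley ?lte_fin.
have [lE lf] := loc_ln_of_neg_exp c0 hlt.
move=> a L s L0; apply: le_trans (hK a L s L0).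
have bA := bounded_ebox p gamma (S := S) a L s.
have bB := bounded_ebox p gamma (S := S) a L (s + lag L).
have A0 : 0 < vol (ebox a L s) by exact: vol_ebox_gt0.
have B0 : 0 < vol (ebox a L (s + lag L)) by exact: vol_ebox_gt0.
set B := ebox a L (s + lag L) in bB B0 *; have [mB _] := bB.
have [-> x0] := mavg_weight bA A0; apply: lee_wpmul2l; first by rewrite lee_fin ltW.
rewrite mavg_ln// (mavg_ae mB (measurable_weight_pow _) (measurable_exp_ln _) (weight_pow _)).
rewrite mavg_integ// poweR_EFin /= lee_fin.
have -> : - mean_on f B = 1 / (1 - r) * mean_on f B * (r - 1).
  have ne : 1 - r != 0 by rewrite lt_eqF// subr_lt0.
  by field.
rewrite expRM; apply: ge0_ler_powR; rewrite ?nnegrE ?expR_ge0 ?(ltW r10)//.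
  by rewrite divr_ge0 ?vol_ge0// integ_ge0// => z _; exact: expR_ge0.
exact: exp_jensen.
Qed.

(** Almost everywhere on [B], [w^(-1)] is at most the inverse of the essential infimum. An infimum
    equal to [+oo] would force [B] to be null; for an infimum equal to 0 the inverse is [+oo], and
    the bound is trivial. *)
Lemma A1_le_A2 (K : R) a L s (B := ebox a L (s + lag L)) : 0 < L ->
  (mavg (ebox a L s) w * (ess_inf mu (patch (cst +oo%E) B (EFin \o w)))^-1 <= K%:E)%E ->
  (mavg (ebox a L s) w * mavg B (fun z => w z `^ (1 / (1 - 2)))%R `^ (2 - 1) <= K%:E)%E.
Proof.
move=> L0; set e := ess_inf _ _.
have bA := bounded_ebox p gamma (S := S) a L s.
have bB : bounded_measurable B by exact: bounded_ebox.
have A0 : 0 < vol (ebox a L s) by exact: vol_ebox_gt0.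
have B0 : 0 < vol B by exact: vol_ebox_gt0.
have [mB _] := bB; have [-> x0] := mavg_weight bA A0; set x := integ _ _ / vol _ in x0 *.
have he : {ae mu, forall z, B z -> (e <= (w z)%:E)%E}.
  by apply: filterS (ess_inf_le mu (patch (cst +oo%E) B (EFin \o w))) => z + Bz;
    rewrite /patch mem_set.
have e0 : (0 <= e)%E.
  apply/ess_infP; apply: aeW => z; rewrite /patch; case: ifP => _; last exact: leey.
  by rewrite lee_fin.
move: e he e0 => [e| |] he // e0 hK; last first.
  exfalso; move: B0; rewrite vol_fine//.
  suff -> : mu B = 0%E by rewrite ltxx.
  case: he => [N [mN N0 hN]]; apply/eqP; rewrite -measure_le0 -N0.
  by apply: le_measure; rewrite ?inE// => z Bz; apply: hN => /(_ Bz).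
apply: le_trans hK; apply: lee_wpmul2l; first by rewrite lee_fin ltW.
have -> : 2 - 1 = 1 :> R by ring.
have -> : 1 / (1 - 2) = -1 :> R by field.
have wp z : 0 <= (w z `^ (-1))%R by exact: powR_ge0.
have m0 : (0 <= mavg B (fun z => w z `^ (-1))%R)%E.
  rewrite mavgE//; apply: mule_ge0; first by rewrite lee_fin invr_ge0 vol_ge0.
  by apply: integral_ge0 => z _; rewrite lee_fin.
rewrite poweRe1//; rewrite lee_fin in e0.
rewrite inver; case: eqP => [_|/eqP ne]; first exact: leey.
have e0' : 0 < e by rewrite lt_neqAle eq_sym ne.
rewrite mavgE//; apply: le_trans (_ : (vol B)^-1%:E * (e^-1 * vol B)%:E <= _)%E.
  apply: lee_wpmul2l; first by rewrite lee_fin invr_ge0 vol_ge0.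
  apply: le_trans (_ : \int[mu]_(z in B) (e^-1)%:E <= _)%E.
    apply: ae_ge0_le_integral => //.
    - by move=> z _; rewrite lee_fin.
    - apply/measurable_EFinP; apply: measurable_funTS; exact: measurable_weight_pow.
    - by move=> z _; rewrite lee_fin invr_ge0 ltW.
    - apply: filterS he => z + Bz => /(_ Bz); rewrite !lee_fin => h.
      by rewrite powR_inv1// lef_pV2// posrE// (lt_le_trans e0').
  by rewrite integral_cst// mu_vol.
by rewrite -EFinM mulrCA mulVf ?gt_eqF// mulr1.
Qed.

Lemma Ainfty_bound (K : R) :
  (forall a L s, 0 < L -> (mavg (ebox a L s) w *
     expeR (mavg (ebox a L (s + lag L)) (fun z => ln (1 / w z))) <= K%:E)%E) ->
  forall a L s, 0 < L -> integ (ebox a L s) (fun z => expR (f z)) <=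
     K * expR (emean f a L (s + lag L)) * vol (ebox a L s).
Proof.
move=> hK a L s L0; have lf := loc_ln_of_ln hK.
have bA := bounded_ebox p gamma (S := S) a L s.
have bB := bounded_ebox p gamma (S := S) a L (s + lag L).
have A0 : 0 < vol (ebox a L s) by exact: vol_ebox_gt0.
have B0 : 0 < vol (ebox a L (s + lag L)) by exact: vol_ebox_gt0.
have [ew _] := mavg_weight bA A0; have := hK a L s L0.
rewrite ew mavg_ln// -emeanE /= -EFinM lee_fin expRN.
by rewrite ler_pdivrMr ?expR_gt0// ler_pdivrMr.
Qed.

End one_weight.

(** The exponent depends on the weight only through the bound [K] of its A_infinity constant. *)
Lemma Ainfty_le_Ar (K : R) : 0 < K -> exists r C : R, 1 < r /\
  forall w, loc_integrable w -> (forall z, 0 <= w z) -> {ae mu, forall z, 0 < w z} ->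
  (forall a L s, 0 < L -> (mavg (ebox a L s) w *
     expeR (mavg (ebox a L (s + lag L)) (fun z => ln (1 / w z))) <= K%:E)%E) ->
  forall a L s, 0 < L -> (mavg (ebox a L s) w *
     mavg (ebox a L (s + lag L)) (fun z => w z `^ (1 / (1 - r)))%R `^ (r - 1) <= C%:E)%E.
Proof.
move=> K0; have [r [C [r1 C0 h]]] := core_exp (S := S) p_gt1 gamma_gt0 gamma_lt1 n_gt0 K0.
exists r, C; split=> // w lw w0 wp hK a L s L0.
have lf := loc_ln_of_ln lw w0 wp hK.
have [x [y [x0 y0 hxy hx hy]]] := h _ lf (loc_integrable_weight lw wp)
  (Ainfty_bound lw w0 wp hK) a L s L0.
have bA := bounded_ebox p gamma (S := S) a L s.
have bB := bounded_ebox p gamma (S := S) a L (s + lag L).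
have A0 : 0 < vol (ebox a L s) by exact: vol_ebox_gt0.
have B0 : 0 < vol (ebox a L (s + lag L)) by exact: vol_ebox_gt0.
have [ew we] := mavg_weight lw wp bA A0; rewrite ew.
rewrite (mavg_ae _ (measurable_weight_pow lw _) (measurable_exp_ln lw _) (weight_pow wp _));
  last by case: bB.
set m := mavg _ _.
have m0 : (0 <= m)%E.
  rewrite /m mavgE//; apply: mule_ge0; first by rewrite lee_fin invr_ge0 vol_ge0.
  by apply: integral_ge0 => z _; rewrite lee_fin expR_ge0.
have my : (m <= y%:E)%E.
  rewrite /m mavgE//; apply: le_trans (lee_wpmul2l _ hy) _.
    by rewrite lee_fin invr_ge0 vol_ge0.
  by rewrite vol_ebox// -EFinM mulrCA mulVf ?mulr1// -(vol_ebox (S := S) p gamma_lt1 a s L0) gt_eqF.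
apply: le_trans (_ : x%:E * (y `^ (r - 1))%:E <= _)%E; last by rewrite -EFinM lee_fin.
apply: lee_pmul.
- by rewrite lee_fin ltW.
- exact: poweR_ge0.
- by rewrite lee_fin ler_pdivrMr// vol_ebox.
- rewrite -poweR_EFin; apply: gt0_ler_poweR; rewrite ?in_itv/= ?m0 ?leey ?lee_fin ?y0//.
  by rewrite subr_ge0 ltW.
Qed.

End weights.

Section spacetime_weights.
Context {R : realType} {n : nat}.
Hypothesis n_gt0 : (0 < n)%N.
Variables (p gamma : R).
Hypotheses (p_gt1 : 1 < p) (gamma_gt0 : 0 < gamma) (gamma_lt1 : gamma < 1).
Local Notation E := (spacetime R n).
Local Notation mu := (@lebesgue_spacetime R n).
Local Notation S := (st_box_space R n false).
Local Notation lag := (lag p gamma).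
Local Notation ebox := (@ebox R n S p gamma).
Local Notation rect := (@parabolic_rectangle R n).
Implicit Types (w g : E -> R) (Q : rect).

Lemma avg_mavg (A : set E) (B : set S) g : ae_same A B -> measurable_fun setT g ->
  avg A g = mavg (S := S) B g.
Proof.
move=> AB mg; rewrite /avg /mavg (ae_same_mu AB).
have mg' : measurable_fun setT (EFin \o g) by apply/measurable_EFinP.
by rewrite (ae_same_integral AB mg').
Qed.

Lemma avg_minus Q g : measurable_fun setT g -> avg (rect_minus p gamma Q) g =
  mavg (S := S) (ebox (rect_corner Q) (rect_edge Q) (rect_start p false Q)) g.
Proof. exact: avg_mavg (early_ae p gamma false Q). Qed.

Lemma avg_plus Q g : measurable_fun setT g -> avg (rect_plus p gamma Q) g =
  mavg (S := S) (ebox (rect_corner Q) (rect_edge Q)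
    (rect_start p false Q + lag (rect_edge Q))) g.
Proof. exact: avg_mavg (late_ae p gamma false Q). Qed.

Lemma ess_inf_plus Q w : ess_inf_on (rect_plus p gamma Q) w =
  ess_inf (bs_mu S) (patch (cst +oo%E) (ebox (rect_corner Q) (rect_edge Q)
    (rect_start p false Q + lag (rect_edge Q))) (EFin \o w)).
Proof.
have [_ _ [N [mN N0 hN]]] := late_ae p gamma false Q.
apply: eq_ess_inf; exists N; split; [exact: mN|exact: N0|].
move=> z /= hz; apply: contrapT => Nz; apply: hz.
rewrite /patch; congr (if _ then _ else _).
have [h1 h2] : (late p gamma false Q `\` N) z <->
    (@ebox_late R n p gamma false Q `\` N) z by rewrite hN.
apply/idP/idP; rewrite !inE => hz.
  by have [] := h1 (conj hz Nz).
by have [] := h2 (conj hz Nz).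
Qed.

Lemma sup_rectP (F : rect -> \bar R) (H : ('I_n -> R) -> R -> R -> \bar R) (K : \bar R) :
  (forall Q, F Q = H (rect_corner Q) (rect_edge Q) (rect_start p false Q)) ->
  (sup_rect F <= K)%E <-> forall a L s, 0 < L -> (H a L s <= K)%E.
Proof.
move=> FH; split=> [h a L s L0|h].
  have [Q [<- <- <-]] := ex_rect p false a s L0; rewrite -FH; apply: le_trans h.
  by apply: ereal_sup_ubound; exists Q.
by apply: ge_ereal_sup => _ [Q _ <-]; rewrite FH; apply: h; exact: rect_edge_gt0.
Qed.

Section one_weight.
Variable w : E -> R.
Hypothesis weight_w : weight w.

Let lw : loc_integrable (S := S) w.
Proof. by case: weight_w => Lw _ _; exact: L1loc_integrable. Qed.
Let w0 z : 0 <= w z. Proof. by case: weight_w. Qed.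
Let wp : {ae bs_mu S, forall z, 0 < w z}. Proof. by case: weight_w. Qed.
Let mw : measurable_fun setT w. Proof. by case: weight_w => -[]. Qed.

Lemma Ainfty_constP (K : \bar R) : (Ainfty_plus_const p gamma w <= K)%E <->
  forall a L s, 0 < L -> (mavg (S := S) (ebox a L s) w *
    expeR (mavg (S := S) (ebox a L (s + lag L)) (fun z => ln (1 / w z))) <= K)%E.
Proof.
apply: (sup_rectP (H := fun a L s => (mavg (S := S) (ebox a L s) w *
  expeR (mavg (S := S) (ebox a L (s + lag L)) (fun z => ln (1 / w z))))%E)) => Q.
by rewrite (avg_minus Q mw) (avg_plus Q (measurable_weight_ln lw w0)).
Qed.

Lemma Ar_constP (r : R) (K : \bar R) : (Ar_plus_const p gamma r w <= K)%E <->
  forall a L s, 0 < L -> (mavg (S := S) (ebox a L s) w *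
    mavg (S := S) (ebox a L (s + lag L)) (fun z => w z `^ (1 / (1 - r)))%R `^ (r - 1)
      <= K)%E.
Proof.
apply: (sup_rectP (H := fun a L s => (mavg (S := S) (ebox a L s) w *
  mavg (S := S) (ebox a L (s + lag L)) (fun z => w z `^ (1 / (1 - r)))%R `^ (r - 1))%E)) => Q.
by rewrite (avg_minus Q mw) (avg_plus Q (measurable_weight_pow lw _)).
Qed.

Lemma A1_constP (K : \bar R) : (A1_plus_const p gamma w <= K)%E <->
  forall a L s, 0 < L -> (mavg (S := S) (ebox a L s) w *
    (ess_inf (bs_mu S) (patch (cst +oo%E) (ebox a L (s + lag L)) (EFin \o w)))^-1 <= K)%E.
Proof.
apply: (sup_rectP (H := fun a L s => (mavg (S := S) (ebox a L s) w *
  (ess_inf (bs_mu S) (patch (cst +oo%E) (ebox a L (s + lag L)) (EFin \o w)))^-1)%E)) => Q.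
by rewrite (avg_minus Q mw) ess_inf_plus.
Qed.

Lemma A1_const_le (K : R) : (A1_plus_const p gamma w <= K%:E)%E ->
  (Ainfty_plus_const p gamma w <= K%:E)%E.
Proof.
move=> /A1_constP h; apply/Ainfty_constP.
apply: (Ar_le_Ainfty p_gt1 gamma_gt0 gamma_lt1 lw w0 wp (r := 2)); first by rewrite ltr1n.
move=> a L s L0; exact: (A1_le_A2 gamma_lt1 lw w0 wp L0 (h a L s L0)).
Qed.

Lemma Ar_const_le (r K : R) : 1 < r -> (Ar_plus_const p gamma r w <= K%:E)%E ->
  (Ainfty_plus_const p gamma w <= K%:E)%E.
Proof.
move=> r1 /Ar_constP h; apply/Ainfty_constP.
exact: (Ar_le_Ainfty p_gt1 gamma_gt0 gamma_lt1 lw w0 wp r1 h).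
Qed.

End one_weight.

Lemma Ainfty_const_le (K : R) : 0 < K -> exists r C : R, 1 < r /\ forall w, weight w ->
  (Ainfty_plus_const p gamma w <= K%:E)%E -> (Ar_plus_const p gamma r w <= C%:E)%E.
Proof.
move=> K0; have [r [C [r1 h]]] :=
  Ainfty_le_Ar (S := S) n_gt0 p_gt1 gamma_gt0 gamma_lt1 K0.
exists r, C; split=> // w weight_w /(Ainfty_constP weight_w) hw.
have [Lw w0 wp] := weight_w.
apply/(Ar_constP weight_w); exact: h (L1loc_integrable false Lw) w0 wp hw.
Qed.

Lemma lty_le_EFin (x : \bar R) : (x < +oo)%E -> exists2 K : R, 0 < K & (x <= K%:E)%E.
Proof.
case: x => [x| |] // _; last by exists 1 => //; exact: leNye.
exists (Num.max x 1); first by rewrite lt_max ltr01 orbT.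
by rewrite lee_fin le_max lexx.
Qed.

Lemma A_plus_bigcup : @A_plus R n p gamma +oo%E =
  \bigcup_(r in [set r : R | 1 <= r]) A_plus p gamma r%:E.
Proof.
apply/seteqP; split=> [w [weight_w /lty_le_EFin[K K0 hK]]|w [r r1 [weight_w]]].
  have [r [C [r1 h]]] := Ainfty_const_le K0.
  exists r; first exact: ltW.
  split; [exact: weight_w|rewrite /A_plus_const gt_eqF//].
  exact: le_lt_trans (h w weight_w hK) (ltry _).
rewrite /A_plus_const; case: eqP => [_|/eqP ne] /lty_le_EFin[K K0 hK]; split=> //.
  exact: le_lt_trans (A1_const_le weight_w hK) (ltry _).
have r1' : 1 < r by rewrite lt_neqAle eq_sym ne.
exact: le_lt_trans (Ar_const_le weight_w r1' hK) (ltry _).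
Qed.

End spacetime_weights.

Theorem theorem1p2 (R : realType) (n : nat) (n_gt0 : (0 < n)%N)
    (p : R) (p_gt1 : 1 < p) (gamma : R) (gamma_gt0 : 0 < gamma)
    (gamma_lt1 : gamma < 1) :
  (* (i) *)
  ([/\ @PBMO_minus R n p gamma = BMO_plus p gamma,
       @BMO_plus R n p gamma = opp_BMO_minus p gamma,
       equivalent_on (@L1loc R n)
         (PBMO_minus_norm p gamma) (BMO_plus_norm p gamma) &
       equivalent_on (@L1loc R n)
         (BMO_plus_norm p gamma) (fun f => BMO_minus_norm p gamma (\- f))]) /\
  (* (ii) *)
  @A_plus R n p gamma +oo%E =
    \bigcup_(r in [set r : R | 1 <= r]) A_plus p gamma r%:E.
Proof.
split; last exact: A_plus_bigcup.
(* The four comparisons that follow are instances of two lemmas: by conversion, [bmo_norm] of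
   [signed] is the BMO^+ norm of [f] for [past] false and the BMO^- norm of [- f] for [past]
   true. *)
have [Cp Cp0 plus_le] : exists2 C : R, 0 < C & forall f, L1loc f ->
    (@PBMO_minus_norm R n p gamma f <= C%:E * BMO_plus_norm p gamma f)%E.
  exact (PBMO_le_bmo_norm n_gt0 p_gt1 gamma_gt0 gamma_lt1 false).
have [Cm Cm0 minus_le] : exists2 C : R, 0 < C & forall f, L1loc f ->
    (@PBMO_minus_norm R n p gamma f <= C%:E * BMO_minus_norm p gamma (\- f)%R)%E.
  exact (PBMO_le_bmo_norm n_gt0 p_gt1 gamma_gt0 gamma_lt1 true).
have ge_plus (f : spacetime R n -> R) : L1loc f ->
    (BMO_plus_norm p gamma f <= @PBMO_minus_norm R n p gamma f)%E.
  exact: (bmo_norm_le_PBMO p gamma_lt1 false).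
have ge_minus (f : spacetime R n -> R) : L1loc f ->
    (BMO_minus_norm p gamma (\- f)%R <= @PBMO_minus_norm R n p gamma f)%E.
  exact: (bmo_norm_le_PBMO p gamma_lt1 true).
have plus_minus (f : spacetime R n -> R) : L1loc f ->
    (BMO_plus_norm p gamma f <= Cm%:E * BMO_minus_norm p gamma (\- f)%R)%E.
  move=> Lf.
  exact: le_trans (ge_plus f Lf) (minus_le f Lf).
have minus_plus (f : spacetime R n -> R) : L1loc f ->
    (BMO_minus_norm p gamma (\- f)%R <= Cp%:E * BMO_plus_norm p gamma f)%E.
  move=> Lf.
  exact: le_trans (ge_minus f Lf) (plus_le f Lf).
have lty (C : R) (x : \bar R) : 0 < C -> (x < +oo)%E -> (C%:E * x < +oo)%E.
  by move=> C0 x_lty; rewrite lte_mul_pinfty// lee_fin ltW.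
split.
- apply/seteqP; split=> f [Lf h]; split=> //.
    exact: le_lt_trans (ge_plus f Lf) h.
  exact: le_lt_trans (plus_le f Lf) (lty Cp _ Cp0 h).
- apply/seteqP; split=> f [Lf h].
    split; first exact: L1loc_opp.
    exact: le_lt_trans (minus_plus f Lf) (lty Cp _ Cp0 h).
  have {}Lf : L1loc f.
    by have := L1loc_opp Lf; congr L1loc; apply/funext => z; rewrite /= opprK.
  split; first exact: Lf.
  exact: le_lt_trans (plus_minus f Lf) (lty Cm _ Cm0 h).
- split; first by exists Cp => // f Lf; exact: plus_le.
  by exists 1 => // f Lf; rewrite mul1e; exact: ge_plus.
- by split; [exists Cm|exists Cp].
Qed.
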